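(* Let $G$ be one of the $17$ wallpaper groups. Then $\mathcal W(G)\ne \mathcal W_0(G)$ if and only if either (i) $G$ is a direct product of (at least two) non-abelian groups, or (ii) $G$ contains only translations and rotations, with some rotation of order greater than two. Moreover, if $G$ has rotations of order at least four, then there is a normal subgroup $\mathcal N(G)\triangleleft \mathcal W(G)$, all of whose non-identity elements are non-trivial (that is, lie in $\mathcal W(G)\setminus\mathcal W_0(G)$), such that $\mathcal W(G)=\mathcal N(G)\rtimes \mathcal W_0(G)$ (internal semidirect product).
   Context: For a group $G$, $\sim$ denotes conjugacy in $G$. The weak Cayley table group $\mathcal W(G)$ is the group (under composition) of all bijections $f:G\to G$ such that $f(g_1g_2)\sim f(g_1)f(g_2)$ for all $g_1,g_2\in G$. It contains $\operatorname{Aut}(G)$ and the inversion map $\iota:g\mapsto g^{-1}$. Put $\mathcal W_0(G)=\langle \operatorname{Aut}(G),\iota\rangle\le \mathcal W(G)$. Elements of $\mathcal W(G)\setminus \mathcal W_0(G)$ are called non-trivial. A wallpaper group is a discrete group of isometries of the Euclidean plane whose subgroup of translations is isomorphic to $\mathbb Z^2$. Two such groups are considered equivalent if they are conjugate by an affine transformation; there are $17$ equivalence classes. The elements of a wallpaper group are translations, rotations, reflections and glide reflections. *)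

(* Defs.v *)
From HB Require Import structures.
From mathcomp Require Import all_boot all_order all_algebra.
From mathcomp Require Import all_classical all_reals all_analysis.

Set Implicit Arguments.
Unset Strict Implicit.
Unset Printing Implicit Defensive.

Import Order.TTheory GRing.Theory Num.Theory.
Import numFieldNormedType.Exports.

Local Open Scope classical_set_scope.
Local Open Scope ring_scope.
Local Open Scope group_scope.

(* The symmetric group of an arbitrary type; the product f * g is f \o g. *)
Record bijection (T : Type) := Bijection {
  bij_fun :> T -> T;
  bij_funP : bijective bij_fun }.

HB.instance Definition _ (T : Type) := gen_eqMixin (bijection T).
HB.instance Definition _ (T : Type) := gen_choiceMixin (bijection T).

Section BijectionGroup.
Variable T : Type.
Implicit Types f g h : bijection T.

Lemma bijectionP f g : f =1 g -> f = g.
Proof.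
case: f g => [f fP] [g gP] /= /funext fg.
by subst g; congr Bijection; exact: Prop_irrelevance.
Qed.

Definition bij_one : bijection T :=
  @Bijection T id (@Bijective T T id id (fun=> erefl) (fun=> erefl)).

Definition bij_mul f g : bijection T :=
  Bijection (bij_comp (bij_funP f) (bij_funP g)).

Lemma bij_inv_subproof f : {g : bijection T | cancel f g /\ cancel g f}.
Proof.
apply: cid; case: f => f fP /=; case: (fP) => g fK gK.
by exists (Bijection (Bijective gK fK)).
Qed.

Definition bij_inv f : bijection T := sval (bij_inv_subproof f).

Lemma bij_mulA : associative bij_mul.
Proof. by move=> f g h; exact: bijectionP. Qed.
Lemma bij_mul1 : left_id bij_one bij_mul.
Proof. by move=> f; exact: bijectionP. Qed.
Lemma bij_mulr1 : right_id bij_one bij_mul.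
Proof. by move=> f; exact: bijectionP. Qed.
Lemma bij_mulV : left_inverse bij_one bij_inv bij_mul.
Proof.
by move=> f; apply: bijectionP; exact: (svalP (bij_inv_subproof f)).1.
Qed.
Lemma bij_mulrV : right_inverse bij_one bij_inv bij_mul.
Proof.
by move=> f; apply: bijectionP; exact: (svalP (bij_inv_subproof f)).2.
Qed.

HB.instance Definition _ :=
  isGroup.Build (bijection T) bij_mulA bij_mul1 bij_mulr1 bij_mulV bij_mulrV.

End BijectionGroup.

Section GroupTheory.

(* A subgroup, regarded as a group in its own right. *)
Definition elts (gT : groupType) (G : groupClosed gT) := {x : gT | x \in G}.

HB.instance Definition _ (gT : groupType) (G : groupClosed gT) :=
  SubChoice.on (elts G).

Lemma elts_group_closed (gT : groupType) (G : groupClosed gT) :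
  group_closed (fun x : gT => x \in G).
Proof. by split=> [|x y xG yG]; [exact: gpred1 | exact: gpredF]. Qed.

HB.instance Definition _ (gT : groupType) (G : groupClosed gT) :=
  SubChoice_isSubGroup.Build gT (fun x : gT => x \in G) (elts G)
    (elts_group_closed G).

Definition generated (gT : groupType) (A : set gT) : set gT :=
  [set x | forall S : groupClosed gT, A `<=` [set` S] -> x \in S].

Definition conjugate (gT : groupType) (x y : gT) := exists z : gT, y = x ^ z.

Definition nonabelian (gT : groupType) := exists x y : gT, x * y != y * x.

Definition has_order (gT : groupType) (x : gT) (n : nat) :=
  [/\ (0 < n)%N, x ^+ n = 1
    & forall m : nat, (0 < m < n)%N -> x ^+ m != 1].

Definition product_of_nonabelian (gT : groupType) :=
  exists (k : nat) (H : 'I_k -> groupType) (phi : gT -> forall i, H i),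
    [/\ (2 <= k)%N, forall i, nonabelian (H i), bijective phi
      & forall x y i, phi (x * y) i = phi x i * phi y i].

Definition normal_in (gT : groupType) (N : groupClosed gT) (W : set gT) :=
  [set` N] `<=` W /\ forall n w : gT, n \in N -> W w -> n ^ w \in N.

(* W is the internal semidirect product of its normal subgroup N by H. That W
   is a subgroup is not presupposed: for a subgroup H, it follows from the four
   clauses. *)
Definition semidirect (gT : groupType) (W : set gT) (N : groupClosed gT)
    (H : set gT) :=
  [/\ normal_in N W, H `<=` W, [set` N] `&` H = [set 1]
    & W = [set n * h | n in [set` N] & h in H]].

End GroupTheory.

(* For arbitrary infinite G, weak_cayley G need not be closed under inverses,
   so it is a plain set. *)
Section WeakCayley.
Variable G : groupType.

Definition weak_cayley : set (bijection G) :=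
  [set f | forall x y : G, conjugate (f (x * y)) (f x * f y)].

Definition automorphisms : set (bijection G) :=
  [set f | {morph f : x y / x * y >-> x * y}].

Definition inversion : bijection G := Bijection (Bijective (@invgK G) (@invgK G)).

Definition weak_cayley0 : set (bijection G) :=
  generated (automorphisms `|` [set inversion]).

End WeakCayley.

Arguments weak_cayley : clear implicits.
Arguments automorphisms : clear implicits.
Arguments inversion : clear implicits.
Arguments weak_cayley0 : clear implicits.

Section Plane.
Variable R : realType.
Local Open Scope ring_scope.

(* The library norm on 'rV[R]_2 is the sup norm, hence this definition. *)
Definition euclid_dist (x y : 'rV[R]_2) : R :=
  Num.sqrt (\sum_(i < 2) (x 0 i - y 0 i) ^+ 2).

Definition is_isometry (f : 'rV[R]_2 -> 'rV[R]_2) :=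
  forall x y, euclid_dist (f x) (f y) = euclid_dist x y.

Definition is_translation (f : 'rV[R]_2 -> 'rV[R]_2) :=
  exists v, forall x, f x = x + v.

Definition rotate (t : R) (x : 'rV[R]_2) : 'rV[R]_2 :=
  \row_(j < 2) (if j == 0 then cos t * x 0 0 - sin t * x 0 1
                else sin t * x 0 0 + cos t * x 0 1).

Definition is_rotation (f : 'rV[R]_2 -> 'rV[R]_2) :=
  exists (c : 'rV[R]_2) (t : R), forall x, f x = c + rotate t (x - c).

(* Every point of G is isolated for the compact-open topology, the usual
   topology on the isometry group. *)
Definition discrete_group (G : groupClosed (bijection 'rV[R]_2)) :=
  let F : set {compact-open, 'rV[R]_2 -> 'rV[R]_2} :=
    [set bij_fun g | g in [set` G]] in
  F `<=` isolated F.

Definition translations_Z2 (G : groupClosed (bijection 'rV[R]_2)) :=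
  exists phi : int * int -> bijection 'rV[R]_2,
    [/\ injective phi, {morph phi : u v / u + v >-> (u * v)%g}
      & range phi = [set g | g \in G /\ is_translation g]].

Definition wallpaper_group (G : groupClosed (bijection 'rV[R]_2)) :=
  [/\ forall g : bijection 'rV[R]_2, g \in G -> is_isometry g,
      discrete_group G & translations_Z2 G].

End Plane.

(* Main.v *)
From HB Require Import structures.
From mathcomp Require Import all_boot all_order all_algebra.
From mathcomp Require Import all_classical all_reals all_analysis.
From mathcomp Require Import lra zify.
Require Import Defs.

(* A weak Cayley map f sends every translation to a translation: a non-translation
   has infinitely many conjugates and a translation finitely many, and f induces an
   injection of the finite point group. On the translation lattice L, f preserves the
   Euclidean norm of sums, hence is additive by polarization, say f = Phi; more
   generally f (v x) = R_x (Phi v) f (x) for an element R_x of the point group. To find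
   R_x, and throughout, one uses that if for each lattice vector one of finitely many
   affine conditions holds, then one of them holds identically.

   If x is a reflection or glide reflection, comparing the squares of conjugate elements
   shows that R_x is 1 or the linear part of f (x). If R_x = 1 for all these x, then the
   defect of f from a homomorphism is a 2-cocycle of the point group whose value on two
   reflections is normal to two different mirrors, so it vanishes and f is an
   automorphism. The opposite case gives an anti-automorphism. A mixture forces the point
   group to be {1, -1, B, -B} and the group to be a product of two infinite dihedral
   groups.

   If there are only rotations and one, say r, has order 4 or 6, then f agrees on the coset
   L r with an automorphism or anti-automorphism, so the maps fixing L r pointwise form
   the required complement. A non-trivial map is obtained by conjugating, by a suitable
   element, only the translations and half-turns. *)
Set Implicit Arguments.
Unset Strict Implicit.
Unset Printing Implicit Defensive.

Import Order.TTheory GRing.Theory Num.Theory.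
Import numFieldNormedType.Exports.

Local Open Scope classical_set_scope.
Local Open Scope ring_scope.
Local Open Scope group_scope.

(** * Linear isometries of the plane *)

(** A conjugacy hides its conjugating element, but that element acts on translations only through
    its linear part, which ranges over a finite set. This is the source of the finitely many affine
    conditions; they become uniform because a product of polynomials vanishing at all natural
    numbers has a zero factor. For h with a reflection C as linear part, h h is the translation by v
    + C v, v the translation part of h. Conjugation preserving C changes this vector at most by
    sign, and almost all information about f is read off this one invariant. Composing f with
    inversion exchanges the two possible values of R_x at reflections. In a mixture, the linear part
    of the image of a rotation is both its conjugate by Phi and the inverse of that conjugate; hence
    only 1 and -1 remain. For an infinite group it is not clear that the inverse of a weak Cayley
    map is one. For the complement this is recovered from a 12th power, 12 being a common multiple
    of 4 and 6. *)

Lemma vec2P (R : realType) (x y : 'rV[R]_2) :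
  x 0%R 0%R = y 0%R 0%R -> x 0%R 1%R = y 0%R 1%R -> x = y.
Proof.
move=> e0 e1; apply/rowP => i.
have [->|->] : i = 0%R \/ i = 1%R by case: i => [[|[|//]]] p; [left|right]; apply: val_inj.
  exact: e0.
exact: e1.
Qed.

Ltac vsplit H := let h0 := fresh "hv" in let h1 := fresh "hv" in
  have h0 := congr1 (fun v : 'rV_2 => v 0%R 0%R) H;
  have h1 := congr1 (fun v : 'rV_2 => v 0%R 1%R) H;
  rewrite ?mxE /= in h0; rewrite ?mxE /= in h1.

Ltac vlra := apply: vec2P; rewrite ?mxE /=; lra.

Section Plane.
Variable R : realType.
Notation V := 'rV[R]_2.
Notation B := (bijection V).
Implicit Types (x y z : V) (A C D : B).

Lemma bijK (T : Type) (A : bijection T) : cancel A (A^-1)%g.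
Proof. by move=> x; rewrite -[LHS]/((A^-1 * A) x) mulVg. Qed.

Lemma bijVK (T : Type) (A : bijection T) : cancel (A^-1)%g A.
Proof. by move=> x; rewrite -[LHS]/((A * A^-1) x) mulgV. Qed.

Lemma bij_inj (T : Type) (A : bijection T) : injective A.
Proof. exact: can_inj (@bijK _ A). Qed.

(** With the plane read as the complex numbers, this is multiplication by the unit c + i s; [refl]
    below is complex conjugation followed by such a multiplication. *)
Definition rotn A := exists c s : R, (c ^+ 2 + s ^+ 2 = 1)%R /\
  forall z, A z 0%R 0%R = (c * z 0 0 - s * z 0 1)%R /\
            A z 0%R 1%R = (s * z 0 0 + c * z 0 1)%R.

Definition refl A := exists c s : R, (c ^+ 2 + s ^+ 2 = 1)%R /\
  forall z, A z 0%R 0%R = (c * z 0 0 + s * z 0 1)%R /\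
            A z 0%R 1%R = (s * z 0 0 - c * z 0 1)%R.

Definition isom A := rotn A \/ refl A.

Definition linear_bij A := forall (k : R) x y, A (k *: x + y) = k *: A x + A y.

Lemma linear_bijD A x y : linear_bij A -> A (x + y) = A x + A y.
Proof. by move=> h; rewrite -[x]scale1r h !scale1r. Qed.

Lemma linear_bij0 A : linear_bij A -> A 0 = 0.
Proof. by move=> h; apply: (addIr (A 0)); rewrite -linear_bijD// !add0r. Qed.

Lemma linear_bijZ A k x : linear_bij A -> A (k *: x) = k *: A x.
Proof. by move=> h; rewrite -[k *: x]addr0 h linear_bij0// addr0. Qed.

Lemma linear_bijN A x : linear_bij A -> A (- x) = - A x.
Proof. by move=> h; rewrite -scaleN1r linear_bijZ// scaleN1r. Qed.

Lemma linear_bijM A C : linear_bij A -> linear_bij C -> linear_bij (A * C).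
Proof. by move=> hA hC k x y; rewrite /= hC hA. Qed.

Lemma linear_bijV A : linear_bij A -> linear_bij A^-1.
Proof. by move=> hA k x y; apply: (@bij_inj _ A); rewrite hA !bijVK. Qed.

Lemma isom_linear A : isom A -> linear_bij A.
Proof.
case=> -[c [s [_ h]]] k x y; apply: vec2P; rewrite !mxE.
- by rewrite !(h _).1 !mxE; lra.
- by rewrite !(h _).2 !mxE; lra.
- by rewrite !(h _).1 !mxE; lra.
- by rewrite !(h _).2 !mxE; lra.
Qed.

Lemma isomD A x y : isom A -> A (x + y) = A x + A y.
Proof. by move=> /isom_linear; exact: linear_bijD. Qed.
Lemma isomN A x : isom A -> A (- x) = - A x.
Proof. by move=> /isom_linear; exact: linear_bijN. Qed.
Lemma isomB A x y : isom A -> A (x - y) = A x - A y.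
Proof. by move=> h; rewrite isomD// isomN. Qed.
Lemma isomZ A k x : isom A -> A (k *: x) = k *: A x.
Proof. by move=> /isom_linear; exact: linear_bijZ. Qed.
Lemma isom0 A : isom A -> A 0 = 0.
Proof. by move=> /isom_linear; exact: linear_bij0. Qed.

(** Multiplicativity of the complex norm; [unit2MV] is the same with the second factor
    conjugated. *)
Lemma unit2M (c s c' s' : R) : (c ^+ 2 + s ^+ 2 = 1)%R -> (c' ^+ 2 + s' ^+ 2 = 1)%R ->
  ((c * c' - s * s') ^+ 2 + (s * c' + c * s') ^+ 2 = 1)%R.
Proof.
by move=> e e'; transitivity ((c ^+ 2 + s ^+ 2) * (c' ^+ 2 + s' ^+ 2))%R; [lra|rewrite e e' mulr1].
Qed.

Lemma unit2MV (c s c' s' : R) : (c ^+ 2 + s ^+ 2 = 1)%R -> (c' ^+ 2 + s' ^+ 2 = 1)%R ->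
  ((c * c' + s * s') ^+ 2 + (s * c' - c * s') ^+ 2 = 1)%R.
Proof.
by move=> e e'; transitivity ((c ^+ 2 + s ^+ 2) * (c' ^+ 2 + s' ^+ 2))%R; [lra|rewrite e e' mulr1].
Qed.

Lemma rotn1 : rotn 1.
Proof. by exists 1%R, 0%R; split=> [|z]; [lra|split; rewrite /=; lra]. Qed.

Lemma rotnM A C : rotn A -> rotn C -> rotn (A * C).
Proof.
move=> [c [s [e h]]] [c' [s' [e' h']]]; exists (c * c' - s * s')%R, (s * c' + c * s')%R.
split=> [|z]; first exact: unit2M.
by split; rewrite /= ?(h _).1 ?(h _).2 ?(h' _).1 ?(h' _).2; lra.
Qed.

Lemma rotn_reflM A C : rotn A -> refl C -> refl (A * C).
Proof.
move=> [c [s [e h]]] [c' [s' [e' h']]]; exists (c * c' - s * s')%R, (s * c' + c * s')%R.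
split=> [|z]; first exact: unit2M.
by split; rewrite /= ?(h _).1 ?(h _).2 ?(h' _).1 ?(h' _).2; lra.
Qed.

Lemma refl_rotnM A C : refl A -> rotn C -> refl (A * C).
Proof.
move=> [c [s [e h]]] [c' [s' [e' h']]]; exists (c * c' + s * s')%R, (s * c' - c * s')%R.
split=> [|z]; first exact: unit2MV.
by split; rewrite /= ?(h _).1 ?(h _).2 ?(h' _).1 ?(h' _).2; lra.
Qed.

Lemma reflM A C : refl A -> refl C -> rotn (A * C).
Proof.
move=> [c [s [e h]]] [c' [s' [e' h']]]; exists (c * c' + s * s')%R, (s * c' - c * s')%R.
split=> [|z]; first exact: unit2MV.
by split; rewrite /= ?(h _).1 ?(h _).2 ?(h' _).1 ?(h' _).2; lra.
Qed.

Lemma rotnC A C : rotn A -> rotn C -> A * C = C * A.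
Proof.
move=> [c [s [e h]]] [c' [s' [e' h']]]; apply: bijectionP => z.
by apply: vec2P; rewrite /= ?(h _).1 ?(h _).2 ?(h' _).1 ?(h' _).2 ?(h _).1 ?(h _).2 ; lra.
Qed.

Lemma reflK A : refl A -> A * A = 1.
Proof.
move=> [c [s [e h]]]; apply: bijectionP => z.
by apply: vec2P; rewrite /= ?(h _).1 ?(h _).2 ?(h _).1 ?(h _).2 -[RHS]mul1r -[in RHS]e; lra.
Qed.

Lemma reflV A : refl A -> A^-1 = A.
Proof. by move=> h; apply: (mulgI A); rewrite mulgV reflK. Qed.

Lemma rotn_fix A z : rotn A -> A <> 1 -> A z = z -> z = 0.
Proof.
move=> [c [s [e h]]] A1 Az.
have c1 : c != 1%R.
  apply/eqP => c1; apply: A1; apply: bijectionP => w.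
  have s0 : s = 0%R by apply/eqP; rewrite -sqrf_eq0; apply/eqP; move: e; rewrite c1; lra.
  by apply: vec2P; rewrite /= ?(h _).1 ?(h _).2 c1 s0; lra.
have := h z; rewrite Az => -[h1 h2].
have cb : (1 - c != 0)%R by rewrite subr_eq0 eq_sym.
(* The coordinates of [A z = z] read (1 - c) z0 = - s z1 and (1 - c) z1 = s z0, so (1 - c) |z|^2
   cancels to zero. *)
have z0 : (z 0 0 ^+ 2 + z 0 1 ^+ 2 = 0)%R.
  apply: (mulfI cb); rewrite mulr0.
  have -> : ((1 - c) * (z 0 0 ^+ 2 + z 0 1 ^+ 2) = ((1 - c) * z 0 0) * z 0 0 + ((1 - c) * z 0 1) * z 0 1)%R by lra.
  rewrite (_ : (1 - c) * z 0 0 = - s * z 0 1)%R; last by lra.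
  rewrite (_ : (1 - c) * z 0 1 = s * z 0 0)%R; last by lra.
  by lra.
move/eqP: z0; rewrite paddr_eq0 ?sqr_ge0// !sqrf_eq0 => /andP[/eqP z0 /eqP z1].
by apply: vec2P; rewrite ?z0 ?z1 mxE.
Qed.

Lemma isom1 : isom 1. Proof. by left; exact: rotn1. Qed.

Lemma isomM A C : isom A -> isom C -> isom (A * C).
Proof.
move=> [hA|hA] [hC|hC]; [left|right|right|left].
- exact: rotnM.
- exact: rotn_reflM.
- exact: refl_rotnM.
- exact: reflM.
Qed.

Lemma rotnV A : rotn A -> rotn A^-1.
Proof.
move=> [c [s [e h]]]; exists c, (- s)%R; split=> [|z]; first by rewrite sqrrN.
suff -> : A^-1 z = \row_j (if j == 0 then c * z 0 0 + s * z 0 1 else - s * z 0 0 + c * z 0 1)%R.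
  by rewrite !mxE /=; split; lra.
apply: (@bij_inj _ A); rewrite bijVK; apply: vec2P; rewrite ?(h _).1 ?(h _).2 !mxE /= -[LHS]mul1r -[in LHS]e; lra.
Qed.

Lemma isomV A : isom A -> isom A^-1.
Proof. by case=> h; [left; exact: rotnV|right; rewrite reflV]. Qed.

Lemma rotn_nrefl A : rotn A -> ~ refl A.
Proof.
move=> [c [s [e h]]] [c' [s' [e' h']]].
have := (h (\row_j (j == 0)%:R)%R); have := (h' (\row_j (j == 0)%:R)%R).
have := (h (\row_j (j == 1)%:R)%R); have := (h' (\row_j (j == 1)%:R)%R).
rewrite !mxE /= => -[->->] [? ?] [->->] [? ?].
have c0 : c = 0%R by lra.
have s0 : s = 0%R by lra.
by move: e; rewrite c0 s0; lra.
Qed.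

Lemma negP_subproof : bijective (fun x : V => - x).
Proof. by exists (fun x : V => - x) => x; rewrite opprK. Qed.
Definition neg : B := Bijection negP_subproof.

Lemma rotn_neg : rotn neg.
Proof. by exists (- 1)%R, 0%R; split=> [|z]; [lra|rewrite !mxE; split; lra]. Qed.

Lemma negM : neg * neg = 1.
Proof. by apply: bijectionP => z /=; rewrite opprK. Qed.

Lemma neg_comm A : isom A -> neg * A = A * neg.
Proof. by move=> h; apply: bijectionP => z /=; rewrite isomN. Qed.

Lemma neg_neq1 : neg <> 1.
Proof.
move=> /(congr1 (fun A : B => A (const_mx 1%R) 0%R 0%R)); rewrite /= !mxE; lra.
Qed.

(** The vector z + A z is fixed by A, hence zero unless A = 1. *)
Lemma rotn_sq1 A : rotn A -> A * A = 1 -> A = 1 \/ A = neg.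
Proof.
move=> hA A2; have [A1|A1] := pselect (A = 1); [by left|right].
apply: bijectionP => z; apply/eqP; rewrite /= -addr_eq0; apply/eqP.
apply: (rotn_fix hA A1); rewrite isomD; last by left.
by rewrite -[A (A z)]/((A * A) z) A2 /= addrC.
Qed.

(** The scalar is 2 c, the trace of A: this is Cayley-Hamilton in determinant 1. *)
Lemma rotn_trace A : rotn A -> exists t : R, forall z, A z + (A^-1)%g z = t *: z.
Proof.
move=> hA; have := hA => -[c [s [e h]]]; exists (c + c)%R => z.
have -> : A^-1 z = \row_j (if j == 0 then c * z 0 0 + s * z 0 1 else - s * z 0 0 + c * z 0 1)%R.
  apply: (@bij_inj _ A); rewrite bijVK; apply: vec2P; rewrite ?(h _).1 ?(h _).2 !mxE /= -[LHS]mul1r -[in LHS]e; lra.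
by apply: vec2P; rewrite !mxE ?(h z).1 ?(h z).2 /=; lra.
Qed.

Lemma refl_neq1 C : refl C -> C <> 1.
Proof. by move=> h e; apply: (rotn_nrefl rotn1); rewrite -e. Qed.

Lemma refl_negneg C : refl C -> C <> neg.
Proof. by move=> h e; apply: (rotn_nrefl rotn_neg); rewrite -e. Qed.

Lemma refl_comm_rotn C A : refl C -> rotn A -> C * A * C = A^-1.
Proof.
move=> hC hA; apply/eqP; rewrite -(inj_eq (mulIg A)) mulVg -!mulgA mulgA; apply/eqP.
exact/reflK/refl_rotnM.
Qed.

End Plane.

(** * Rigidity of linear isometries, and covering by polynomial conditions *)

Section PlaneFacts.
Variable R : realType.
Notation V := 'rV[R]_2.
Notation B := (bijection V).
Implicit Types (x y z : V) (A C D : B).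

(** (A - 1)(A^-1 - 1) is the scalar 2 - t, which is non-zero unless A = 1 and so provides a right
    inverse of A - 1. *)
Lemma rotn_sub_onto A : rotn A -> A <> 1 -> forall y, exists z, A z - z = y.
Proof.
move=> hA A1 y; have iA : isom A by left.
have [t tE] := rotn_trace hA.
have key z : A ((A^-1)%g z - z) - ((A^-1)%g z - z) = (2 - t)%R *: z.
  rewrite isomB// bijVK; have e := tE z; vsplit e; vlra.
have t2 : (2 - t != 0)%R.
  apply/eqP => t2; apply: A1; apply: bijectionP => z.
  have := key z; rewrite t2 scale0r => /eqP; rewrite subr_eq0 => /eqP /(rotn_fix hA).
  have [-> //|A1] := pselect (A = 1); move=> /(_ A1) /eqP; rewrite subr_eq0 => /eqP.
  by move=> /(congr1 A); rewrite bijVK.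
exists ((2 - t)^-1 *: ((A^-1)%g y - y))%R.
by rewrite isomZ// -scalerBr key scalerA mulVf// scale1r.
Qed.

(** For a rotation E other than 1, (1 + C)(E - 1) = 0 with E - 1 onto would give C = -1. A
    reflection D is replaced by the rotation C D. *)
Lemma refl_axis C D : refl C -> isom D ->
  (forall z, D z + C (D z) = z + C z) -> D = 1 \/ D = C.
Proof.
move=> hC; have iC : isom C by right.
have rot E : rotn E -> (forall z, E z + C (E z) = z + C z) -> E = 1.
  move=> hE h; have [//|E1] := pselect (E = 1); exfalso.
  apply: (refl_negneg hC); apply: bijectionP => y.
  have [z <-] := rotn_sub_onto hE E1 y.
  apply/eqP; rewrite /= -addr_eq0 isomB//; apply/eqP.
  by transitivity ((E z + C (E z)) - (z + C z));
    [apply: vec2P; rewrite !mxE; lra | rewrite h subrr].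
move=> [hD|hD] h; [left; exact: rot|right].
have := rot (C * D) (reflM hC hD); rewrite /= => e.
apply: (mulgI C); rewrite reflK//; apply: e => z.
by rewrite -[C (C _)]/((C * C) _) reflK// /= addrC h.
Qed.

(** Conjugation by C inverts rotations, so a rotation commuting with C has square 1. *)
Lemma refl_commute C D : refl C -> isom D -> D * C = C * D ->
  [\/ D = 1, D = C, D = neg R | D = neg R * C].
Proof.
move=> hC iD DC.
have rot E : rotn E -> E * C = C * E -> E = 1 \/ E = neg R.
  move=> hE EC; apply: rotn_sq1 => //.
  have EV : E^-1 = E by rewrite -(refl_comm_rotn hC hE) -EC -mulgA reflK// mulg1.
  by rewrite -{1}EV mulVg.
case: iD => hD.
  by case: (rot _ hD DC) => e; [exact: Or41|exact: Or43].
have /(rot _ (reflM hD hC)) : D * C * C = C * (D * C) by rewrite {1}DC -mulgA.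
have DE : D = D * C * C by rewrite -mulgA reflK// mulg1.
by case=> e; rewrite e ?mul1g in DE; [exact: Or42|exact: Or44].
Qed.

Lemma refl_commute_axis C D (w : V) : refl C -> isom D -> D * C = C * D -> C w = w ->
  D w = w \/ D w = - w.
Proof.
by move=> hC iD DC Cw; case: (refl_commute hC iD DC) => -> /=; rewrite ?Cw; [left|left|right|right].
Qed.

Lemma vec_eq_opp0 (w : V) : w = - w -> w = 0.
Proof.
by move=> h; vsplit h; vlra.
Qed.

Lemma refl_commute_axis1 C D (w : V) : refl C -> isom D -> D * C = C * D -> C w = w ->
  w <> 0 -> D w = w -> D = 1 \/ D = C.
Proof.
move=> hC iD DC Cw w0 Dw; case: (refl_commute hC iD DC) => e; [by left|by right| |];
  exfalso; apply: w0; apply: vec_eq_opp0; by rewrite -{1}Dw e /= ?Cw.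
Qed.

(** By Cayley-Hamilton, (C - A)(C - A^-1) = C^2 - t C + 1 = 0. *)
Lemma rotn_trace_inj A C t : rotn A -> rotn C -> (forall z, A z + (A^-1)%g z = t *: z) ->
  (forall z, C z + (C^-1)%g z = t *: z) -> C = A \/ C = A^-1.
Proof.
move=> hA hC tA tC; have [->|CA] := pselect (C = A); [by left|right].
apply: bijectionP => z; apply/eqP; rewrite -subr_eq0; apply/eqP.
have iC : isom C by left.
have iA : isom A by left.
have CA1 : A^-1 * C <> 1.
  by move=> e; apply: CA; rewrite -[C]mul1g -(mulgV A) -mulgA e mulg1.
apply: (rotn_fix (rotnM (rotnV hA) hC) CA1).
apply: (@bij_inj _ A); rewrite /= bijVK isomB// (isomB _ _ iA) bijVK.
rewrite -[C ((A^-1)%g z)]/((C * A^-1) z) (rotnC hC (rotnV hA)) /=.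
have tA' := tA (C z); have tC' := tC (C z); rewrite bijK in tC'.
have eqn : C (C z) + z = A (C z) + (A^-1)%g (C z) by rewrite tA' tC'.
by vsplit eqn; vlra.
Qed.

Lemma refl_anti_inj C D (w : V) : refl C -> refl D -> C w = - w -> D w = - w -> C = D \/ w = 0.
Proof.
move=> hC hD Cw Dw; have [CD|CD] := pselect (C * D = 1).
  by left; rewrite -[C]mulg1 -(reflK hD) mulgA CD mul1g.
right; apply: (rotn_fix (reflM hC hD) CD).
by rewrite /= Dw isomN ?Cw ?opprK//; right.
Qed.

Lemma poly_nat_eq0 (p : {poly R}) : (forall n : nat, p.[n%:R] = 0)%R -> p = 0.
Proof.
move=> h; apply: (@roots_geq_poly_eq0 _ _ [seq n%:R%R | n <- iota 0 (size p)]).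
- by apply/allP => _ /mapP[n _ ->]; apply/rootP.
- by rewrite map_inj_uniq ?iota_uniq// => m n /eqP; rewrite eqr_nat => /eqP.
- by rewrite size_map size_iota.
Qed.

Lemma poly_cover (I : eqType) (s : seq I) (P Q : I -> {poly R}) :
  (forall n : nat, exists2 i, i \in s & (P i).[n%:R]%R = 0%R /\ (Q i).[n%:R]%R = 0%R) ->
  exists2 i, i \in s & P i = 0 /\ Q i = 0.
Proof.
(* [r i] is [Q i] exactly when [P i] is zero, so [r i = 0] forces both to vanish; the product of the
   [r i] has every natural number as a root. *)
move=> h; pose r i := if P i == 0 then Q i else P i.
have : (\prod_(i <- s) r i)%R = 0.
  apply: poly_nat_eq0 => n; have [i si [Pi Qi]] := h n.
  apply/eqP; rewrite horner_prod prodf_seq_eq0; apply/hasP; exists i => //=.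
  by rewrite /r; case: ifP => _; apply/eqP.
move/eqP; rewrite prodf_seq_eq0 => /hasP[i si /=].
rewrite /r; case: (eqVneq (P i) 0) => [Pi /eqP Qi|Pi /eqP Pi0]; first by exists i.
by rewrite Pi0 eqxx in Pi.
Qed.

(* Applied along the curve n w1 + n ^ 2 w2, this turns a choice depending on a lattice
   vector into a uniform one. *)
Lemma vec_cover (I : eqType) (s : seq I) (a b c d e : I -> V) :
  (forall n : nat, exists2 i, i \in s &
     n%:R%R *: a i + (n%:R ^+ 2)%R *: b i + (n%:R ^+ 3)%R *: c i + (n%:R ^+ 4)%R *: d i = e i) ->
  exists2 i, i \in s & [/\ a i = 0, b i = 0, c i = 0, d i = 0 & e i = 0].
Proof.
move=> h.
pose P k i : {poly R} := (a i 0 k *: 'X + b i 0 k *: 'X^2 + c i 0 k *: 'X^3 + d i 0 k *: 'X^4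
  - (e i 0 k)%:P)%R.
have [|i si [h0 h1]] := @poly_cover I s (P 0%R) (P 1%R).
  move=> n; have [i si hi] := h n; exists i => //; rewrite /P.
  by vsplit hi; rewrite /P !(hornerD, hornerN, hornerZ, hornerXn, hornerX, hornerC); split; lra.
exists i => //.
have co k : P k i = 0 -> [/\ a i 0 k = 0, b i 0 k = 0, c i 0 k = 0, d i 0 k = 0 & e i 0 k = 0]%R.
  move=> Pk; have hc m : ((P k i)`_m = 0)%R by rewrite Pk coef0.
  have := hc 0%N; have := hc 1%N; have := hc 2%N; have := hc 3%N; have := hc 4%N.
  rewrite /P !coefE /=; rewrite !mulr0 !mulr1 !subr0 !add0r !addr0 => -> -> -> -> /eqP.
  by rewrite oppr_eq0 => /eqP ->.
have [a0 b0 c0 d0 e0] := co _ h0; have [a1 b1 c1 d1 e1] := co _ h1.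
by split; apply: vec2P; rewrite mxE.
Qed.

End PlaneFacts.

(** * Crystallographic groups *)

Section Crystal.
Variable R : realType.
Notation V := 'rV[R]_2.
Notation B := (bijection V).
Implicit Types (A C D : B).

Definition lin_fun (h : V -> V) := forall (k : R) x y, h (k *: x + y) = k *: h x + h y.

Definition lattice (w1 w2 : V) (v : V) := exists m n : int, v = (w1 *~ m + w2 *~ n)%R.

(* An abstract planar crystallographic group: [x : gT] acts by z |-> lin x z + pt x,
   and [tau v] is the translation by the lattice vector v. *)
Record crystal (gT : groupType) (lin : gT -> B) (pt : gT -> V) (tau : V -> gT)
    (w1 w2 : V) : Prop := Crystal {
  cr_linM : forall x y, lin (x * y) = lin x * lin y;
  cr_ptM : forall x y, pt (x * y) = pt x + lin x (pt y);
  cr_inj : forall x y, lin x = lin y -> pt x = pt y -> x = y;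
  cr_isom : forall x, isom (lin x);
  cr_basis : (w1 0 0 * w2 0 1 - w1 0 1 * w2 0 0 != 0)%R;
  cr_tau : forall v, lattice w1 w2 v -> lin (tau v) = 1 /\ pt (tau v) = v;
  cr_lat : forall x, lin x = 1 -> lattice w1 w2 (pt x) }.

Variables (gT : groupType) (lin : gT -> B) (pt : gT -> V) (tau : V -> gT) (w1 w2 : V).
Hypothesis cr : crystal lin pt tau w1 w2.
Notation L := (lattice w1 w2).
Implicit Types (x y z : gT) (u v w : V).

Let linM := cr_linM cr.
Let ptM := cr_ptM cr.

Lemma lin_isom x : isom (lin x). Proof. exact: cr_isom cr x. Qed.
Lemma lin1 : lin 1 = 1.
Proof. by apply: (mulgI (lin 1)); rewrite -linM !mulg1. Qed.
Lemma linV x : lin x^-1 = (lin x)^-1.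
Proof. by apply: (mulgI (lin x)); rewrite -linM !mulgV lin1. Qed.
Lemma pt1 : pt 1 = 0.
Proof.
by have := ptM 1 1; rewrite mulg1 lin1 /= => /eqP; rewrite -subr_eq0 opprD addrA subrr sub0r oppr_eq0 => /eqP.
Qed.

Lemma lattice0 : L 0. Proof. by exists 0, 0; rewrite !mulr0z addr0. Qed.
Lemma latticeD u v : L u -> L v -> L (u + v).
Proof.
move=> [m [n ->]] [m' [n' ->]]; exists (m + m')%R, (n + n')%R.
by rewrite !mulrzDr addrACA.
Qed.
Lemma latticeN u : L u -> L (- u).
Proof. by move=> [m [n ->]]; exists (- m)%R, (- n)%R; rewrite !mulrNz opprD. Qed.
Lemma latticeB u v : L u -> L v -> L (u - v).
Proof. by move=> Lu Lv; apply: latticeD => //; exact: latticeN. Qed.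
Lemma lattice1 : L w1. Proof. by exists 1%R, 0; rewrite mulr0z addr0. Qed.
Lemma lattice2 : L w2. Proof. by exists 0, 1%R; rewrite mulr0z add0r. Qed.
Lemma latticeMn u n : L u -> L (u *+ n)%R.
Proof.
by move=> Lu; elim: n => [|n IH]; [rewrite mulr0n; exact: lattice0|rewrite mulrS; exact: latticeD].
Qed.

Lemma lin_tau v : L v -> lin (tau v) = 1. Proof. by case/(cr_tau cr). Qed.
Lemma pt_tau v : L v -> pt (tau v) = v. Proof. by case/(cr_tau cr). Qed.
Lemma tau_pt x : lin x = 1 -> x = tau (pt x).
Proof. by move=> h; apply: (cr_inj cr); rewrite ?lin_tau ?pt_tau//; exact: (cr_lat cr). Qed.
Lemma tauM u v : L u -> L v -> tau u * tau v = tau (u + v).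
Proof.
move=> Lu Lv; have Luv := latticeD Lu Lv.
by apply: (cr_inj cr); rewrite ?linM ?ptM ?lin_tau ?pt_tau ?mulg1.
Qed.
Lemma tau0 : tau 0 = 1.
Proof. by rewrite -pt1 -tau_pt// lin1. Qed.
Lemma tauV v : L v -> (tau v)^-1 = tau (- v).
Proof.
move=> Lv; apply: (mulgI (tau v)); rewrite mulgV tauM//; last exact: latticeN.
by rewrite subrr tau0.
Qed.
Lemma tau_inj u v : L u -> L v -> tau u = tau v -> u = v.
Proof. by move=> Lu Lv /(congr1 pt); rewrite !pt_tau. Qed.

Lemma lin_tauM v x : L v -> lin (tau v * x) = lin x.
Proof. by move=> Lv; rewrite linM lin_tau// mul1g. Qed.
Lemma pt_tauM v x : L v -> pt (tau v * x) = v + pt x.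
Proof. by move=> Lv; rewrite ptM lin_tau// pt_tau. Qed.

Lemma ptV x : pt x^-1 = - (lin x)^-1%g (pt x).
Proof.
apply: (@bij_inj _ (lin x)); have := ptM x x^-1; rewrite mulgV pt1 => /eqP.
rewrite eq_sym addrC addr_eq0 => /eqP ->; rewrite isomN ?bijVK//; exact: lin_isom.
Qed.

Lemma conj_trans x y : lin y = 1 -> lin (x * y * x^-1) = 1 /\ pt (x * y * x^-1) = lin x (pt y).
Proof.
move=> ly; rewrite !linM ly mulg1 linV mulgV; split=> //.
rewrite !ptM ptV linM ly mulg1 isomN ?bijVK; last exact: lin_isom.
by rewrite addrAC subrr add0r.
Qed.

Lemma lattice_lin x v : L v -> L (lin x v).
Proof.
move=> Lv; have [l1 p1] := conj_trans x (lin_tau Lv); rewrite pt_tau// in p1.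
by rewrite -p1; exact: (cr_lat cr).
Qed.

Lemma tau_comm x v : L v -> x * tau v = tau (lin x v) * x.
Proof.
move=> Lv; apply: (mulIg x^-1); rewrite mulgK.
have [l1 p1] := conj_trans x (lin_tau Lv).
by rewrite (tau_pt l1) p1 pt_tau.
Qed.

Lemma tau_conj x v : L v -> tau v ^ x = tau ((lin x)^-1%g v).
Proof.
move=> Lv; rewrite /conjg -linV; have Lv' := lattice_lin x^-1 Lv.
by rewrite mulgA (tau_comm x^-1)// -mulgA mulVg mulg1.
Qed.

Lemma same_lin x y : lin x = lin y -> exists2 v, L v & x = tau v * y.
Proof.
move=> e; have l1 : lin (x * y^-1) = 1 by rewrite linM linV e mulgV.
exists (pt (x * y^-1)); first exact: (cr_lat cr).
by rewrite -tau_pt// mulgVK.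
Qed.

Lemma lattice_span v : exists a b : R, v = a *: w1 + b *: w2.
Proof.
have d := cr_basis cr; set dt := (_ - _)%R in d.
exists ((v 0 0 * w2 0 1 - v 0 1 * w2 0 0) / dt)%R, ((w1 0 0 * v 0 1 - w1 0 1 * v 0 0) / dt)%R.
by apply: vec2P; rewrite !mxE; apply: (mulIf d); rewrite mulrDl mulrAC divfK// [X in (_ + X)%R]mulrAC divfK// /dt; lra.
Qed.

Lemma lattice_ext (h k : V -> V) : lin_fun h -> lin_fun k ->
  (forall v, L v -> h v = k v) -> h =1 k.
Proof.
move=> hh hk e z; have [a [b ->]] := lattice_span z.
have z0 (g : V -> V) : lin_fun g -> g 0 = 0.
  by move=> hg; have := hg 1%R 0 0; rewrite !scale1r addr0 => /eqP; rewrite -subr_eq0 opprD addrA subrr sub0r oppr_eq0 => /eqP.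
have co (g : V -> V) : lin_fun g -> g (a *: w1 + b *: w2) = a *: g w1 + b *: g w2.
  by move=> hg; rewrite hg -[b *: w2]addr0 hg z0// addr0.
by rewrite (co h hh) (co k hk) (e _ lattice1) (e _ lattice2).
Qed.

Lemma lattice_ext_bij A C : linear_bij A -> linear_bij C ->
  (forall v, L v -> A v = C v) -> A = C.
Proof. by move=> hA hC h; apply: bijectionP; exact: lattice_ext. Qed.

Lemma additive_lattice (D : V -> V) : (forall u v, L u -> L v -> D (u + v) = D u + D v) ->
  [/\ forall u (n : nat), L u -> D (u *+ n)%R = n%:R%R *: D u &
      D w1 = 0 -> D w2 = 0 -> forall v, L v -> D v = 0].
Proof.
move=> Da.
have D0 : D 0 = 0 by apply: (addIr (D 0)); rewrite -Da ?add0r//; exact: lattice0.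
have Dn u (n : nat) : L u -> D (u *+ n)%R = n%:R%R *: D u.
  move=> Lu; elim: n => [|n IH]; first by rewrite mulr0n scale0r.
  rewrite mulrS Da//; last exact: latticeMn.
  by rewrite IH -[n.+1]add1n natrD scalerDl scale1r.
split=> // d1 d2.
have DN u : L u -> D (- u) = - D u.
  by move=> Lu; apply/eqP; rewrite -addr_eq0 -Da ?addNr ?D0//; exact: latticeN.
have Dz u (m : int) : L u -> D u = 0 -> D (u *~ m)%R = 0.
  move=> Lu Du; case: m => n; first by rewrite -pmulrn Dn// Du scaler0.
  rewrite NegzE mulrNz DN -?pmulrn ?Dn ?Du ?scaler0 ?oppr0//; exact: latticeMn.
move=> _ [m [n ->]]; rewrite Da ?Dz ?addr0//; try exact: lattice1; try exact: lattice2.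
  by exists m, 0; rewrite mulr0z addr0.
by exists 0, n; rewrite mulr0z add0r.
Qed.

Lemma lattice_extend (D : V -> V) : (forall u v, L u -> L v -> D (u + v) = D u + D v) ->
  exists2 F : V -> V, lin_fun F & forall v, L v -> F v = D v.
Proof.
move=> Da; have d := cr_basis cr; set dt := (_ - _)%R in d.
(* Coordinates in the basis (w1, w2), by Cramer's rule. *)
pose a (v : V) := ((v 0 0 * w2 0 1 - v 0 1 * w2 0 0) / dt)%R.
pose b (v : V) := ((w1 0 0 * v 0 1 - w1 0 1 * v 0 0) / dt)%R.
pose F v := a v *: D w1 + b v *: D w2.
have hF : lin_fun F by move=> k u v; apply: vec2P; rewrite !mxE /a /b !mxE; lra.
exists F => // v Lv; apply/eqP; rewrite -subr_eq0; apply/eqP; move: v Lv.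
have Fa u v : L u -> L v -> F (u + v) - D (u + v) = (F u - D u) + (F v - D v).
  move=> Lu Lv; have := hF 1%R u v; rewrite !scale1r => ->.
  by rewrite Da// opprD addrACA.
have [_] := additive_lattice Fa; apply.
- have -> : F w1 = D w1; last by rewrite subrr.
  by rewrite /F /a /b divff// [X in (X / dt)%R](_ : _ = 0)%R ?mul0r ?scale1r ?scale0r ?addr0//; lra.
- have -> : F w2 = D w2; last by rewrite subrr.
  by rewrite /F /a /b divff// [X in (X / dt)%R](_ : _ = 0)%R ?mul0r ?scale1r ?scale0r ?add0r//; lra.
Qed.

Section Cover.
Variables (I : eqType) (s : seq I) (D1 D2 : I -> V -> V) (c : I -> V).
Hypothesis D1a : forall i u v, i \in s -> L u -> L v -> D1 i (u + v) = D1 i u + D1 i v.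
Hypothesis D2a : forall i u v, i \in s -> L u -> L v -> D2 i (u + v) = D2 i u + D2 i v.

Lemma lattice_cover2 :
  (forall u v, L u -> L v -> exists2 i, i \in s & D1 i u + D2 i v = c i) ->
  exists2 i, i \in s & [/\ forall u, L u -> D1 i u = 0, forall u, L u -> D2 i u = 0 & c i = 0].
Proof.
move=> h.
have [|i si [a1 a2 b1 b2 c0]] := @vec_cover R I s (D1^~ w1) (D1^~ w2) (D2^~ w1) (D2^~ w2) c.
  (* On the curve (n w1 + n^2 w2, n^3 w1 + n^4 w2) in L x L, distinct powers of n separate the
     values of [D1] and [D2] at the two basis vectors. *)
  move=> n; have L1 := latticeMn n lattice1; have L2 := latticeMn (n ^ 2) lattice2.
  have L3 := latticeMn (n ^ 3) lattice1; have L4 := latticeMn (n ^ 4) lattice2.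
  have [i si hi] := h _ _ (latticeD L1 L2) (latticeD L3 L4); exists i => //.
  have [d1 _] := additive_lattice (fun u v => D1a si (u := u) (v := v)).
  have [d2 _] := additive_lattice (fun u v => D2a si (u := u) (v := v)).
  rewrite -hi D1a// D2a// (d1 _ _ lattice1) (d1 _ _ lattice2) (d2 _ _ lattice1) (d2 _ _ lattice2).
  by rewrite !natrX !addrA.
exists i => //; split=> //.
- by have [_] := additive_lattice (fun u v => D1a si (u := u) (v := v)); apply.
- by have [_] := additive_lattice (fun u v => D2a si (u := u) (v := v)); apply.
Qed.

End Cover.

Lemma lattice_cover (I : eqType) (s : seq I) (D : I -> V -> V) (c : I -> V) :
  (forall i u v, i \in s -> L u -> L v -> D i (u + v) = D i u + D i v) ->
  (forall u, L u -> exists2 i, i \in s & D i u = c i) ->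
  exists2 i, i \in s & (forall u, L u -> D i u = 0) /\ c i = 0.
Proof.
move=> Da h; have [||i si [d _ c0]] := @lattice_cover2 I s D (fun _ _ => 0) c Da.
- by move=> *; rewrite addr0.
- by move=> u _ Lu _; have [i si e] := h u Lu; exists i; rewrite ?addr0.
by exists i.
Qed.

(* The trace is an integer, since it can be computed in a lattice basis. *)
Lemma lin_trace x : rotn (lin x) ->
  exists2 k : int, (-2%:Z <= k <= 2%:Z)%R & forall v, lin x v + (lin x)^-1%g v = k%:~R%R *: v.
Proof.
move=> hx; have [t tE] := rotn_trace hx; have := hx => -[c [s [e h]]].
have tc : t = (c + c)%R.
  have cV : (lin x)^-1%g (const_mx 1%R) = \row_j (if j == 0 then c + s else c - s)%R.
    apply: (@bij_inj _ (lin x)); rewrite bijVK; apply: vec2P; rewrite ?(h _).1 ?(h _).2 !mxE /=; lra.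
  have := congr1 (fun v : V => v 0 0) (tE (const_mx 1%R)).
  by rewrite cV !mxE (h _).1 !mxE /=; lra.
have [k [l e1]] := lattice_lin x lattice1; have [m [n e2]] := lattice_lin x lattice2.
have tk : t = (k + n)%:~R%R.
  have [h00 h01] := h w1; have [h10 h11] := h w2.
  have e1' : lin x w1 = k%:~R%R *: w1 + l%:~R%R *: w2 by rewrite e1 !scaler_int.
  have e2' : lin x w2 = m%:~R%R *: w1 + n%:~R%R *: w2 by rewrite e2 !scaler_int.
  rewrite e1' !mxE in h00 h01; rewrite e2' !mxE in h10 h11.
  apply: (mulIf (cr_basis cr)); rewrite tc intrD.
  (* det (A w1, w2) + det (w1, A w2) is the trace of A times det (w1, w2). *)
  transitivity ((c * w1 0 0 - s * w1 0 1) * w2 0 1 - (s * w1 0 0 + c * w1 0 1) * w2 0 0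
     + (w1 0 0 * (s * w2 0 0 + c * w2 0 1) - w1 0 1 * (c * w2 0 0 - s * w2 0 1)))%R; first by lra.
  by rewrite -h00 -h01 -h10 -h11; lra.
exists (k + n)%R; last by rewrite -tk.
have c2 : (c ^+ 2 <= 1)%R by have := sqr_ge0 s; lra.
have [c_ge c_le] : (-1 <= c)%R /\ (c <= 1)%R by split; nra.
by rewrite -!(ler_int R) -tk tc /=; apply/andP; split; rewrite ?mulrNz /=; lra.
Qed.

(** Crystallographic restriction: a rotation is determined up to inversion by its trace, one of the
    five integers from -2 to 2. The reflections, if any, form one coset of the rotations. *)
Lemma point_group_finite : exists s : seq B, forall A, A \in s <-> exists x, lin x = A.
Proof.
suff [s sP] : exists s : seq B, forall x, lin x \in s.
  exists [seq A <- s | `[< exists x, lin x = A >]] => A; rewrite mem_filter.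
  by split=> [/andP[/asboolP]//|[x <-]]; rewrite sP andbT; apply/asboolP; exists x.
have [r rP] : exists s : seq B, forall x, rotn (lin x) -> lin x \in s.
  pose Q (k : int) A := (exists x, lin x = A) /\ rotn A /\
    forall v, A v + A^-1%g v = k%:~R%R *: v.
  pose F k := xget 1 [set A | Q k A].
  exists (flatten [seq [:: F (n%:Z - 2)%R; (F (n%:Z - 2)%R)^-1] | n <- iota 0 5]) => x hx.
  have [k /andP[k1 k2] kE] := lin_trace hx.
  have [n n5 kn] : exists2 n, (n < 5)%N & k = (n%:Z - 2)%R.
    exists `|(k + 2)%R|%N; lia.
  apply/flattenP; exists [:: F k; (F k)^-1].
    by rewrite kn; apply/mapP; exists n => //; rewrite mem_iota.
  have [] : Q k (F k) by apply: (@xgetPex _ _ [set A | Q k A]); exists (lin x); split=> //; exists x.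
  move=> _ [hF FE]; rewrite !inE; apply/orP.
  by case: (rotn_trace_inj hF hx FE kE) => ->; [left|right].
have [[x0 h0]|no] := pselect (exists x, refl (lin x)).
  exists (r ++ [seq A * lin x0 | A <- r]) => x; rewrite mem_cat.
  have [/rP->//|hx] := lin_isom x.
  apply/orP; right; apply/mapP; exists (lin (x * x0)).
    by apply: rP; rewrite linM; exact: reflM.
  by rewrite linM -mulgA reflK// mulg1.
by exists r => x; apply: rP; have [//|hx] := lin_isom x; case: no; exists x.
Qed.

End Crystal.

(** * Weak Cayley maps on translations *)

Section Conjugate.
Variable gT : groupType.
Implicit Types x y z : gT.

Lemma conjugate_refl x : conjugate x x.
Proof. by exists 1; rewrite conjg1. Qed.
Lemma conjugate_sym x y : conjugate x y -> conjugate y x.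
Proof. by case=> z ->; exists z^-1; rewrite conjgK. Qed.
Lemma conjugate_trans x y z : conjugate x y -> conjugate y z -> conjugate x z.
Proof. by case=> a -> [b ->]; exists (a * b); rewrite conjgM. Qed.
Lemma conjugate_mulC x y : conjugate (x * y) (y * x).
Proof. by exists x; rewrite /conjg !mulgA mulVg mul1g. Qed.
Lemma conjugate1 x : conjugate 1 x -> x = 1.
Proof. by case=> z ->; rewrite conj1g. Qed.

Variable f : bijection gT.
Hypothesis fW : weak_cayley gT f.

Lemma wc1 : f 1 = 1.
Proof.
have f1 : f (f^-1 1) = 1 by rewrite bijVK.
by apply: conjugate1; have := fW (f^-1 1) 1; rewrite mulg1 f1 mul1g.
Qed.

Lemma wcV x : f x^-1 = (f x)^-1.
Proof.
have := fW x^-1 x; rewrite mulVg wc1 => /conjugate1 h.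
by apply: (mulIg (f x)); rewrite h mulVg.
Qed.

(** f (z^-1 (x z)) and f ((x z) z^-1) are conjugate to the two orders of the product of f (z^-1) and
    f (x z). *)
Lemma wc_conj x y : conjugate x y -> conjugate (f x) (f y).
Proof.
case=> z ->; rewrite /conjg; apply: conjugate_sym; apply: conjugate_trans (fW _ _) _.
apply: conjugate_trans (conjugate_mulC _ _) _; apply: conjugate_sym.
by have := fW (x * z) z^-1; rewrite mulgK.
Qed.

End Conjugate.

(** * Additivity on the lattice, by polarization and counting *)

Section WeakCayley.
Variable R : realType.
Notation V := 'rV[R]_2.
Notation B := (bijection V).
Implicit Types (A C D : B).

Definition sqnorm (v : V) : R := (v 0 0 * v 0 0 + v 0 1 * v 0 1)%R.

Lemma sqnorm_isom A v : isom A -> sqnorm (A v) = sqnorm v.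
Proof.
by move=> [|] [c [s [e h]]]; rewrite /sqnorm (h v).1 (h v).2 -[RHS]mul1r -e; lra.
Qed.

Lemma sqnorm_eq0 v : sqnorm v = 0 -> v = 0.
Proof.
move/eqP; rewrite /sqnorm -!expr2 paddr_eq0 ?sqr_ge0// !sqrf_eq0 => /andP[/eqP z0 /eqP z1].
by apply: vec2P; rewrite ?z0 ?z1 mxE.
Qed.

Variables (gT : groupType) (lin : gT -> B) (pt : gT -> V) (tau : V -> gT) (w1 w2 : V).
Hypothesis cr : crystal lin pt tau w1 w2.
Notation L := (lattice w1 w2).
Implicit Types (x y z : gT) (u v w : V).

Let linM := cr_linM cr.

Variable f : bijection gT.
Hypothesis fW : weak_cayley gT f.

Lemma tau_conjV u x : L u -> tau u * x * (tau u)^-1 = tau (u - lin x u) * x.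
Proof.
move=> Lu; have Lx := lattice_lin cr x Lu; have Lu' := latticeN Lu.
rewrite (tauV cr)// -mulgA (tau_comm cr)// mulgA isomN; last exact: lin_isom cr x.
by rewrite (tauM cr)//; exact: latticeN.
Qed.

Lemma conj_lin1 x y : conjugate x y -> lin y = 1 -> lin x = 1.
Proof.
case=> z ->; rewrite /conjg !linM (linV cr) => h.
apply: (mulIg (lin z)); rewrite mul1g; apply: (mulgI (lin z)^-1).
by rewrite h mulVg.
Qed.

Lemma conj_tau x u : L u -> conjugate x (tau u) -> exists2 z, x = tau (lin z u) & L (lin z u).
Proof.
move=> Lu [z]; move=> /(congr1 (conjg^~ z^-1)); rewrite conjgK => <-.
exists z; last exact: (lattice_lin cr).
by rewrite (tau_conj cr)// (linV cr) invgK.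
Qed.

Lemma not_injective_in_seq (T : eqType) (s : seq T) (h : nat -> T) :
  injective h -> ~ (forall n, h n \in s).
Proof.
move=> hI hs; have := @uniq_leq_size _ [seq h n | n <- iota 0 (size s).+1] s.
rewrite map_inj_uniq// iota_uniq size_map size_iota ltnn => /(_ isT) H.
by have /H : {subset [seq h n | n <- iota 0 (size s).+1] <= s} by move=> _ /mapP[n _ ->].
Qed.

(* A non-translation has infinitely many conjugates, a translation only finitely many. *)
Lemma wc_lin1 x : lin (f x) = 1 -> lin x = 1.
Proof.
move=> fx; have [//|x1] := pselect (lin x = 1); exfalso.
have [w Lw wx] : exists2 w, L w & w - lin x w <> 0.
  have [h1|] := pselect (w1 - lin x w1 = 0); last by exists w1 => //; exact: lattice1.
  have [h2|] := pselect (w2 - lin x w2 = 0); last by exists w2 => //; exact: lattice2.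
  case: x1; apply: (lattice_ext_bij cr); [exact/isom_linear/(lin_isom cr)|exact/isom_linear/isom1|].
  have xa u v : L u -> L v -> u + v - lin x (u + v) = (u - lin x u) + (v - lin x v).
    by move=> _ _; rewrite (isomD _ _ (lin_isom cr x)) opprD addrACA.
  move=> v Lv; apply/eqP; rewrite eq_sym -subr_eq0; apply/eqP; move: v Lv.
  by have [_] := additive_lattice xa; apply.
have [s sP] := point_group_finite cr.
(* These conjugates of x have distinct translation parts, differing by multiples of w - lin x w.
   Their images are conjugates of the translation f x, of which there are at most as many as linear
   parts. *)
pose h n := tau (w *+ n)%R * x * (tau (w *+ n)%R)^-1.
apply: (@not_injective_in_seq _ [seq tau (A (pt (f x))) | A <- s] (f \o h)).
  apply: inj_comp; first exact: bij_inj.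
  move=> m n; rewrite /h !tau_conjV; try exact: latticeMn.
  move=> /mulIg /(tau_inj cr) e; have {}e : (w *+ m - lin x (w *+ m) = w *+ n - lin x (w *+ n))%R.
    have Lk k := latticeMn k Lw.
    by apply: e; apply: latticeB => //; exact: (lattice_lin cr).
  have ew k : (w *+ k = k%:R%R *: w)%R by rewrite scaler_nat.
  move: e; rewrite !ew !(isomZ _ _ (lin_isom cr x)).
  rewrite -!scalerBr => /eqP; rewrite -subr_eq0 -scalerBl scaler_eq0.
  by move=> /orP[|/eqP//]; rewrite subr_eq0 eqr_nat => /eqP.
move=> n /=; apply/mapP.
have cx : conjugate (f (h n)) (f x).
  apply: wc_conj => //; exists (tau (w *+ n)%R).
  by rewrite /h /conjg !mulgA mulVg mul1g mulgVK.
rewrite (tau_pt cr fx) in cx.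
have [|z zE _] := conj_tau _ cx; first exact: (cr_lat cr).
by exists (lin z); first by apply/sP; exists z.
Qed.

(** A provisional domain: so far f is only known to reflect translations. That M is all of L comes
    out in [wc_lin_tau]. *)
Let M u := L u /\ lin (f (tau u)) = 1.
Let g u := pt (f (tau u)).

Let gE u : M u -> f (tau u) = tau (g u).
Proof. by case=> _ /(tau_pt cr). Qed.
Let Lg u : M u -> L (g u).
Proof. by case=> _ /(cr_lat cr). Qed.

Let MD u v : M u -> M v -> M (u + v) /\ sqnorm (g (u + v)) = sqnorm (g u + g v).
Proof.
move=> Mu Mv; have [Lu Lv] := (Mu.1, Mv.1).
have := fW (tau u) (tau v); rewrite (tauM cr)// (gE Mu) (gE Mv) (tauM cr); try exact: Lg.
move=> c; have [|z zE _] := conj_tau _ c; first by apply: latticeD; exact: Lg.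
have Muv : M (u + v).
  split; first exact: latticeD.
  apply: (conj_lin1 c); apply: (lin_tau cr); apply: latticeD; exact: Lg.
split=> //; rewrite /g zE (pt_tau cr) ?sqnorm_isom//; first exact: (lin_isom cr).
by apply: (lattice_lin cr); apply: latticeD; exact: Lg.
Qed.

Let MN u : M u -> M (- u) /\ g (- u) = - g u.
Proof.
move=> Mu; have fE : f (tau (- u)) = tau (- g u).
  by rewrite -(tauV cr) ?(wcV fW) ?gE// ?(tauV cr)//; [exact: Lg|exact: Mu.1].
have LN := latticeN (Lg Mu).
by split; [split; [exact/latticeN/Mu.1|rewrite fE (lin_tau cr)]|rewrite /g fE (pt_tau cr)].
Qed.

(* Polarization: a map that preserves norms of sums and is odd is additive. *)
Let gD u v : M u -> M v -> g (u + v) = g u + g v.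
Proof.
move=> Mu Mv; have [Muv e1] := MD Mu Mv.
have [_] := MD Muv (MN Mu).1; rewrite (MN Mu).2 addrAC subrr add0r => e2.
have [_] := MD Muv (MN Mv).1; rewrite (MN Mv).2 addrK => e3.
apply/eqP; rewrite -subr_eq0; apply/eqP; apply: sqnorm_eq0.
by move: e1 e2 e3; rewrite /sqnorm !mxE; lra.
Qed.

Let g_surj w : L w -> exists2 u, M u & g u = w.
Proof.
move=> Lw; set x := f^-1 (tau w); have fx : f x = tau w by rewrite /x bijVK.
have lx : lin x = 1 by apply: wc_lin1; rewrite fx (lin_tau cr).
exists (pt x); last by rewrite /g -(tau_pt cr lx) fx (pt_tau cr).
by split; [exact: (cr_lat cr)|rewrite -(tau_pt cr lx) fx (lin_tau cr)].
Qed.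

Let g_inj u v : M u -> M v -> g u = g v -> u = v.
Proof.
move=> Mu Mv e; apply: (tau_inj cr); [exact: Mu.1|exact: Mv.1|].
by apply: (@bij_inj _ f); rewrite !gE// e.
Qed.

Let gi w := xget 0 [set u | M u /\ g u = w].
Let giP w : L w -> M (gi w) /\ g (gi w) = w.
Proof. by move=> /g_surj[u Mu gu]; apply: (@xgetPex _ 0 [set u | M u /\ g u = w]); exists u. Qed.

(** Since (tau u x)(tau v x)^-1 = tau (u - v), the translation parts [h u] have the same mutual
    distances as the [g u], which makes h additive. Each [h u] is the image of [g u] under one of
    finitely many linear parts, and [lattice_cover] makes the choice uniform. *)
Let coset x : exists y, forall u, M u -> f (tau u * x) = tau (lin y (g u)) * f x.
Proof.
pose h u := pt (f (tau u * x) * (f x)^-1).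
have hC u v : M u -> M v -> conjugate (f (tau (u - v))) (f (tau u * x) * (f (tau v * x))^-1).
  move=> [Lu _] [Lv _]; have := fW (tau u * x) (tau v * x)^-1.
  rewrite wcV// invgM mulgA mulgK (tauV cr)// (tauM cr)//; exact: latticeN.
have M0 : M 0.
  by split; [exact: lattice0|rewrite (tau0 cr) (wc1 fW) (lin1 cr)].
have conj_tau' u y : M u -> conjugate (f (tau u)) y ->
    lin y = 1 /\ exists2 z, pt y = lin z (g u) & L (pt y).
  move=> Mu /conjugate_sym; rewrite gE// => cy; have [|z -> Lz] := conj_tau _ cy; first exact: Lg.
  by rewrite (lin_tau cr)// (pt_tau cr)//; split=> //; exists z.
have hE u : M u -> f (tau u * x) = tau (h u) * f x /\ exists2 z, h u = lin z (g u) & L (h u).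
  move=> Mu; have := hC _ _ Mu M0; rewrite subr0 (tau0 cr) mul1g => /(conj_tau' _ _ Mu)[l1 hu].
  by split=> //; rewrite /h -(tau_pt cr l1) mulgVK.
have h_sub u v : M u -> M v -> sqnorm (h u - h v) = sqnorm (g u - g v).
  move=> Mu Mv; have [Mv' gv'] := MN Mv; have [Muv _] := MD Mu Mv'.
  have [l1 [z zE _]] := conj_tau' _ _ Muv (hC _ _ Mu Mv).
  rewrite -gv' -gD// -(sqnorm_isom (g (u - v)) (lin_isom cr z)) -zE.
  rewrite (hE u Mu).1 (hE v Mv).1 invgM mulgA mulgK.
  have [[_ _ Lu] [_ _ Lv]] := ((hE u Mu).2, (hE v Mv).2).
  by rewrite (tauV cr)// (tauM cr)// ?(pt_tau cr)//; [exact: latticeB|exact: latticeN].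
have h0 : h 0 = 0 by rewrite /h (tau0 cr) mul1g mulgV (pt1 cr).
have g0 : g 0 = 0 by rewrite /g (tau0 cr) (wc1 fW) (pt1 cr).
have hD u v : M u -> M v -> h (u + v) = h u + h v.
  move=> Mu Mv; have [Muv _] := MD Mu Mv; have guv := gD Mu Mv.
  apply/eqP; rewrite -subr_eq0; apply/eqP; apply: sqnorm_eq0.
  have := h_sub _ _ Mu M0; have := h_sub _ _ Mv M0; have := h_sub _ _ Muv M0.
  have := h_sub _ _ Muv Mu; have := h_sub _ _ Muv Mv; have := h_sub _ _ Mu Mv.
  by rewrite h0 g0 guv /sqnorm !mxE; lra.
have giD u v : L u -> L v -> gi (u + v) = gi u + gi v.
  move=> Lu Lv; have [[Mu gu] [Mv gv]] := (giP Lu, giP Lv).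
  have [Muv guv] := giP (latticeD Lu Lv); have [Muv' _] := MD Mu Mv.
  by apply: g_inj => //; rewrite guv gD// gu gv.
have [s sP] := point_group_finite cr.
have [||A /sP[y <-] [yE _]] := @lattice_cover R w1 w2 _ s (fun A w => h (gi w) - A w) (fun _ => 0).
- move=> A u v /sP[z <-] Lu Lv; rewrite giD// (isomD _ _ (lin_isom cr z)).
  by rewrite (hD _ _ (giP Lu).1 (giP Lv).1) opprD addrACA.
- move=> w Lw; have [Mw gw] := giP Lw; have [_ [z zE _]] := hE _ Mw.
  by exists (lin z); [apply/sP; exists z|rewrite zE gw subrr].
exists y => u Mu; rewrite (hE u Mu).1; congr (tau _ * _).
have [Mg gg] := giP (Lg Mu).
by have /eqP := yE _ (Lg Mu); rewrite subr_eq0 (g_inj Mg Mu gg) => /eqP.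
Qed.

Let coset_eq x x' : lin (f x') = lin (f x) -> exists2 u, M u & x' = tau u * x.
Proof.
move=> /(same_lin cr)[l Ll fE]; have [y yP] := coset x.
have [u Mu gu] := g_surj (lattice_lin cr y^-1 Ll).
exists u => //; apply: (@bij_inj _ f); rewrite yP// fE gu (linV cr).
by rewrite bijVK.
Qed.

(* x |-> f x induces an injection, hence a bijection, of the finite point group. *)
Lemma wc_lin_tau v : L v -> lin (f (tau v)) = 1.
Proof.
move=> Lv; have [s sP] := point_group_finite cr.
pose rep A := xget 1 [set x | lin x = A].
have repP A : A \in s -> lin (rep A) = A.
  by move=> /sP sA; exact: (@xgetPex _ 1 [set x | lin x = A]).
(* By [coset_eq], A |-> lin (f (rep A)) is injective on the finite point group, hence onto. *)
have [|||_ q_s] := @uniq_min_size _ [seq lin (f (rep A)) | A <- undup s] (undup s).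
- rewrite map_inj_in_uniq ?undup_uniq// => A A'; rewrite !mem_undup => sA sA' e.
  have [u [Lu _] uE] := coset_eq e.
  by rewrite -(repP A sA) -(repP A' sA') uE (lin_tauM cr).
- by move=> _ /mapP[A _ ->]; rewrite mem_undup; apply/sP; exists (f (rep A)).
- by rewrite size_map.
have rep_ex x : exists2 A, A \in s & exists2 u, M u & x = tau u * rep A.
  have : lin (f x) \in undup s by rewrite mem_undup; apply/sP; exists (f x).
  rewrite -q_s => /mapP[A]; rewrite mem_undup => sA e.
  by exists A => //; exact: coset_eq.
(* Both tau v and 1 lie in the coset of [rep 1], whence v = u - u' with u and u' in M. *)
have [A sA [u Mu uE]] := rep_ex (tau v).
have [A' sA' [u' Mu' uE']] := rep_ex 1.
have A1 : A = 1.
  by rewrite -(repP A sA) -(lin_tauM cr _ Mu.1) -uE (lin_tau cr).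
have A'1 : A' = 1.
  by rewrite -(repP A' sA') -(lin_tauM cr _ Mu'.1) -uE' (lin1 cr).
have rE : rep 1 = tau (- u').
  by apply: (mulgI (tau u')); rewrite -{1}A'1 -uE' -(tauV cr) ?mulgV//; exact: Mu'.1.
have [Mu'' _] := MN Mu'; have [Mv _] := MD Mu Mu''.
by rewrite uE A1 rE (tauM cr); [exact: Mv.2|exact: Mu.1|exact: Mu''.1].
Qed.

Let ML u : L u -> M u.
Proof. by move=> Lu; split=> //; exact: wc_lin_tau. Qed.

Lemma wc_struct : exists Phi : B, [/\ linear_bij Phi,
  forall v, L v -> L (Phi v) /\ f (tau v) = tau (Phi v),
  forall w, L w -> exists2 v, L v & Phi v = w &
  forall x, exists y, forall v, L v -> f (tau v * x) = tau (lin y (Phi v)) * f x].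
Proof.
have gLD u v : L u -> L v -> g (u + v) = g u + g v by move=> /ML Mu /ML Mv; exact: gD.
have giD u v : L u -> L v -> gi (u + v) = gi u + gi v.
  move=> Lu Lv; have [[Mu gu] [Mv gv]] := (giP Lu, giP Lv).
  have [Muv guv] := giP (latticeD Lu Lv); have [Muv' _] := MD Mu Mv.
  by apply: g_inj => //; rewrite guv gD// gu gv.
have [F lF FE] := lattice_extend cr gLD; have [F' lF' F'E] := lattice_extend cr giD.
have lid : lin_fun (@id V) by [].
have lc (h k : V -> V) : lin_fun h -> lin_fun k -> lin_fun (h \o k).
  by move=> hh hk a u v; rewrite /= hk hh.
have FF' : F \o F' =1 id.
  apply: (lattice_ext cr) => //; first exact: lc.
  by move=> v Lv; have [Mg gg] := giP Lv; rewrite /= F'E// FE//; exact: Mg.1.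
have F'F : F' \o F =1 id.
  apply: (lattice_ext cr) => //; first exact: lc.
  move=> v Lv; have Mv := ML Lv; have [Mg gg] := giP (Lg Mv).
  by rewrite /= FE// F'E; [exact: g_inj|exact: Lg].
exists (Bijection (@Bijective _ _ F F' F'F FF')); split => //=.
- by move=> v Lv; rewrite FE//; split; [exact/Lg/ML|exact/gE/ML].
- by move=> w Lw; have [Mg gg] := giP Lw; exists (gi w); [exact: Mg.1|rewrite FE//; exact: Mg.1].
- by move=> x; have [y yP] := coset x; exists y => v Lv; rewrite FE// yP//; exact: ML.
Qed.

End WeakCayley.

(** * Reflections and glide reflections *)

Section Axis.
Variable R : realType.
Notation V := 'rV[R]_2.
Notation B := (bijection V).
Implicit Types (A C D : B) (u v : V).

(* For a reflection C, [axis C v] is twice the projection of v to the mirror of C. *)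
Definition axis C v := v + C v.

Lemma axisD C u v : isom C -> axis C (u + v) = axis C u + axis C v.
Proof. by move=> iC; rewrite /axis isomD// addrACA. Qed.

Lemma axisN C u : isom C -> axis C (- u) = - axis C u.
Proof. by move=> iC; rewrite /axis isomN// opprD. Qed.

Lemma axis_fix C v : refl C -> C (axis C v) = axis C v.
Proof.
move=> hC; rewrite /axis isomD; last by right.
by rewrite -[C (C v)]/((C * C) v) reflK// addrC.
Qed.

Lemma axis_refl C v : refl C -> axis C (C v) = axis C v.
Proof. by move=> hC; rewrite /axis -[C (C v)]/((C * C) v) reflK// addrC. Qed.

Lemma axis_comm A C D v : isom A -> A * C = D * A -> axis D (A v) = A (axis C v).
Proof.
by move=> iA e; rewrite /axis isomD// -[D (A v)]/((D * A) v) -e.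
Qed.

Lemma axis_lin C A : isom C -> isom A -> lin_fun (fun v => axis C (A v)).
Proof.
by move=> iC iA k u v; rewrite (isom_linear iA) axisD// /axis (isomZ _ _ iC) scalerDr.
Qed.

Lemma refl_axis_eq C A : refl C -> isom A -> (forall v, axis C (A v) = axis C v) ->
  A = 1 \/ A = C.
Proof. by move=> hC iA h; apply: refl_axis. Qed.

Lemma refl_axis_neq0 C : refl C -> ~ (forall v, axis C v = 0).
Proof.
move=> hC h; apply: (refl_negneg hC); apply: bijectionP => v.
by apply/eqP; rewrite /= -addr_eq0 addrC; apply/eqP/h.
Qed.
End Axis.

(** * Twists and linear parts of a weak Cayley map *)

Section Structure.
Variable R : realType.
Notation V := 'rV[R]_2.
Notation B := (bijection V).
Implicit Types (A C D : B).
Variables (gT : groupType) (lin : gT -> B) (pt : gT -> V) (tau : V -> gT) (w1 w2 : V).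
Hypothesis cr : crystal lin pt tau w1 w2.
Notation L := (lattice w1 w2).
Implicit Types (x y z h : gT) (u v w : V).

Let linM := cr_linM cr.
Let ptM := cr_ptM cr.
Let isoL := lin_isom cr.

(** h h is the translation by axis (lin h) (pt h), and conjugating a translation by z applies lin z
    to its vector. *)
Lemma axis_conj h h' : refl (lin h) -> conjugate h h' -> exists z,
  [/\ h' = z * h * z^-1, lin z * lin h = lin h' * lin z &
      axis (lin h') (pt h') = lin z (axis (lin h) (pt h))].
Proof.
move=> hC [z zE]; exists z^-1.
have h'E : h' = z^-1 * h * z^-1^-1 by rewrite invgK zE conjgE mulgA.
split=> //; first by rewrite -!linM h'E mulgVK.
have l1 : lin (h * h) = 1 by rewrite linM reflK.
have [_] := conj_trans cr z^-1 l1; rewrite [pt (h * h)]ptM -/(axis (lin h) (pt h)) => <-.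
by rewrite -[LHS]ptM; congr pt; rewrite h'E !invgK !mulgA mulgK.
Qed.

(** The conjugating linear part commutes with the reflection, so it acts on the mirror as 1 or
    -1. *)
Lemma axis_sign h h' : refl (lin h) -> lin h' = lin h -> conjugate h h' ->
  axis (lin h) (pt h') = axis (lin h) (pt h) \/ axis (lin h) (pt h') = - axis (lin h) (pt h).
Proof.
move=> hC e /(axis_conj hC)[z [_ zC]]; rewrite e in zC *; move=> ->.
by apply: (refl_commute_axis hC (isoL z) zC); exact: axis_fix.
Qed.

(** Equal non-zero axes leave 1 and lin h as linear parts of the conjugating element. It is then tau
    l or tau l h, and h commutes with itself, so only conjugation by tau l has an effect. *)
Lemma axis_conj_lattice h h' : refl (lin h) -> lin h' = lin h -> conjugate h h' ->
  axis (lin h) (pt h') = axis (lin h) (pt h) -> axis (lin h) (pt h) <> 0 ->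
  exists2 l, L l & pt h' = (l - lin h l) + pt h.
Proof.
move=> hC e /(axis_conj hC)[z [h'E zC zA]] ax ax0; rewrite e in zC zA.
have case1 y l : L l -> h' = (tau l * y) * h * (tau l * y)^-1 -> y * h = h * y ->
    exists2 l, L l & pt h' = (l - lin h l) + pt h.
  move=> Ll e' yh; exists l => //; rewrite e' invgM -!mulgA (mulgA y) yh !mulgA mulgK.
  rewrite (tau_conjV cr)// (pt_tauM cr)//; apply: latticeB => //; exact: (lattice_lin cr).
have [z1|zh] := refl_commute_axis1 hC (isoL z) zC (axis_fix _ hC) ax0 (etrans (esym zA) ax).
  have zE : z = tau (pt z) * 1 by rewrite mulg1 -(tau_pt cr z1).
  apply: (case1 1 (pt z)); [exact: (cr_lat cr)|by rewrite -zE|by rewrite mulg1 mul1g].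
have [l Ll zE] := same_lin cr zh.
by apply: (case1 h l) => //; rewrite -zE.
Qed.

Variable f : bijection gT.
Hypothesis fW : weak_cayley gT f.
Variable Phi : B.
Hypothesis PhiL : linear_bij Phi.
Hypothesis PhiLat : forall v, L v -> L (Phi v) /\ f (tau v) = tau (Phi v).
Hypothesis Phi_surj : forall w, L w -> exists2 v, L v & Phi v = w.
Hypothesis PhiT : forall x, exists y, forall v, L v -> f (tau v * x) = tau (lin y (Phi v)) * f x.

(* A homomorphism has twist 1 at every x, an anti-homomorphism has twist [lin (f x)] at x. *)
Definition twist x : B := lin (sval (cid (PhiT x))).

Lemma twistE x v : L v -> f (tau v * x) = tau (twist x (Phi v)) * f x.
Proof. by rewrite /twist; case: cid => y /= h /h. Qed.

Lemma twist_isom x : isom (twist x). Proof. exact: isoL. Qed.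

Lemma twist_lat x v : L v -> L (twist x v). Proof. exact: (lattice_lin cr). Qed.

Lemma linear_ext_Phi A D : linear_bij A -> linear_bij D ->
  (forall v, L v -> A (Phi v) = D (Phi v)) -> A = D.
Proof.
move=> lA lD h; apply: (lattice_ext_bij cr) => // w /Phi_surj[v Lv <-]; exact: h.
Qed.

Lemma twist_uniq x y : (forall v, L v -> f (tau v * x) = tau (lin y (Phi v)) * f x) -> twist x = lin y.
Proof.
move=> h; apply: linear_ext_Phi; try exact/isom_linear/isoL.
move=> v Lv; have [LP _] := PhiLat Lv.
have := h v Lv; rewrite twistE// => /mulIg /(tau_inj cr); apply; exact: (lattice_lin cr).
Qed.

Lemma twist_lin x y : lin x = lin y -> twist x = twist y.
Proof.
move=> /(same_lin cr)[l Ll ->]; apply: twist_uniq => v Lv.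
rewrite -/(twist y) mulgA (tauM cr)// !twistE//; last exact: latticeD.
have [LP _] := PhiLat Lv; have [LP' _] := PhiLat Ll.
rewrite mulgA (tauM cr); try exact: twist_lat.
by rewrite (linear_bijD _ _ PhiL) (isomD _ _ (twist_isom y)).
Qed.

Lemma f_lin_tauM x v : L v -> lin (f (tau v * x)) = lin (f x).
Proof.
move=> Lv; have [LP _] := PhiLat Lv.
by rewrite twistE// (lin_tauM cr)//; exact: twist_lat.
Qed.

Lemma f_lin x y : lin x = lin y -> lin (f x) = lin (f y).
Proof. by move=> /(same_lin cr)[l Ll ->]; exact: f_lin_tauM. Qed.

Lemma f_lin_inj x y : lin (f x) = lin (f y) -> lin x = lin y.
Proof.
move=> /(same_lin cr)[l Ll e].
have [v Lv vE] := Phi_surj (lattice_lin cr (sval (cid (PhiT y)))^-1 Ll).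
have -> : x = tau v * y.
  by apply: (@bij_inj _ f); rewrite twistE// vE (linV cr) bijVK.
exact: (lin_tauM cr).
Qed.

Lemma f_lin1 x : lin (f x) = 1 <-> lin x = 1.
Proof.
rewrite -(lin1 cr) -{1}(wc1 fW); split; first exact: f_lin_inj.
exact: f_lin.
Qed.

(** What the linear part of f x must be if f is a homomorphism; an anti-homomorphism has the inverse
    of it. *)
Definition cj A : B := Phi * A * Phi^-1.

Lemma cjM A D : cj (A * D) = cj A * cj D.
Proof. by rewrite /cj !mulgA mulgVK. Qed.
Lemma cj1 : cj 1 = 1. Proof. by rewrite /cj mulg1 mulgV. Qed.
Lemma cj_inj : injective cj.
Proof. by move=> A D /mulIg /mulgI. Qed.
Lemma cjE A v : cj A (Phi v) = Phi (A v).
Proof. by rewrite /cj /= bijK. Qed.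
Lemma cj_neg : cj (neg R) = neg R.
Proof. by apply: bijectionP => v; rewrite /cj /= linear_bijN// bijVK. Qed.

(** tau v and its conjugate tau (lin x v) have conjugate images, so Phi (lin x v) = A (Phi v) with A
    in the finite point group, and A can be taken independent of v. *)
Lemma cj_point x : exists y, lin y = cj (lin x).
Proof.
have [s sP] := point_group_finite cr.
have [||A /sP[y yE] [h _]] := @lattice_cover R w1 w2 _ s
    (fun A v => Phi (lin x v) - A (Phi v)) (fun _ => 0).
- move=> A u v /sP[z <-] Lu Lv.
  by rewrite (isomD _ _ (isoL x)) !(linear_bijD _ _ PhiL) (isomD _ _ (isoL z)) opprD addrACA.
- move=> v Lv; have [LP fE] := PhiLat Lv; have Lx := lattice_lin cr x Lv.
  have [LPx fxE] := PhiLat Lx.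
  have : conjugate (f (tau (lin x v))) (f (tau v)).
    apply: wc_conj => //; exists x; rewrite (tau_conj cr)//.
    by rewrite bijK.
  rewrite fE => c; have [|z zE Lz] := conj_tau cr _ c; first by [].
  exists (lin z); first by apply/sP; exists z.
  by apply/eqP; rewrite subr_eq0; apply/eqP; apply: (tau_inj cr) => //; rewrite -fxE.
exists y; rewrite yE; apply: linear_ext_Phi.
- by rewrite -yE; exact/isom_linear/isoL.
- by apply: linear_bijM; [apply: linear_bijM => //; exact/isom_linear/isoL|exact: linear_bijV].
- by move=> v Lv; apply/eqP; rewrite cjE eq_sym -subr_eq0; apply/eqP/h.
Qed.

Lemma cj_isom x : isom (cj (lin x)).
Proof. by have [y <-] := cj_point x. Qed.

(** Reflections are the isometries of square 1 other than 1 and -1. This survives conjugation by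
    Phi, which is not known to be an isometry. *)
Lemma cj_refl x : refl (cj (lin x)) <-> refl (lin x).
Proof.
have sq1 A : isom A -> A * A = 1 -> A <> 1 -> A <> neg R -> refl A.
  by move=> [hA|//] A2 A1 An; case: (rotn_sq1 hA A2) => e; [case: A1|case: An].
split=> h; apply: sq1; rewrite ?isoL//; try exact: cj_isom.
- by apply: cj_inj; rewrite cjM reflK// cj1.
- by move=> e; apply: (refl_neq1 h); rewrite e cj1.
- by move=> e; apply: (refl_negneg h); rewrite e cj_neg.
- by rewrite -cjM reflK// cj1.
- by rewrite -cj1 => /cj_inj; exact: refl_neq1.
- by rewrite -cj_neg => /cj_inj; exact: refl_negneg.
Qed.

Lemma cj_rotn x : rotn (lin x) -> rotn (cj (lin x)).
Proof.
by move=> h; have [//|/cj_refl] := cj_isom x; move/(rotn_nrefl h).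
Qed.

Lemma twist_conj x w : L w -> conjugate (tau (twist x w) * f x) (tau w * f x).
Proof.
by move=> /Phi_surj[v Lv <-]; have [_ <-] := PhiLat Lv; rewrite -twistE.
Qed.

(** By [axis_sign] and [twist_conj], twist x w + pt (f x) and w + pt (f x) have axes equal up to
    sign. One sign holds for all w, and for the minus sign the constant term must vanish. *)
Let refl_twist_alt x : refl (lin (f x)) ->
  (forall w, L w -> axis (lin (f x)) (twist x w) = axis (lin (f x)) w) \/
  ((forall w, L w -> axis (lin (f x)) (twist x w) = - axis (lin (f x)) w) /\
   axis (lin (f x)) (pt (f x)) = 0).
Proof.
move=> hC; set C := lin (f x) in hC *; have iC : isom C by right.
have twD u v : axis C (twist x (u + v)) = axis C (twist x u) + axis C (twist x v).
  by rewrite (isomD _ _ (twist_isom x)) axisD.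
pose D (b : bool) w := if b then axis C (twist x w) - axis C w else axis C (twist x w) + axis C w.
pose c (b : bool) := if b then 0 else - (axis C (pt (f x)) + axis C (pt (f x))).
have [||[] _ [h0 c0]] := @lattice_cover R w1 w2 _ [:: true; false] D c.
- move=> b u v _ Lu Lv; rewrite /D twD (axisD _ _ iC).
  by case: b; [rewrite opprD addrACA|rewrite addrACA].
- move=> w Lw; have Lt := twist_lat x Lw.
  have := axis_sign _ _ (twist_conj x Lw); rewrite !(lin_tauM cr)// !(pt_tauM cr)//.
  rewrite -/C !(axisD _ _ iC) => /(_ hC erefl)[] e; [exists true|exists false] => //=; vsplit e; vlra.
- by left=> w Lw; have /eqP := h0 w Lw; rewrite /D subr_eq0 => /eqP.
- right; split=> [w Lw|]; first by have /eqP := h0 w Lw; rewrite /D addr_eq0 => /eqP.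
  by rewrite /c in c0; vsplit c0; vlra.
Qed.

Lemma refl_twist x : refl (lin (f x)) -> twist x = 1 \/ twist x = lin (f x).
Proof.
move=> hC; set C := lin (f x) in hC *; have iC : isom C by right.
apply: refl_axis_eq => //; first exact: twist_isom.
apply: (lattice_ext cr); [exact: axis_lin (twist_isom x)|exact: (axis_lin iC (isom1 R))|].
(* The minus sign would need axis C (pt (f x)) = 0 throughout the coset of x, but passing to
   [tau l * x] adds a non-zero axis. *)
have [//|[hneg hp]] := refl_twist_alt hC; exfalso.
have [l Ll lax] : exists2 l, L l & axis C (twist x (Phi l)) <> 0.
  apply: contrapT => no; apply: (refl_axis_neq0 hC).
  apply: (lattice_ext cr); first exact: (axis_lin iC (isom1 R)).
    by move=> k u v; rewrite scaler0 addr0.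
  move=> w /Phi_surj[v Lv <-]; have [LP _] := PhiLat Lv; apply: contrapT => h; apply: no; exists v => // e.
  by apply: h; apply/eqP; rewrite -oppr_eq0 -hneg// e.
have lE := f_lin_tauM x Ll; have [LP _] := PhiLat Ll.
have hCl : refl (lin (f (tau l * x))) by rewrite lE.
have [|[_]] := refl_twist_alt hCl; rewrite lE -/C => h.
  apply: lax; have := hneg _ LP; rewrite (twist_lin (y := x)) in h; last exact: (lin_tauM cr).
  by rewrite h// => /vec_eq_opp0.
move: h; rewrite twistE// (pt_tauM cr); last exact: twist_lat.
by rewrite axisD// hp addr0.
Qed.

(** Conjugating x by translations shows that [axis C] kills Phi (v - lin x v), that is, [axis C] is
    invariant under [cj (lin x)]. This leaves 1 and C, and 1 is excluded because x would be a
    translation. *)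
Lemma refl_cj x : refl (lin (f x)) -> cj (lin x) = lin (f x).
Proof.
move=> hC; set C := lin (f x) in hC *; have iC : isom C by right.
have key : forall v, L v -> axis C (twist x (Phi (v - lin x v))) = 0.
  pose D (b : bool) v := axis C (twist x (Phi (v - lin x v))).
  pose c (b : bool) := if b then 0 else - (axis C (pt (f x)) + axis C (pt (f x))).
  suff [b _ [h _]] : exists2 b, b \in [:: true; false] & (forall v, L v -> D b v = 0) /\ c b = 0 by exact: h.
  apply: lattice_cover.
    move=> b u v _ Lu Lv; rewrite /D -axisD// -(isomD _ _ (twist_isom x)) -(linear_bijD _ _ PhiL).
    by rewrite (isomD _ _ (isoL x)) opprD addrACA.
  move=> v Lv; have Lv' := latticeB Lv (lattice_lin cr x Lv); have [LP _] := PhiLat Lv'.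
  have cf : conjugate (f x) (f (tau v * x * (tau v)^-1)).
    by apply: wc_conj => //; exists (tau v)^-1; rewrite conjgE invgK mulgA.
  rewrite (tau_conjV cr)// twistE// in cf.
  have Lt := twist_lat x LP.
  have := axis_sign _ _ cf; rewrite !(lin_tauM cr)// !(pt_tauM cr)// -/C axisD// => /(_ hC erefl)[] e.
    by exists true => //; rewrite /D /c; vsplit e; vlra.
  by exists false => //; rewrite /D /c; vsplit e; vlra.
have ax1 : forall w, axis C (twist x w) = axis C w.
  move=> w; case: (refl_twist hC) => ->; first by [].
  by rewrite axis_refl.
have := refl_axis_eq hC (cj_isom x); case=> [|e|//].
  apply: (lattice_ext cr); [exact: axis_lin (cj_isom x)|exact: (axis_lin iC (isom1 R))|].
  move=> w /Phi_surj[v Lv <-]; rewrite cjE; have := key v Lv.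
  rewrite ax1 (linear_bijD _ _ PhiL) (linear_bijN _ PhiL) axisD// axisN// => /eqP.
  by rewrite subr_eq0 => /eqP.
exfalso; apply: (refl_neq1 hC); apply/f_lin1.
by apply: cj_inj; rewrite e cj1.
Qed.

Lemma f_refl x : refl (lin (f x)) <-> refl (lin x).
Proof.
split=> h; first by apply/cj_refl; rewrite refl_cj.
(* Let y have the reflection [cj (lin x)] as linear part. By [refl_cj] its preimage has the linear
   part of x, so f x and y have the same linear part. *)
have [y yE] := cj_point x; have fy : lin (f (f^-1 y)) = cj (lin x) by rewrite bijVK.
have hy : refl (lin (f (f^-1 y))) by rewrite fy; apply/cj_refl.
suff <- : lin (f (f^-1 y)) = lin (f x) by [].
by apply: f_lin; apply: cj_inj; rewrite (refl_cj hy).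
Qed.

Lemma f_rotn x : rotn (lin x) -> rotn (lin (f x)).
Proof.
by move=> h; have [//|/f_refl] := isoL (f x); move/(rotn_nrefl h).
Qed.

(** Since r y is a reflection or glide reflection, the conjugacy of f (tau v r tau u y) with f (tau
    v r) f (tau u y) can be read on axes. The conjugating linear part p can be chosen independent of
    u and v. The terms in v and in u then leave two values each for [twist r] and [Q * twist y] in
    terms of p. *)
Lemma rotn_twist r y : rotn (lin r) -> refl (lin y) ->
  (twist y = 1 -> lin (f r) = cj (lin r) /\
     (twist r = 1 \/ twist r = lin (f r) * lin (f y))) /\
  (twist y = lin (f y) -> lin (f r) = (cj (lin r))^-1 /\
     (twist r = lin (f y) \/ twist r = lin (f r))).
Proof.
move=> hw hy.
have hY : refl (lin (f y)) by apply/f_refl.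
have hQ := f_rotn hw; have hD := cj_rotn hw.
have hwy : refl (lin (r * y)) by rewrite linM; exact: rotn_reflM.
have hC : refl (lin (f (r * y))) by apply/f_refl.
have CE := refl_cj hC; rewrite linM cjM (refl_cj hY) in CE.
set Y := lin (f y) in hY CE *; set Q := lin (f r) in hQ *.
set D := cj (lin r) in hD CE *; set C := lin (f (r * y)) in hC CE.
have hC' : refl (Q * Y) by exact: rotn_reflM.
have [iC iC'] : isom C /\ isom (Q * Y) by split; right.
have iD : isom D by left.
have iQ : isom Q by left.
have iY : isom Y by right.
have [iRw iRy] := (twist_isom r, twist_isom y).
have axR v : axis C (twist (r * y) v) = axis C v.
  by case: (refl_twist hC) => ->; [|exact: axis_refl].
have [s sP] := point_group_finite cr.
(* The conjugating p must intertwine C with Q Y; by [axis_conj] it maps the one axis to the other.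
   [D1] and [D2] are the parts linear in v and in u, [c] the constant term. *)
pose D1 (p : B) v := axis (Q * Y) (twist r v) - p (axis C v).
pose D2 (p : B) u := axis (Q * Y) (Q (twist y u)) - p (axis C (D u)).
pose c (p : B) := p (axis C (pt (f (r * y)))) - axis (Q * Y) (pt (f r * f y)).
have [|||p] := @lattice_cover2 R w1 w2 _ [seq p <- s | p * C == Q * Y * p] D1 D2 c.
- move=> p u v; rewrite mem_filter => /andP[_ /sP[z zE]] Lu Lv.
  have ip : isom p by rewrite -zE; exact: isoL.
  by rewrite /D1 (isomD _ _ iRw) !axisD// (isomD _ _ ip) opprD addrACA.
- move=> p u v; rewrite mem_filter => /andP[_ /sP[z zE]] Lu Lv.
  have ip : isom p by rewrite -zE; exact: isoL.
  by rewrite /D2 (isomD _ _ iRy) (isomD _ _ iQ) (isomD _ _ iD) !axisD// (isomD _ _ ip) opprD addrACA.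
- move=> v' u' /Phi_surj[v Lv <-] /Phi_surj[u Lu <-].
  have [[LPv _] [LPu _]] := (PhiLat Lv, PhiLat Lu).
  have Lwu := lattice_lin cr r Lu; have Lvu := latticeD Lv Lwu; have [LPvu _] := PhiLat Lvu.
  have Lt1 := twist_lat r LPv; have Lt2 := twist_lat y LPu; have Lt3 := twist_lat (r * y) LPvu.
  have LQ := lattice_lin cr (f r) Lt2.
  have := fW (tau v * r) (tau u * y).
  have -> : tau v * r * (tau u * y) = tau (v + lin r u) * (r * y).
    by rewrite mulgA -(mulgA (tau v) r) (tau_comm cr)// (mulgA (tau v)) (tauM cr)// mulgA.
  rewrite !twistE//.
  have -> : tau (twist r (Phi v)) * f r * (tau (twist y (Phi u)) * f y) =
      tau (twist r (Phi v) + Q (twist y (Phi u))) * (f r * f y).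
    by rewrite mulgA -(mulgA _ (f r)) (tau_comm cr)// (mulgA (tau _)) (tauM cr)// mulgA.
  move=> /axis_conj; rewrite !(lin_tauM cr)//; last exact: latticeD.
  move=> /(_ hC)[z [_]]; rewrite linM -/Q -/Y -/C => zC.
  rewrite !(pt_tauM cr)//; last exact: latticeD.
  rewrite axisD// axisD// axisD// axR (linear_bijD _ _ PhiL) -cjE axisD// !(isomD _ _ (isoL z)) => e.
  exists (lin z); first by rewrite mem_filter zC eqxx; apply/sP; exists z.
  by rewrite /D1 /D2 /c !(isomD _ _ (isoL z)) -/D in e *; vsplit e; vlra.
rewrite mem_filter => /andP[/eqP pC /sP[z zE]] [h1 h2 _].
have ip : isom p by rewrite -zE; exact: isoL.
have ipV := isomV ip; have iDV := isomV iD.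
have g1 : twist r * p^-1 = 1 \/ twist r * p^-1 = Q * Y.
  apply: refl_axis_eq => //; first exact: isomM.
  move=> v; rewrite /= -[in RHS](bijVK p v) (axis_comm _ ip pC).
  move: (p^-1 v); apply: (lattice_ext cr).
  - exact: axis_lin.
  - by move=> k a b; rewrite (axis_lin iC (isom1 R)) (isomD _ _ ip) (isomZ _ _ ip).
  - by move=> a /h1 /eqP; rewrite subr_eq0 => /eqP.
have g2 : Q * twist y * (p * D)^-1 = 1 \/ Q * twist y * (p * D)^-1 = Q * Y.
  apply: refl_axis_eq => //; first by apply: isomM; [exact: isomM|apply/isomV/isomM].
  move=> v; rewrite invgM /= -[in RHS](bijVK p v) (axis_comm _ ip pC) -[in RHS](bijVK D (p^-1 v)).
  move: (D^-1 (p^-1 v)); apply: (lattice_ext cr).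
  - by apply: (axis_lin (A := Q * twist y)) => //; exact: isomM.
  - by move=> k a b; rewrite (axis_lin iC iD) (isomD _ _ ip) (isomZ _ _ ip).
  - by move=> a /h2 /eqP; rewrite subr_eq0 => /eqP.
(* What remains is algebra: Y, Q Y and D Y are involutions and p conjugates D Y to Q Y. *)
have Y2 := reflK hY; have YV := reflV hY.
have QYQY : Q * Y * (Q * Y) = 1 by exact: reflK.
have DYDY : D * Y * (D * Y) = 1 by rewrite CE; exact: reflK.
rewrite -CE in pC.
have g1' : twist r = p \/ twist r = Q * Y * p.
  by rewrite -(mulgVK p (twist r)); case: g1 => ->; [left|right]; rewrite ?mul1g.
have g2' : Q * twist y = p * D \/ Q * twist y = Q * Y * p * D.
  by rewrite -(mulgVK (p * D) (Q * twist y)); case: g2 => ->; [left|right]; rewrite ?mul1g ?mulgA.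
clear g1 g2 h1 h2 D1 D2 c; clearbody C D Q Y; split=> tE; rewrite tE in g2'.
- rewrite mulg1 in g2'; case: g2' => e.
    have pE : p = Q * D^-1 by rewrite e mulgK.
    have p1 : p = 1.
      apply: (mulgI (Q * Y)); rewrite mulg1 -pC mulgA -e //.
    by rewrite p1 mul1g in e; rewrite p1 mulg1 in g1'.
  have e1 : Y * p * D = 1 by apply: (mulgI Q); rewrite mulg1 !mulgA -e.
  have pE : p = Y * D^-1.
    by apply: (mulIg D); rewrite mulgVK; apply: (mulgI Y); rewrite mulgA e1 Y2.
  have QD : Q = D.
    have := pC; rewrite {1}pE pE !mulgA mulgVK Y2 -(mulgA Q) Y2 mulg1 => e2.
    by apply: (mulIg D^-1); rewrite -e2 mulgV.
  split=> //; case: g1' => ->; [right|left].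
    rewrite pE QD; apply: (mulIg (D * Y)); rewrite DYDY mulgA mulgVK Y2//.
  by rewrite pE !mulgA -(mulgA Q) Y2 mulg1 QD mulgV.
- case: g2' => e.
    have pE : p = Q * Y * D^-1 by rewrite e mulgK.
    have QD : Q = D^-1.
      have := pC; rewrite mulgA -e -mulgA Y2 mulg1 => ->.
      by rewrite pE mulgA QYQY mul1g.
    split=> //; case: g1' => ->; [left|right].
      by rewrite pE -QD; apply: (mulgI (Q * Y)); rewrite mulgA QYQY mul1g -mulgA Y2 mulg1.
    by rewrite pE mulgA QYQY mul1g.
  have e' : p = D^-1.
    by apply: (mulIg D); rewrite mulVg; apply: (mulgI (Q * Y)); rewrite mulg1 mulgA -e.
  have QD : Q = D^-1.
    have := pC; rewrite e' mulgA mulVg mul1g => e2.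
    have QY : Q * Y = Y * D by rewrite [in RHS]e2 mulgVK.
    apply: (mulgI D); rewrite mulgV -(mulgK Y Q) QY YV -DYDY.
    by rewrite !mulgA.
  split=> //; case: g1' => ->; [right|left]; first by rewrite e' QD.
  by rewrite e' -QD; apply: (mulgI (Q * Y)); rewrite mulgA QYQY mul1g -mulgA Y2 mulg1.
Qed.

Lemma twist1 x : lin x = 1 -> twist x = 1.
Proof.
move=> x1; rewrite -(lin1 cr); apply: twist_uniq => v Lv; rewrite (lin1 cr) /=.
have [LP fE] := PhiLat Lv; have Lx := cr_lat cr x1; have [LPx fxE] := PhiLat Lx.
rewrite (tau_pt cr x1) fxE !(tauM cr)//.
have [_ ->] := PhiLat (latticeD Lv Lx).
by rewrite (linear_bijD _ _ PhiL).
Qed.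

(** * Trivial twists: vanishing of the defect *)

Section Untwisted.
Hypothesis tw1 : forall x, twist x = 1.
Hypothesis qcj : forall x, lin (f x) = cj (lin x).

Let fE x v : L v -> f (tau v * x) = tau (Phi v) * f x.
Proof. by move=> Lv; rewrite twistE// tw1. Qed.

(** The defect of f at (x, y). It is a translation because f acts on linear parts as the
    homomorphism [cj]. *)
Let del x y := pt (f (x * y) * (f x * f y)^-1).

Let delE x y : L (del x y) /\ f (x * y) = tau (del x y) * (f x * f y).
Proof.
have l1 : lin (f (x * y) * (f x * f y)^-1) = 1.
  by rewrite linM (linV cr) linM !qcj linM cjM mulgV.
split; first exact: (cr_lat cr).
by rewrite -(tau_pt cr l1) mulgVK.
Qed.

Let del_eq0 x y : f (x * y) = f x * f y -> del x y = 0.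
Proof. by move=> e; rewrite /del e mulgV (pt1 cr). Qed.

Let del1l x y : lin x = 1 -> del x y = 0.
Proof.
move=> x1; apply: del_eq0; have Lx := cr_lat cr x1; have [_ e] := PhiLat Lx.
by rewrite (tau_pt cr x1) fE// e.
Qed.

Let del1r x y : lin y = 1 -> del x y = 0.
Proof.
move=> y1; apply: del_eq0; have Ly := cr_lat cr y1; have [LP e] := PhiLat Ly.
have Lx := lattice_lin cr x Ly.
by rewrite (tau_pt cr y1) (tau_comm cr)// fE// e (tau_comm cr)// qcj cjE.
Qed.

Let cocycle x y z : del (x * y) z + del x y = del x (y * z) + lin (f x) (del y z).
Proof.
have [L1 e1] := delE (x * y) z; have [L2 e2] := delE x y.
have [L3 e3] := delE x (y * z); have [L4 e4] := delE y z.
have L5 := lattice_lin cr (f x) L4.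
apply: (tau_inj cr); [exact: latticeD|exact: latticeD|].
rewrite -!(tauM cr)//; apply: (mulIg (f x * f y * f z)).
have -> : tau (del (x * y) z) * tau (del x y) * (f x * f y * f z) = f (x * y * z).
  by rewrite e1 e2 !mulgA.
have -> : tau (lin (f x) (del y z)) = f x * tau (del y z) * (f x)^-1.
  by rewrite (tau_comm cr)// mulgK.
by rewrite -mulgA e3 e4 !mulgA mulgVK.
Qed.

(** f (tau v x y) and f (tau v x) f y have axes equal up to sign. The minus sign for all v would
    make [axis C] zero on L, so the defect has no component along the mirror. *)
Let del_refl x y : refl (lin (x * y)) -> lin (f (x * y)) (del x y) = - del x y.
Proof.
move=> /f_refl hC; set C := lin (f (x * y)) in hC *; have iC : isom C by right.
have [Ld dE] := delE x y; have CE : lin (f x * f y) = C.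
  by rewrite /C dE (lin_tauM cr).
suff : axis C (del x y) = 0 by rewrite /axis addrC => /eqP; rewrite addr_eq0 => /eqP.
pose D (b : bool) w := if b then 0 else axis C w + axis C w.
pose c (b : bool) := if b then axis C (del x y) else
  - (axis C (del x y) + axis C (pt (f x * f y)) + axis C (pt (f x * f y))).
have [||[] _ [h0 c0]] := @lattice_cover R w1 w2 _ [:: true; false] D c.
- move=> b u v _ Lu Lv; rewrite /D !(axisD _ _ iC); case: b; first by rewrite addr0.
  by rewrite addrACA.
- move=> w /Phi_surj[v Lv <-]; have [LP _] := PhiLat Lv.
  have := fW (tau v * x) y; rewrite -mulgA !fE// -mulgA => cc.
  have := axis_sign _ _ cc; rewrite !(lin_tauM cr)// CE -/C => /(_ hC erefl).
  rewrite !(pt_tauM cr)// dE (pt_tauM cr)// !axisD// => -[] e; [exists true|exists false] => //;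
    rewrite /D /c; vsplit e; vlra.
- exact: c0.
- exfalso; apply: (refl_axis_neq0 hC); apply: (lattice_ext cr).
  + exact: (axis_lin iC (isom1 R)).
  + by move=> k u v; rewrite scaler0 addr0.
  + by move=> w Lw; have := h0 w Lw; rewrite /D => e; vsplit e; vlra.
Qed.

(* [del] is a 2-cocycle on the point group. On a pair of reflections it must be
   normal to two different mirrors, hence vanish. *)
Let del_rr x y : refl (lin x) -> refl (lin y) -> del x y = 0.
Proof.
move=> hx hy; have [e|xy] := pselect (lin x = lin y).
  have [l Ll yE] : exists2 l, L l & y = tau l * x^-1.
    by apply: (same_lin cr); rewrite (linV cr) reflV.
  apply: del_eq0; rewrite yE fE// mulgA (tau_comm cr)// mulgK.
  have [LP _] := PhiLat Ll; have Lx := lattice_lin cr x Ll; have [_ ->] := PhiLat Lx.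
  by rewrite (wcV fW) mulgA (tau_comm cr)// mulgK qcj cjE.
have hX : refl (lin (f x)) by apply/f_refl.
have hY : refl (lin (f y)) by apply/f_refl.
have iX : isom (lin (f x)) by right.
(* These triples express del (x y, y^-1) and del (x^-1, x y) through del (x, y). The corresponding
   products are x and y, so [del_refl] applies with either mirror. *)
have c1 := cocycle x y y^-1; have c2 := cocycle x^-1 x y.
rewrite mulgV (del1r x (lin1 cr)) in c1; rewrite mulVg (del1l y (lin1 cr)) in c2.
have d1 : del y y^-1 = 0 by apply: del_eq0; rewrite (wcV fW) !mulgV (wc1 fW).
have d2 : del x^-1 x = 0 by apply: del_eq0; rewrite (wcV fW) !mulVg (wc1 fW).
rewrite d1 isom0// addr0 in c1; rewrite d2 addr0 in c2.
have r1 : lin (f x) (del (x * y) y^-1) = - del (x * y) y^-1.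
  by have := @del_refl (x * y) y^-1; rewrite mulgK; apply.
have r2 : lin (f y) (del x^-1 (x * y)) = - del x^-1 (x * y).
  by have := @del_refl x^-1 (x * y); rewrite mulKg; apply.
have e1 : del (x * y) y^-1 = - del x y by apply/eqP; rewrite -addr_eq0 c1.
have fxV : lin (f x^-1) = lin (f x) by rewrite (wcV fW) (linV cr) reflV.
have e2 : del x^-1 (x * y) = - lin (f x) (del x y).
  by apply/eqP; rewrite -addr_eq0 -fxV -c2.
have Xd : lin (f x) (del x y) = - del x y.
  by move: r1; rewrite e1 isomN// opprK => e; rewrite -[in RHS]e opprK.
have Yd : lin (f y) (del x y) = - del x y by move: r2; rewrite e2 Xd opprK.
have [/f_lin_inj//|//] := refl_anti_inj hX hY Xd Yd.
Qed.

(** The cocycle identity reduces pairs containing a rotation to pairs of reflections, after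
    multiplying rotations by a reflection; y0 serves when both entries are rotations. *)
Lemma untwisted_morph (y0 : gT) : refl (lin y0) -> {morph f : x y / x * y >-> x * y}.
Proof.
move=> h0.
have reflV' y : refl (lin y) -> refl (lin y^-1) by move=> h; rewrite (linV cr) reflV.
have del_wr x y : rotn (lin x) -> refl (lin y) -> del x y = 0.
  move=> hx hy; have hxy : refl (lin (x * y)) by rewrite linM; exact: rotn_reflM.
  have := cocycle (x * y) y^-1 y; rewrite mulgK mulVg (del1r _ (lin1 cr)).
  by rewrite (del_rr hxy (reflV' _ hy)) (del_rr (reflV' _ hy) hy) (isom0 (isoL _)) !addr0.
have del_rw x y : refl (lin x) -> rotn (lin y) -> del x y = 0.
  move=> hx hy; have hxy : refl (lin (x * y)) by rewrite linM; exact: refl_rotnM.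
  have := cocycle x x^-1 (x * y); rewrite mulgV mulKg (del1l _ (lin1 cr)).
  by rewrite (del_rr hx (reflV' _ hx)) (del_rr (reflV' _ hx) hxy) (isom0 (isoL _)) !addr0 => <-.
have del_ww x y : rotn (lin x) -> rotn (lin y) -> del x y = 0.
  move=> hx hy; have hyy : refl (lin (y * y0)) by rewrite linM; exact: rotn_reflM.
  have hxy : refl (lin (x * (y * y0))) by rewrite linM; exact: rotn_reflM.
  have := cocycle x (y * y0) y0^-1; rewrite mulgK.
  rewrite (del_rr hxy (reflV' _ h0)) (del_rr hyy (reflV' _ h0)) (del_wr _ _ hx hyy).
  by rewrite (isom0 (isoL _)) !addr0 => <-.
move=> x y; have [_ ->] := delE x y.
suff -> : del x y = 0 by rewrite (tau0 cr) mul1g.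
by case: (isoL x) => hx; case: (isoL y) => hy;
  [exact: del_ww|exact: del_wr|exact: del_rw|exact: del_rr].
Qed.

End Untwisted.

Lemma refl_untwisted_morph y0 : refl (lin y0) -> (forall y, refl (lin y) -> twist y = 1) ->
  {morph f : x y / x * y >-> x * y}.
Proof.
move=> h0 ht; have rw x : rotn (lin x) -> twist x = 1 /\ lin (f x) = cj (lin x).
  move=> hx; have [/(_ (ht _ h0))[qx t1] _] := rotn_twist hx h0; split=> //.
  have hxy : refl (lin (x * y0)) by rewrite linM; exact: rotn_reflM.
  have [/(_ (ht _ hxy))[_ t2] _] := rotn_twist hx hxy.
  (* The second alternatives, for y0 and for x y0, agree only if f y0 and f (x y0) have the same
     linear part, that is, if lin x = 1. *)
  case: t1 => // t1; case: t2 => // t2; apply: twist1.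
  have /f_lin_inj : lin (f y0) = lin (f (x * y0)) by apply: (mulgI (lin (f x))); rewrite -t1 -t2.
  by rewrite linM => e; apply: (mulIg (lin y0)); rewrite mul1g -e.
apply: untwisted_morph h0 => x; case: (isoL x) => hx.
- by have [] := rw x hx.
- exact: ht.
- by have [] := rw x hx.
- by rewrite refl_cj//; apply/f_refl.
Qed.

(** * Both twists at reflections *)

Section Mixed.
Variables x0 y0 : gT.
Hypothesis hx0 : refl (lin x0).
Hypothesis hy0 : refl (lin y0).
Hypothesis tx0 : twist x0 = 1.
Hypothesis ty0 : twist y0 = lin (f y0).
Notation C := (lin (f x0)).

Let hC : refl C. Proof. by apply/f_refl. Qed.
Let hY : refl (lin (f y0)). Proof. by apply/f_refl. Qed.
Let iC : isom C. Proof. by right. Qed.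

(** x0 gives lin (f z) = cj (lin z), while y0 gives its inverse. *)
Lemma mixed_rotn z : rotn (lin z) -> lin z = 1 \/ lin z = neg R.
Proof.
move=> hz; apply: rotn_sq1 => //.
have [/(_ tx0)[e1 _] _] := rotn_twist hz hx0; have [_ /(_ ty0)[e2 _]] := rotn_twist hz hy0.
by apply: cj_inj; rewrite cjM cj1 -{1}e1 e2 mulVg.
Qed.

Lemma mixed_lin : lin y0 = neg R * lin x0 /\ lin (f y0) = neg R * C.
Proof.
have xy : lin x0 <> lin y0.
  by move=> /twist_lin e; apply: (refl_neq1 hY); rewrite -ty0 -e.
have [e|e] : lin (x0 * y0) = 1 \/ lin (x0 * y0) = neg R.
  by apply: mixed_rotn; rewrite linM; exact: reflM.
  by exfalso; apply: xy; apply: (mulgI (lin x0)); rewrite reflK// -linM e.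
have yE : lin y0 = neg R * lin x0.
  by rewrite neg_comm// -e linM mulgA reflK// mul1g.
by split; [exact: yE|rewrite -(refl_cj hY) -(refl_cj hC) yE cjM cj_neg].
Qed.

Let negC : neg R * C = C * neg R. Proof. exact: (neg_comm iC). Qed.
Let neg2 : neg R * neg R = 1. Proof. exact: (negM R). Qed.
Let iY : isom (neg R * C). Proof. by apply: isomM iC; left; exact: rotn_neg. Qed.
Let hY' : refl (neg R * C). Proof. by rewrite -mixed_lin.2. Qed.

(** The common element of the two lists of [rotn_twist]: 1 and -C from x0, -C and -1 from y0. *)
Let twist_neg z : lin z = neg R -> twist z = neg R * C.
Proof.
move=> zE; have hz : rotn (lin z) by rewrite zE; exact: rotn_neg.
have [/(_ tx0)[e1 t1] _] := rotn_twist hz hx0; have [_ /(_ ty0)[e2 t2]] := rotn_twist hz hy0.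
rewrite e1 zE cj_neg in t1 t2; rewrite mixed_lin.2 in t2.
case: t1 => // t1; case: t2 => // t2; exfalso.
by apply: (@neg_neq1 R); rewrite -t1 -t2.
Qed.

Let axisY v : axis C ((neg R * C)%g v) = - axis C v.
Proof. by rewrite /= axisN// axis_refl. Qed.

Let axisYY v : axis (neg R * C) ((neg R * C)%g v) = axis (neg R * C) v.
Proof. exact: axis_refl. Qed.

Let twist_y y1 : lin y1 = lin y0 -> twist y1 = neg R * C /\ lin (f y1) = neg R * C.
Proof. by move=> e; rewrite (twist_lin e) ty0 mixed_lin.2; split=> //; rewrite (f_lin e) mixed_lin.2. Qed.

Let twist_x x1 : lin x1 = lin x0 -> twist x1 = 1 /\ lin (f x1) = C.
Proof. by move=> e; rewrite (twist_lin e) tx0 (f_lin e). Qed.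

Let f_neg z : lin z = neg R -> lin (f z) = neg R.
Proof.
move=> zE; have hz : rotn (lin z) by rewrite zE; exact: rotn_neg.
by have [/(_ tx0)[-> _] _] := rotn_twist hz hx0; rewrite zE cj_neg.
Qed.

(** In the conjugacy of f (tau v y1 z1) with f (tau v y1) f z1, the twist at y1 reverses [axis C]
    and the twist at y1 z1 does not, so only the minus sign can hold for all v. *)
Let axis_yz y1 z1 : lin y1 = lin y0 -> lin z1 = neg R ->
  axis C (pt (f (y1 * z1))) = - axis C (pt (f y1 * f z1)).
Proof.
move=> ly lz; have lx : lin (y1 * z1) = lin x0.
  by rewrite linM ly lz -(neg_comm (isoL y0)) mixed_lin.1 mulgA neg2 mul1g.
have [[tx qx] [ty qy]] := (twist_x lx, twist_y ly); have qz := f_neg lz.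
have lh : lin (f y1 * f z1) = C by rewrite linM qy qz -mulgA -negC mulgA neg2 mul1g.
pose D (b : bool) w := if b then axis C w + axis C w else 0.
pose c (b : bool) := if b then axis C (pt (f y1 * f z1)) - axis C (pt (f (y1 * z1)))
  else axis C (pt (f (y1 * z1))) + axis C (pt (f y1 * f z1)).
have [||[] _ [h0 c0]] := @lattice_cover R w1 w2 _ [:: true; false] D c.
- move=> b u v _ Lu Lv; rewrite /D !(axisD _ _ iC); case: b; last by rewrite addr0.
  by rewrite addrACA.
- move=> w /Phi_surj[v Lv <-]; have [LP _] := PhiLat Lv; have Lt := twist_lat y1 LP.
  have := fW (tau v * y1) z1; rewrite -mulgA !twistE// -mulgA => cc.
  have L1 := twist_lat (y1 * z1) LP.
  have := axis_sign _ _ cc; rewrite !(lin_tauM cr)// qx lh => /(_ hC erefl).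
  rewrite !(pt_tauM cr)// ty tx !axisD// axisY /= => -[] e; [exists true|exists false] => //;
    rewrite /D /c; vsplit e; vlra.
- exfalso; apply: (refl_axis_neq0 hC); apply: (lattice_ext cr).
  + exact: (axis_lin iC (isom1 R)).
  + by move=> k u v; rewrite scaler0 addr0.
  + by move=> w Lw; have := h0 w Lw; rewrite /D => e; vsplit e; vlra.
- by rewrite /c in c0; vsplit c0; vlra.
Qed.

Let conj_xz x1 z1 : lin x1 = lin x0 -> lin z1 = neg R ->
  exists2 m, L m & pt (f (x1 * z1)) = pt (f x1 * f z1) + (m - (neg R * C)%g m).
Proof.
move=> lx lz; have ly : lin (x1 * z1) = lin y0.
  by rewrite linM lx lz -(neg_comm (isoL x0)) mixed_lin.1.
have [[tx qx] [ty qy]] := (twist_x lx, twist_y ly); have qz := f_neg lz.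
set Y := neg R * C in ty qy *.
have lh : lin (f x1 * f z1) = Y by rewrite linM qx qz -negC.
set h := pt (f x1 * f z1); set d := pt (f (x1 * z1)).
(* [axis_conj_lattice] needs equal non-zero axes. A lattice vector s with a non-zero axis, and with
   the two axes not opposite, exists because [axis Y] is not zero on L. *)
have [s Ls [s1 s2]] : exists2 s, L s & axis Y (s + h) <> 0 /\ axis Y (Y s + d) <> - axis Y (s + h).
  apply: contrapT => no.
  pose D (b : bool) w := if b then axis Y w else axis Y w + axis Y w.
  pose c (b : bool) := if b then - axis Y h else - (axis Y h + axis Y d).
  have [||b _ [h0 _]] := @lattice_cover R w1 w2 _ [:: true; false] D c.
  - move=> b u v _ Lu Lv; rewrite /D !(axisD _ _ iY); case: b => //.
    by rewrite addrACA.
  - move=> s Ls; apply: contrapT => ns; apply: no; exists s => //; split=> e; apply: ns.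
      by exists true => //; rewrite /D /c; apply/eqP; rewrite -addr_eq0 -axisD//; apply/eqP.
    exists false => //; rewrite /D /c; move: e; rewrite !axisD// axisYY => e; vsplit e; vlra.
  apply: (refl_axis_neq0 hY'); apply: (lattice_ext cr).
  + exact: (axis_lin iY (isom1 R)).
  + by move=> k u v; rewrite scaler0 addr0.
  + by move=> w Lw; have := h0 w Lw; rewrite /D; case: b h0 => // _ e; vsplit e; vlra.
have [v Lv vE] := Phi_surj Ls; have [LP _] := PhiLat Lv; have L1 := twist_lat (x1 * z1) LP.
have L2 := twist_lat x1 LP.
have := fW (tau v * x1) z1; rewrite -mulgA !twistE// -mulgA tx ty vE in L1 L2 * => /conjugate_sym cc.
have [e1 e2] : lin (tau s * (f x1 * f z1)) = Y /\ lin (tau (Y s) * f (x1 * z1)) = Y.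
  by rewrite !(lin_tauM cr).
have p1 : pt (tau s * (f x1 * f z1)) = s + h by rewrite (pt_tauM cr).
have p2 : pt (tau (Y s) * f (x1 * z1)) = Y s + d by rewrite (pt_tauM cr).
have := axis_conj_lattice _ _ cc; rewrite e1 e2 p1 p2 => /(_ hY' erefl) H.
have [||l Ll lE] := H.
  by have := axis_sign _ _ cc; rewrite e1 e2 p1 p2 => /(_ hY' erefl)[].
  exact: s1.
exists (l + s); first exact: latticeD.
rewrite (isomD _ _ iY); vsplit lE; vlra.
Qed.

(** Take a half-turn z1 and y = x0 z1, so that y z1 = x0. Then [axis_yz] and [conj_xz] give axis C
    (pt (f x0)) = - axis C m, and tau m f x0 is a true reflection rather than a glide. *)
Lemma mixed_mirror : exists2 X, lin X = C & axis C (pt X) = 0.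
Proof.
have [z1 lz] : exists z, lin z = neg R.
  by exists (x0 * y0); rewrite linM mixed_lin.1 mulgA -(neg_comm (isoL x0)) -mulgA reflK// mulg1.
have z2 : z1 * z1 = 1.
  by apply: (cr_inj cr); rewrite ?linM ?ptM lz ?(lin1 cr) ?(pt1 cr) /= ?subrr.
have ly : lin (x0 * z1) = lin y0.
  by rewrite linM lz -(neg_comm (isoL x0)) mixed_lin.1.
have := axis_yz ly lz; rewrite -mulgA z2 mulg1.
have [m Lm mE] := conj_xz (erefl (lin x0)) lz.
rewrite !ptM (f_lin ly) mixed_lin.2 mE ptM !axisD// axisY axisN// axisY axis_refl// => e.
exists (tau m * f x0); first exact: (lin_tauM cr).
rewrite (pt_tauM cr)// axisD//; vsplit e; vlra.
Qed.

(** The conclusion says that L is rectangular and not rhombic: the projection of a lattice vector to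
    the mirror of C lies in L. The halving comes from the half-turn X Y, whose conjugates differ
    from it by translations in 2 L. *)
Lemma mixed_rect X Y : lin X = C -> lin Y = neg R * C ->
  axis C (pt X) = 0 -> axis (neg R * C) (pt Y) = 0 ->
  forall w, L w -> exists2 u, L u & axis C w = u + u.
Proof.
move=> lX lY aX aY; have pX : C (pt X) = - pt X by apply/eqP; rewrite -addr_eq0 addrC; apply/eqP.
have pY : C (pt Y) = pt Y.
  by move: aY; rewrite /axis /= => /eqP; rewrite subr_eq0 eq_sym => /eqP.
have XY : X * Y = Y * X.
  apply: (cr_inj cr); first by rewrite !linM lX lY mulgA negC.
  by rewrite !ptM lX lY /= pX pY opprK addrC.
have [z0 z0E] : exists z0, z0 = X * Y by exists (X * Y).
have lz0 : lin z0 = neg R by rewrite z0E linM lX lY negC mulgA reflK// mul1g.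
(* Each linear part is represented by one of 1, z0, X, Y, all commuting with z0, so only conjugation
   by translations matters, and tau l moves a half-turn by 2 l. *)
have cls h : conjugate h z0 -> exists2 l, L l & h = tau (l + l) * z0.
  move=> /conjugate_sym[g' gE]; pose g := g'^-1.
  have {}gE : h = g * z0 * g^-1 by rewrite gE /g invgK conjgE mulgA.
  have [e ez0 eE] : exists2 e, e * z0 = z0 * e & lin g = lin e.
    have [hg|hg] := isoL g.
      case: (mixed_rotn hg) => eg; first by exists 1; rewrite ?mul1g ?mulg1 ?(lin1 cr).
      by exists z0 => //; rewrite lz0.
    have /mixed_rotn [eg|eg] : rotn (lin (g * X)) by rewrite linM lX; exact: reflM.
      exists X; first by rewrite z0E -mulgA XY.
      by rewrite lX -[LHS]mulg1 -(reflK hC) mulgA -{1}lX -linM eg mul1g.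
    exists Y; first by rewrite z0E mulgA -XY.
    by rewrite lY -[LHS]mulg1 -(reflK hC) mulgA -{1}lX -linM eg.
  have [l Ll gE'] := same_lin cr eE; exists l => //.
  rewrite gE gE' invgM -!mulgA (mulgA e) ez0 -mulgA (mulgA e) mulgV mul1g mulgA.
  by rewrite (tau_conjV cr)// lz0 /= opprK.
pose x1 := f^-1 X; pose y1 := f^-1 Y.
have fx1 : f x1 = X by rewrite bijVK.
have fy1 : f y1 = Y by rewrite bijVK.
have lx : lin x1 = lin x0 by apply: f_lin_inj; rewrite fx1.
have ly : lin y1 = lin y0 by apply: f_lin_inj; rewrite fy1 mixed_lin.2.
have lz : lin (x1 * y1) = neg R.
  by rewrite linM lx ly mixed_lin.1 mulgA -(neg_comm (isoL x0)) -mulgA reflK// mulg1.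
have [[tx _] [ty _]] := (twist_x lx, twist_y ly); have tz := twist_neg lz.
have [l1 Ll1 e1] : exists2 l, L l & f (x1 * y1) = tau (l + l) * z0.
  by apply: cls; rewrite z0E; have := fW x1 y1; rewrite fx1 fy1.
move=> w Lw; have [v Lv vE] := Phi_surj Lw; have [LP _] := PhiLat Lv.
have Lx := lattice_lin cr x1 Lv; have Lvx := latticeD Lv Lx; have [LPx _] := PhiLat Lvx.
have L1 := twist_lat (x1 * y1) LPx; have L2 := twist_lat y1 LP; have L3 := twist_lat x1 LP.
have := fW (tau v * x1) (tau v * y1).
have -> : tau v * x1 * (tau v * y1) = tau (v + lin x1 v) * (x1 * y1).
  by rewrite mulgA -(mulgA (tau v)) (tau_comm cr)// (mulgA (tau v)) (tauM cr)// mulgA.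
rewrite !twistE//.
(* The two twists make the translation parts cancel: w + C (- C w) = 0. *)
have -> : tau (twist x1 (Phi v)) * f x1 * (tau (twist y1 (Phi v)) * f y1) = z0.
  rewrite mulgA -(mulgA _ (f x1)) (tau_comm cr)// (mulgA (tau _)) fx1 fy1 lX.
  rewrite (tauM cr)//; last exact: (lattice_lin cr).
  rewrite tx ty /= (isomN _ iC) -[C (C _)]/((C * C) _) reflK//= subrr (tau0 cr).
  by rewrite mul1g z0E.
move=> /cls[l2 Ll2]; rewrite e1 mulgA (tauM cr)//; last exact: latticeD.
move=> /mulIg /(tau_inj cr) e2.
have {}e2 := e2 (latticeD L1 (latticeD Ll1 Ll1)) (latticeD Ll2 Ll2).
exists (l1 - l2); first exact: latticeB.
move: e2; rewrite tz (linear_bijD _ _ PhiL) -cjE lx (refl_cj hC) vE (isomD _ _ iY) /=.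
rewrite -[C (C _)]/((C * C) _) reflK//= /axis => e2; vsplit e2; vlra.
Qed.

End Mixed.

End Structure.

Section ClosedPred.
Variables (gT : groupType) (S : {pred gT}).
(** The closure proof is a phantom argument, to which the inferred subgroup structure is
    attached. *)
Definition closed_pred of group_closed S : {pred gT} := S.
Hypothesis Sc : group_closed S.
HB.instance Definition _ := isMulClosed.Build _ (closed_pred Sc) (group_closedM Sc).
HB.instance Definition _ := isMul1Closed.Build _ (closed_pred Sc) Sc.1.
HB.instance Definition _ := isInvClosed.Build _ (closed_pred Sc) (group_closedV Sc).
End ClosedPred.

(** * Internal direct products *)

Section Products.
Variable gT : groupType.

Lemma ord2P (P : 'I_2 -> Prop) : P ord0 -> P ord_max -> forall i, P i.
Proof.
move=> P0 P1 i; case: i => [[|[|//]]] p.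
  by rewrite (_ : Ordinal p = ord0)//; apply: val_inj.
by rewrite (_ : Ordinal p = ord_max)//; apply: val_inj.
Qed.

Definition mk_elt (G : groupClosed gT) a (aG : a \in G) : elts G := exist (fun x => x \in G) a aG.

Lemma internal_product (H0 H1 : groupClosed gT) :
  (forall a b, a \in H0 -> b \in H1 -> a * b = b * a) ->
  (forall a, a \in H0 -> a \in H1 -> a = 1) ->
  (forall g, exists a b, [/\ a \in H0, b \in H1 & g = a * b]) ->
  (exists a b, [/\ a \in H0, b \in H0 & a * b <> b * a]) ->
  (exists a b, [/\ a \in H1, b \in H1 & a * b <> b * a]) ->
  product_of_nonabelian gT.
Proof.
move=> comm triv dec na0 na1.
pose H (i : 'I_2) := if i == ord0 then H0 else H1.
have dec' g : exists h : forall i, elts (H i), g = val (h ord0) * val (h ord_max).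
  have [a [b [aH bH gE]]] := dec g.
  have hP : forall i, (if i == ord0 then a else b) \in H i by apply: ord2P.
  by exists (fun i => mk_elt (hP i)).
have uni (h k : forall i, elts (H i)) :
    val (h ord0) * val (h ord_max) = val (k ord0) * val (k ord_max) -> h = k.
  move=> e; have [h0 h1 k0 k1] : [/\ val (h ord0) \in H0, val (h ord_max) \in H1,
    val (k ord0) \in H0 & val (k ord_max) \in H1].
    by split; [exact: (valP (h ord0))|exact: (valP (h ord_max))|exact: (valP (k ord0))|exact: (valP (k ord_max))].
  have e' : (val (k ord0))^-1 * val (h ord0) = val (k ord_max) * (val (h ord_max))^-1.
    by apply: (mulIg (val (h ord_max))); rewrite mulgVK -mulgA e mulKg.
  have t1 : (val (k ord0))^-1 * val (h ord0) = 1.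
    apply: triv; first by apply: gpredM => //; rewrite gpredV.
    by rewrite e'; apply: gpredM => //; rewrite gpredV.
  apply: functional_extensionality_dep; apply: ord2P; apply: val_inj.
    by apply: (mulgI (val (k ord0))^-1); rewrite t1 mulVg.
  by apply: (mulIg (val (h ord_max))^-1); rewrite mulgV -e' t1.
pose phi g := sval (cid (dec' g)).
have phiE g : g = val (phi g ord0) * val (phi g ord_max) by rewrite /phi; case: cid.
exists 2%N, (fun i => elts (H i) : groupType), phi; split => //.
- apply: ord2P.
    have [a [b [aH bH ab]]] := na0; exists (mk_elt aH), (mk_elt bH).
    by apply/eqP => /(congr1 val).
  have [a [b [aH bH ab]]] := na1; exists (mk_elt aH), (mk_elt bH).
  by apply/eqP => /(congr1 val).
- exists (fun h : forall i, elts (H i) => val (h ord0) * val (h ord_max)) => [g|h]; first by rewrite -phiE.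
  by apply: uni; rewrite -phiE.
- move=> x y; suff -> : phi (x * y) = fun i => phi x i * phi y i by [].
  apply: uni; rewrite -phiE [in LHS](phiE x) [in LHS](phiE y) !valM /=.
  rewrite -!mulgA; congr (_ * _); rewrite !mulgA; congr (_ * _).
  by apply/esym/comm; [exact: (valP (phi y ord0))|exact: (valP (phi x ord_max))].
Qed.

End Products.

(** * Trivial weak Cayley maps *)

Section WeakCayley0.
Variable gT : groupType.
Implicit Type f : bijection gT.

Definition antimorph f := forall x y, f (x * y) = f y * f x.

Definition auto_anti : {pred bijection gT} :=
  fun f => `[< {morph f : x y / x * y >-> x * y} \/ antimorph f >].

Lemma auto_antiP f : reflect ({morph f : x y / x * y >-> x * y} \/ antimorph f) (f \in auto_anti).
Proof. exact: asboolP. Qed.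

Lemma auto_anti_closed : group_closed auto_anti.
Proof.
split; first by apply/auto_antiP; left.
move=> f g /auto_antiP hf /auto_antiP hg; apply/auto_antiP.
have hg' : {morph (g^-1)%g : x y / x * y >-> x * y} \/ antimorph (g^-1)%g.
  by case: hg => h; [left|right] => x y; apply: (@bij_inj _ g); rewrite h !bijVK.
case: hf hg' => hf [hg'|hg']; [left|right|right|left] => x y;
  by rewrite /= hg' hf.
Qed.

(** Automorphisms and anti-automorphisms form a group containing the generators, and an
    anti-automorphism is inversion composed with an automorphism. *)
Lemma weak_cayley0E f : weak_cayley0 gT f <-> {morph f : x y / x * y >-> x * y} \/ antimorph f.
Proof.
split.
  have sub : automorphisms gT `|` [set inversion gT] `<=` [set` closed_pred auto_anti_closed].
    move=> g [hg|->] /=; apply/auto_antiP; [by left|right => x y /=; exact: invgM].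
  by move=> /(_ (closed_pred auto_anti_closed) sub) /auto_antiP.
case=> h S sub; first by apply: sub; left.
have -> : f = inversion gT * (inversion gT * f) by apply: bijectionP => x /=; rewrite invgK.
apply: gpredM; apply: sub; [by right|left => x y /=].
by rewrite h invgM.
Qed.

Lemma weak_cayley0_sub f : weak_cayley0 gT f -> weak_cayley gT f.
Proof.
move=> /weak_cayley0E[] h x y; rewrite h; first exact: conjugate_refl.
exact: conjugate_mulC.
Qed.

Lemma weak_cayley_comp f g : weak_cayley gT f -> weak_cayley gT g -> weak_cayley gT (f * g).
Proof.
move=> hf hg x y /=; apply: conjugate_trans (hf _ _).
by apply: wc_conj.
Qed.

Lemma weak_cayley_inversion f : weak_cayley gT f -> weak_cayley gT (inversion gT * f).
Proof.
move=> hf; apply: weak_cayley_comp => //; apply: weak_cayley0_sub.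
by apply/weak_cayley0E; right=> x y /=; exact: invgM.
Qed.

Lemma nontrivial_weak_cayley_neq f : weak_cayley gT f -> ~ weak_cayley0 gT f ->
  weak_cayley gT <> weak_cayley0 gT.
Proof. by move=> fW f0 e; apply: f0; rewrite -e. Qed.

Lemma trivial_semidirect : weak_cayley gT = weak_cayley0 gT ->
  exists N : groupClosed (bijection gT),
  (forall f, f \in N -> f <> 1 -> weak_cayley gT f /\ ~ weak_cayley0 gT f) /\
  semidirect (weak_cayley gT) N (weak_cayley0 gT).
Proof.
move=> WE; pose one_only : {pred bijection gT} := fun f => f == 1.
have tc : group_closed one_only.
  split=> [|f g]; first exact/eqP.
  by move=> /eqP -> /eqP ->; apply/eqP; rewrite mulgV.
have W1 : weak_cayley0 gT 1 by apply/weak_cayley0E; left.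
have NE f : (f \in closed_pred tc) = (f == 1) by [].
exists (closed_pred tc : groupClosed (bijection gT)); split=> [f|]; first by rewrite NE => /eqP.
rewrite WE; split=> //.
- split=> [f|f h]; first by rewrite /= NE => /eqP ->.
  by rewrite NE => /eqP -> _; rewrite conj1g NE.
- apply/seteqP; split=> [f [/= + _]|f /= ->]; first by rewrite NE => /eqP.
  by split=> //=; rewrite NE.
- apply/seteqP; split=> [f f0|_ [n /= + [h h0 <-]]]; last by rewrite NE => /eqP ->; rewrite mul1g.
  by exists 1; [rewrite /= NE|exists f => //; rewrite mul1g].
Qed.

(* Inverting a single factor is neither an automorphism nor an anti-automorphism. *)
Lemma product_nontrivial : product_of_nonabelian gT -> weak_cayley gT <> weak_cayley0 gT.
Proof.
move=> [k [H [phi [k2 na [psi phiK psiK] phiM]]]].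
pose i0 : 'I_k := Ordinal (ltnW k2); pose i1 : 'I_k := Ordinal k2.
have i01 : i1 != i0 by [].
pose sw (h : forall i, H i) i := if i == i0 then (h i)^-1 else h i.
have swK h : sw (sw h) = h.
  by apply: functional_extensionality_dep => i; rewrite /sw; case: (i == i0); rewrite ?invgK.
pose F x := psi (sw (phi x)).
have FK : cancel F F by move=> x; rewrite /F psiK swK phiK.
pose f : bijection gT := Bijection (Bijective FK FK).
have fphi x i : phi (f x) i = sw (phi x) i by rewrite /= /F psiK.
have phi_inj x y : (forall i, phi x i = phi y i) -> x = y.
  by move=> e; rewrite -[x]phiK -[y]phiK; congr psi; exact: functional_extensionality_dep.
have phi1 i : phi 1 i = 1 by apply: (mulgI (phi 1 i)); rewrite -phiM !mulg1.
have phiV x i : phi x^-1 i = (phi x i)^-1.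
  by apply: (mulIg (phi x i)); rewrite -phiM !mulVg phi1.
apply: (@nontrivial_weak_cayley_neq f).
  (* In the factor i0, conjugating (x y)^-1 by x gives x^-1 y^-1; in the other factors the map is
     the identity. *)
  move=> x y; exists (psi (fun i => if i == i0 then phi x i else 1)).
  apply: phi_inj => i; rewrite conjgE !phiM phiV !fphi !psiK /sw.
  case: ifP => _; last by rewrite phiM invg1 mul1g mulg1.
  by rewrite phiM invgM mulgVK.
move=> /weak_cayley0E[] h.
  have [a [b /eqP ab]] := na i0; apply: ab.
  (* The family with c at i0 and 1 elsewhere; [ecast] carries c along the equality of indices. *)
  pose e (c : H i0) i : H i := if eqP : reflect (i0 = i) _ is ReflectT e then ecast j (H j) e c else 1.
  have ee c : e c i0 = c by rewrite /e; case: eqP => // p; rewrite eq_axiomK.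
  have : phi (f (psi (e a^-1) * psi (e b^-1))) i0 = phi (f (psi (e a^-1)) * f (psi (e b^-1))) i0.
    by rewrite h.
  by rewrite phiM !fphi /sw eqxx phiM !psiK !ee invgM !invgK => ->.
have [a [b /eqP ab]] := na i1; apply: ab.
pose e (c : H i1) i : H i := if eqP : reflect (i1 = i) _ is ReflectT e then ecast j (H j) e c else 1.
have ee c : e c i1 = c by rewrite /e; case: eqP => // p; rewrite eq_axiomK.
have : phi (f (psi (e a) * psi (e b))) i1 = phi (f (psi (e b)) * f (psi (e a))) i1.
  by rewrite h.
by rewrite phiM !fphi /sw (negbTE i01) phiM !psiK !ee.
Qed.

End WeakCayley0.

(** * The dichotomy in the presence of reflections *)

Section Reflections.
Variable R : realType.
Notation V := 'rV[R]_2.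
Notation B := (bijection V).
Implicit Types (A C D : B).
Variables (gT : groupType) (lin : gT -> B) (pt : gT -> V) (tau : V -> gT) (w1 w2 : V).
Hypothesis cr : crystal lin pt tau w1 w2.
Notation L := (lattice w1 w2).
Implicit Types (x y z : gT) (u v w : V).

Let linM := cr_linM cr.
Let ptM := cr_ptM cr.
Let isoL := lin_isom cr.

(* The elements moving points only along a line, normal to the mirror of the involution D. *)
Definition line_group D : {pred gT} :=
  fun g => `[< (lin g = 1 \/ lin g = D) /\ D (pt g) = - pt g >].

Lemma line_groupP D g : reflect ((lin g = 1 \/ lin g = D) /\ D (pt g) = - pt g) (g \in line_group D).
Proof. exact: asboolP. Qed.

Lemma line_group_closed D : refl D -> group_closed (line_group D).
Proof.
move=> hD; have iD : isom D by right.
split; first by apply/line_groupP; rewrite (lin1 cr) (pt1 cr) oppr0 isom0//; split=> //; left.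
move=> g h /line_groupP[lg pg] /line_groupP[lh ph]; apply/line_groupP.
rewrite linM (linV cr) ptM (ptV cr); split.
  by case: lg => ->; case: lh => ->; rewrite ?invg1 ?reflV ?mulg1 ?mul1g ?reflK//; [left|right|right|left].
have hV : (lin h)^-1%g (pt h) = pt h \/ (lin h)^-1%g (pt h) = - pt h.
  by case: lh => ->; [left; rewrite invg1|right; rewrite reflV].
have : lin g (- (lin h)^-1%g (pt h)) = pt h \/ lin g (- (lin h)^-1%g (pt h)) = - pt h.
  rewrite isomN ?isoL//; case: hV => ->; case: lg => -> /=; rewrite ?isomN// ?ph ?opprK; by [left|right].
by case=> ->; rewrite (isomD _ _ iD) ?(isomN _ iD) pg ph opprD.
Qed.

(** The factors are the line groups of C and -C. [rect] splits each lattice vector along the two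
    perpendicular axes, and X and Y invert the translations along their own axes, which makes both
    factors non-abelian. *)
Lemma crystal_product C X Y : refl C -> lin X = C -> lin Y = neg R * C ->
  axis C (pt X) = 0 -> axis (neg R * C) (pt Y) = 0 ->
  (forall w, L w -> exists2 u, L u & axis C w = u + u) ->
  (forall g, [\/ lin g = 1, lin g = neg R, lin g = C | lin g = neg R * C]) ->
  product_of_nonabelian gT.
Proof.
move=> hC lX lY aX aY rect pg; have iC : isom C by right.
have iN : isom (neg R) by left; exact: rotn_neg.
have negC := neg_comm iC; have hY : refl (neg R * C) by apply: rotn_reflM => //; exact: rotn_neg.
have pX : C (pt X) = - pt X by apply/eqP; rewrite -addr_eq0 addrC; apply/eqP.
have pY : (neg R * C)%g (pt Y) = - pt Y by apply/eqP; rewrite -addr_eq0 addrC; apply/eqP.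
have H1e g : (neg R * C)%g (pt g) = - pt g <-> C (pt g) = pt g.
  by rewrite /=; split=> [/oppr_inj//|->].
have half w : L w -> exists u u', [/\ L u, L u', C u = u, C u' = - u' & w = u' + u].
  move=> Lw; have [u Lu uE] := rect w Lw; exists u, (w - u).
  have Cu : C u = u.
    have := axis_fix w hC; rewrite uE (isomD _ _ iC) => e; vsplit e; vlra.
  split; [exact: Lu|exact: latticeB|exact: Cu| |by rewrite subrK].
  by rewrite (isomB _ _ iC) Cu; rewrite /axis in uE; vsplit uE; vlra.
have tX u' : L u' -> C u' = - u' -> tau u' \in closed_pred (line_group_closed hC).
  by move=> Lu' Cu'; apply/line_groupP; rewrite (lin_tau cr)// (pt_tau cr)//; split=> //; left.
have tY u : L u -> C u = u -> tau u \in closed_pred (line_group_closed hY).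
  by move=> Lu Cu; apply/line_groupP; rewrite (lin_tau cr)// (pt_tau cr)//=; split; [left|rewrite Cu].
have XH : X \in closed_pred (line_group_closed hC) by apply/line_groupP; split=> //; right.
have YH : Y \in closed_pred (line_group_closed hY) by apply/line_groupP; split=> //; right.
have comm a b : a \in line_group C -> b \in line_group (neg R * C) -> a * b = b * a.
  move=> /line_groupP[la pa] /line_groupP[lb /H1e pb].
  apply: (cr_inj cr).
    by rewrite !linM; case: la => ->; case: lb => ->; rewrite ?mul1g ?mulg1// mulgA negC.
  rewrite !ptM; have -> : lin a (pt b) = pt b by case: la => -> //=.
  have -> : lin b (pt a) = pt a by case: lb => -> //=; rewrite pa opprK.
  exact: addrC.
apply: (internal_product (H0 := closed_pred (line_group_closed hC))
                         (H1 := closed_pred (line_group_closed hY))).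
- exact: comm.
- move=> a /line_groupP[la pa] /line_groupP[lb /H1e pb]; apply: (cr_inj cr).
    rewrite (lin1 cr); case: la => // la; case: lb => // lb; exfalso.
    apply: (@neg_neq1 R); apply: (mulIg C); rewrite mul1g -lb; exact: la.
  by rewrite (pt1 cr); apply: vec_eq_opp0; rewrite -pa pb.
- move=> g.
  have [e0 [e1 [e0H e1H lg]]] : exists e0 e1, [/\ e0 \in closed_pred (line_group_closed hC),
      e1 \in closed_pred (line_group_closed hY) & lin g = lin (e0 * e1)].
    case: (pg g) => ->; [exists 1, 1|exists X, Y|exists X, 1|exists 1, Y]; split=> //; try exact: gpred1.
    - by rewrite mulg1 (lin1 cr).
    - by rewrite linM lX lY negC mulgA reflK// mul1g.
    - by rewrite mulg1 lX.
    - by rewrite mul1g lY.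
  have [l Ll ->] := same_lin cr lg; have [u [u' [Lu Lu' Cu Cu' ->]]] := half l Ll.
  exists (tau u' * e0), (tau u * e1); split; [exact: gpredM (tX _ _ _) _|exact: gpredM (tY _ _ _) _|].
  rewrite -(tauM cr)// -!mulgA; congr (_ * _); rewrite !mulgA; congr (_ * _).
  by apply/esym/comm => //; exact: tY.
- have [w Lw Cw] : exists2 w, L w & C w <> w.
    apply: contrapT => no; apply: (refl_neq1 hC); apply: (lattice_ext_bij cr).
    + exact: isom_linear.
    + exact/isom_linear/isom1.
    + by move=> w Lw; apply: contrapT => h; apply: no; exists w.
  have [u [u' [Lu Lu' Cu Cu' wE]]] := half w Lw.
  exists X, (tau u'); split; [exact: XH|exact: tX|rewrite (tau_comm cr)// lX Cu'].
  move=> /mulIg /(tau_inj cr) e; apply: Cw.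
  have {}e := e (latticeN Lu') Lu'.
  have u0 : u' = 0 by apply: vec_eq_opp0.
  by rewrite wE u0 add0r.
- have [w Lw Cw] : exists2 w, L w & axis C w <> 0.
    apply: contrapT => no; apply: (refl_axis_neq0 hC); apply: (lattice_ext cr).
    + exact: (axis_lin iC (isom1 R)).
    + by move=> k u v; rewrite scaler0 addr0.
    + by move=> w Lw; apply: contrapT => h; apply: no; exists w.
  have [u [u' [Lu Lu' Cu Cu' wE]]] := half w Lw.
  exists Y, (tau u); split; [exact: YH|exact: tY|rewrite (tau_comm cr)// lY /= Cu].
  move=> /mulIg /(tau_inj cr) e; apply: Cw.
  have {}e := e (latticeN Lu) Lu.
  have u0 : u = 0 by apply: vec_eq_opp0.
  by rewrite wE u0 addr0 /axis Cu' subrr.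
Qed.

(** Inversion after f multiplies the twist at y by (lin (f y))^-1, exchanging the two values at
    reflections. If neither f nor this composite has all twists 1 there, both are mixed. *)
Lemma wc_refl_cases f y0 : weak_cayley gT f -> refl (lin y0) ->
  ({morph f : x y / x * y >-> x * y} \/ antimorph f) \/
  (product_of_nonabelian gT /\ forall z, rotn (lin z) -> lin z = 1 \/ lin z = neg R).
Proof.
move=> fW h0; have [Phi [PhiL PhiLat Phi_surj PhiT]] := wc_struct cr fW.
pose fi := inversion gT * f.
have fiW : weak_cayley gT fi := weak_cayley_inversion fW.
pose Phi' := neg R * Phi.
have Phi'L : linear_bij Phi'.
  by apply: linear_bijM => //; apply: isom_linear; left; exact: rotn_neg.
have Phi'Lat v : L v -> L (Phi' v) /\ fi (tau v) = tau (Phi' v).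
  move=> Lv; have [LP e] := PhiLat v Lv; split; first exact: latticeN.
  by rewrite /fi /= e (tauV cr).
have Phi'_surj w : L w -> exists2 v, L v & Phi' v = w.
  move=> Lw; have [v Lv e] := Phi_surj _ (latticeN Lw).
  by exists v => //; rewrite /Phi' /= e opprK.
have fiE x A : (exists y, lin y = A) -> (forall v, L v -> f (tau v * x) = tau (A (Phi v)) * f x) ->
    forall v, L v -> fi (tau v * x) = tau (((lin (f x))^-1 * A)%g (Phi' v)) * fi x.
  move=> [y <-] h v Lv; have [LP _] := PhiLat v Lv; have Ly := lattice_lin cr y LP.
  have Lz := lattice_lin cr (f x)^-1 (lattice_lin cr y (latticeN LP)).
  rewrite /fi /= h// invgM (tauV cr)// -(linV cr).
  rewrite (tau_comm cr); last exact: latticeN.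
  by rewrite (isomN _ (isoL y)).
have Phi'T x : exists y, forall v, L v -> fi (tau v * x) = tau (lin y (Phi' v)) * fi x.
  have [y yE] := PhiT x; exists ((f x)^-1 * y); rewrite linM (linV cr).
  by apply: fiE => //; exists y.
have cls y : refl (lin y) ->
    (twist PhiT y = 1 /\ twist Phi'T y = lin (fi y)) \/
    (twist PhiT y = lin (f y) /\ twist Phi'T y = 1).
  move=> hy; have hf : refl (lin (f y)).
    by apply/(f_refl cr fW PhiL PhiLat Phi_surj PhiT).
  have key : twist Phi'T y = (lin (f y))^-1 * twist PhiT y.
    have -> : (lin (f y))^-1 * twist PhiT y = lin ((f y)^-1 * sval (cid (PhiT y))).
      by rewrite linM (linV cr).
    apply: (twist_uniq cr Phi'Lat Phi'_surj) => v Lv; rewrite linM (linV cr).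
    apply: fiE Lv; first by exists (sval (cid (PhiT y))).
    exact: (twistE PhiT).
  have [e|e] := refl_twist cr fW PhiL PhiLat Phi_surj PhiT hf; rewrite ?key e; [left|right].
    by split=> //; rewrite mulg1 /fi /= (linV cr).
  by rewrite mulVg.
have [a1|] := pselect (forall y, refl (lin y) -> twist PhiT y = 1).
  left; left; exact: (refl_untwisted_morph cr fW PhiL PhiLat Phi_surj h0 a1).
move=> /existsNP[y1 /not_implyP[hy1 ty1]].
have {}ty1 : twist PhiT y1 = lin (f y1) /\ twist Phi'T y1 = 1 by case: (cls _ hy1) => -[].
have [a1|] := pselect (forall y, refl (lin y) -> twist Phi'T y = 1).
  left; right => x y; apply: invg_inj; rewrite invgM.
  exact: (refl_untwisted_morph cr fiW Phi'L Phi'Lat Phi'_surj h0 a1).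
move=> /existsNP[x1 /not_implyP[hx1 tx1]].
have {}tx1 : twist PhiT x1 = 1 /\ twist Phi'T x1 = lin (fi x1) by case: (cls _ hx1) => -[].
right; have mr := mixed_rotn cr fW PhiL PhiLat Phi_surj hx1 hy1 tx1.1 ty1.1.
split=> //.
have [ly fy] := mixed_lin cr fW PhiL PhiLat Phi_surj hx1 hy1 tx1.1 ty1.1.
have hC : refl (lin (f x1)) by apply/(f_refl cr fW PhiL PhiLat Phi_surj PhiT).
(* f yields a true reflection X; the composite with inversion, with x1 and y1 exchanged, yields
   Y. *)
have [X lX aX] := mixed_mirror cr fW PhiL PhiLat Phi_surj hx1 hy1 tx1.1 ty1.1.
have [Y lY aY] := mixed_mirror cr fiW Phi'L Phi'Lat Phi'_surj hy1 hx1 ty1.2 tx1.2.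
have fiy : lin (fi y1) = neg R * lin (f x1).
  by rewrite /fi /= (linV cr) -fy reflV//; apply/(f_refl cr fW PhiL PhiLat Phi_surj PhiT).
rewrite fiy in lY aY.
apply: (crystal_product hC lX lY aX aY).
  exact: (mixed_rect cr fW PhiL PhiLat Phi_surj hx1 hy1 tx1.1 ty1.1 lX lY aX aY).
move=> g; have [hg|hg] := isoL g.
  by case: (mr g hg) => e; [exact: Or41|exact: Or42].
have /mr : rotn (lin (g * X)) by rewrite linM lX; exact: reflM.
rewrite linM lX; case=> e; [apply: Or43|apply: Or44].
  by apply: (mulIg (lin (f x1))); rewrite e reflK.
by apply: (mulIg (lin (f x1))); rewrite e -mulgA reflK// mulg1.
Qed.

End Reflections.

(** * Groups of rotations *)

Section Rotations.
Variable R : realType.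
Notation V := 'rV[R]_2.
Notation B := (bijection V).
Implicit Types (A C D : B).
Variables (gT : groupType) (lin : gT -> B) (pt : gT -> V) (tau : V -> gT) (w1 w2 : V).
Hypothesis cr : crystal lin pt tau w1 w2.
Notation L := (lattice w1 w2).
Implicit Types (x y z : gT) (u v w : V).

Let linM := cr_linM cr.
Let ptM := cr_ptM cr.
Let isoL := lin_isom cr.

Lemma half_turn_invol z : lin z = neg R -> z * z = 1.
Proof.
by move=> lz; apply: (cr_inj cr); rewrite ?linM ?ptM lz ?(lin1 cr) ?(pt1 cr) ?negM//= subrr.
Qed.

Lemma basis_neq0 : w1 <> 0.
Proof.
move=> h; have := cr_basis cr; rewrite h !mxE => /eqP; apply; lra.
Qed.

(** * Only translations and half-turns *)

Section HalfTurns.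
Hypothesis small : forall x, lin x = 1 \/ lin x = neg R.

Let half_turn_morph (g : gT -> gT) (Phi : V -> V) :
  (forall v, L v -> L (Phi v) /\ g (tau v) = tau (Phi v)) ->
  (forall v, Phi (- v) = - Phi v) ->
  (forall x v, L v -> g (tau v * x) = tau (Phi v) * g x) ->
  (forall x, lin x = neg R -> lin (g x) = neg R) ->
  (forall x, g x^-1 = (g x)^-1) -> {morph g : x y / x * y >-> x * y}.
Proof.
move=> gL PhiN gT1 gneg gV x y.
have [lx|lx] := small x.
  have Lx := cr_lat cr lx; have [_ e] := gL _ Lx.
  by rewrite (tau_pt cr lx) gT1// e.
have gx := gneg x lx.
have tw w : L w -> g x * tau (Phi w) = tau (- Phi w) * g x.
  by move=> Lw; have [LP _] := gL _ Lw; rewrite (tau_comm cr)// gx.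
have [ly|ly] := small y.
  have Ly := cr_lat cr ly; have [LP e] := gL _ Ly.
  by rewrite (tau_pt cr ly) (tau_comm cr)// lx /= gT1 ?PhiN ?e ?tw//; exact: latticeN.
have [w Lw ->] : exists2 w, L w & y = tau w * x^-1.
  apply: (same_lin cr); rewrite (linV cr) lx ly.
  by apply: (mulgI (neg R)); rewrite mulgV negM.
have LN := latticeN Lw; have [LP e] := gL _ LN.
rewrite mulgA (tau_comm cr)// mulgK lx /= e PhiN gT1// mulgA tw//.
by rewrite gV mulgK.
Qed.

Lemma wc_half_turns f : weak_cayley gT f -> {morph f : x y / x * y >-> x * y} \/ antimorph f.
Proof.
move=> fW; have [Phi [PhiL PhiLat Phi_surj PhiT]] := wc_struct cr fW.
have PhiN v : Phi (- v) = - Phi v by exact: linear_bijN.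
have f1 x : lin (f x) = 1 -> lin x = 1 := @wc_lin1 _ _ _ _ _ _ _ cr _ fW x.
have fneg x : lin x = neg R -> lin (f x) = neg R.
  by move=> lx; case: (small (f x)) => // /f1; rewrite lx => /neg_neq1.
have trans x v : lin x = 1 -> L v -> f (tau v * x) = tau (Phi v) * f x.
  move=> lx Lv; have Lx := cr_lat cr lx; have [LP e] := PhiLat _ Lv; have [LPx ex] := PhiLat _ Lx.
  rewrite (tau_pt cr lx) ex !(tauM cr)//.
  by have [_ ->] := PhiLat _ (latticeD Lv Lx); rewrite linear_bijD.
have [[z lz]|no] := pselect (exists z, lin z = neg R); last first.
  left; apply: (half_turn_morph PhiLat PhiN _ fneg (wcV fW)) => x v Lv; apply: trans => //.
  by case: (small x) => // lx; case: no; exists x.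
have coset eps : (forall v, L v -> f (tau v * z) = tau (eps (Phi v)) * f z) ->
    (forall u v, eps (u + v) = eps u + eps v) -> (forall v, L v -> L (eps v)) ->
    forall x v, lin x = neg R -> L v -> f (tau v * x) = tau (eps (Phi v)) * f x.
  move=> h epsD epsL x v lx Lv; have [|l Ll ->] := same_lin cr (x := x) (y := z); first by rewrite lz.
  have [LP _] := PhiLat _ Lv; have [LPl _] := PhiLat _ Ll.
  have Le := epsL _ LP; have Lel := epsL _ LPl.
  rewrite mulgA (tauM cr)// !h//; last exact: latticeD.
  by rewrite mulgA (tauM cr)// linear_bijD// epsD.
have [y yE] := PhiT z; have [ly|ly] := small y; rewrite ly in yE.
  left; apply: (half_turn_morph PhiLat PhiN _ fneg (wcV fW)) => x v Lv.
  case: (small x) => lx; first exact: trans.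
  exact: (coset id).
(* The twist at half-turns is -1. Inverting moves the translation across the half-turn, so x |-> (f
   x)^-1 has trivial twist with respect to -Phi. *)
right => x0 y0; apply: invg_inj; rewrite invgM; move: x0 y0.
have invol x : lin x = neg R -> x^-1 = x.
  by move=> lx; apply: (mulgI x); rewrite mulgV half_turn_invol.
apply: (@half_turn_morph (fun x => (f x)^-1) (fun v => - Phi v)).
- move=> v Lv; have [LP e] := PhiLat _ Lv; split; first exact: latticeN.
  by rewrite e (tauV cr).
- by move=> v; rewrite PhiN.
- move=> x v Lv; have [LP _] := PhiLat _ Lv; have LN := latticeN LP.
  case: (small x) => lx.
    have fx : lin (f x) = 1 by rewrite (tau_pt cr lx); have [? ->] := PhiLat _ (cr_lat cr lx); rewrite (lin_tau cr).
    have Lfx := cr_lat cr fx; have LNx := latticeN Lfx; have LD := latticeD LP Lfx.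
    have fxE := tau_pt cr fx; move: (pt (f x)) fxE Lfx LNx LD => t fxE Lfx LNx LD.
    by rewrite trans// fxE (tauM cr)// !(tauV cr)// (tauM cr)// opprD.
  have fx := fneg x lx.
  rewrite (coset (neg R) yE _ _ x v lx Lv)//=; first last.
  - by move=> u Lu; exact: latticeN.
  - by move=> u u'; rewrite opprD.
  rewrite invgM (tauV cr)// opprK invol// (tau_comm cr)//.
  by rewrite fx.
- by move=> x lx; rewrite invol fneg.
- by move=> x; rewrite (wcV fW).
Qed.

End HalfTurns.

Hypothesis rot : forall x, rotn (lin x).

Lemma lin_comm x y : lin x * lin y = lin y * lin x.
Proof. exact: rotnC. Qed.

Lemma conj_lin x y : conjugate x y -> lin y = lin x.
Proof. by case=> z ->; rewrite conjgE linM lin_comm -linM mulgK. Qed.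

Definition trace_is A (k : int) := forall v, A v + (A^-1)%g v = k%:~R%R *: v.

Lemma trace_eq x y k : trace_is (lin x) k -> trace_is (lin y) k -> lin y = lin x \/ lin y = (lin x)^-1.
Proof. by move=> hx hy; apply: rotn_trace_inj hx hy. Qed.

Lemma lin_trace_cases x : lin x = 1 \/ lin x = neg R \/
  exists2 k, (k \in [:: 0; 1%R; (-1)%R]) & trace_is (lin x) k.
Proof.
have [k k2 kE] := lin_trace cr (rot x).
have {k2} : (k == 2%:Z) || (k == (-2)%R) || (k \in [:: 0; 1%R; (-1)%R]) by rewrite !inE; lia.
move=> /orP[/orP[|]|k0]; last by right; right; exists k.
  move=> /eqP e; rewrite e in kE; left.
  have h1 v : (1%g : B) v + ((1%g : B)^-1)%g v = 2%:Z%:~R%R *: v by rewrite invg1 /= scaler_int.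
  by case: (rotn_trace_inj (@rotn1 R) (rot x) h1 kE) => ->; rewrite ?invg1.
move=> /eqP e; rewrite e in kE; right; left.
have hn v : (neg R) v + ((neg R)^-1)%g v = (-2)%:~R%R *: v.
  have -> : (neg R)^-1 = neg R by apply: (mulgI (neg R)); rewrite mulgV negM.
  by rewrite scaler_int /= mulrNz -opprD.
by case: (rotn_trace_inj (@rotn_neg R) (rot x) hn kE) => -> //; apply: (mulgI (neg R)); rewrite mulgV negM.
Qed.

Lemma trace0_sq A : isom A -> trace_is A 0 -> A * A = neg R.
Proof.
move=> iA h; apply: bijectionP => v /=; have := h (A v); rewrite bijK => e.
by vsplit e; vlra.
Qed.

Lemma trace1_cube A : isom A -> trace_is A 1 -> A * A * A = neg R.
Proof.
move=> iA h; apply: bijectionP => v /=.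
have := h (A (A v)); rewrite bijK => e1; have := h (A v); rewrite bijK => e2.
by vsplit e1; vsplit e2; vlra.
Qed.

(** Linear parts of order 4 and of order 3 or 6 would have a product of order 12, whose trace k
    satisfies k^2 = 3. *)
Lemma trace0_1_absurd x y (e : int) : trace_is (lin x) 0 -> trace_is (lin y) e ->
  (e = 1 \/ e = -1)%R -> False.
Proof.
move=> h0 he e1; have [k k2 kE] := lin_trace cr (rot (y * x)).
have xx := trace0_sq (isoL x) h0.
have xV v : (lin x)^-1%g v = - lin x v.
  by have := h0 v => e0; vsplit e0; vlra.
(* With X^2 = -1, k = X (Y - Y^-1), hence k^2 = - (Y - Y^-1)^2 = 4 - e^2 = 3. *)
have key v : k%:~R%R *: v = lin x (lin y v) - lin x ((lin y)^-1%g v).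
  by rewrite -kE linM invgM /= xV -[lin y (lin x v)]/((lin y * lin x) v) lin_comm.
pose a := lin y w1; pose b := (lin y)^-1%g w1.
have ya v : (lin y)^-1%g (lin y v) = v by rewrite bijK.
have yb v : lin y ((lin y)^-1%g v) = v by rewrite bijVK.
have XX v : lin x (lin x v) = - v by rewrite -[LHS]/((lin x * lin x) v) xx.
have ab : k%:~R%R *: (a - b) = - (lin x w1 + lin x w1 + lin x w1).
  have ka := key a; have kb := key b; rewrite /a ya in ka; rewrite /b yb in kb.
  have ea := he a; have eb := he b; rewrite /a ya in ea; rewrite /b yb in eb.
  have ew := congr1 (lin x) (he w1).
  have ea' := congr1 (lin x) ea; have eb' := congr1 (lin x) eb.
  rewrite /a /b; rewrite !(isomD _ _ (isoL x)) !(isomZ _ _ (isoL x)) in ew ea' eb'.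
  case: e1 ew ea' eb' => -> ew ea' eb';
    rewrite ?mulrNz ?mulr1z in ew ea' eb'; vsplit ew; vsplit ea'; vsplit eb'; vsplit ka; vsplit kb; vlra.
have k3 : (k%:~R * k%:~R)%R *: w1 = 3%:R%R *: w1 :> V.
  rewrite -scalerA (key w1) -(isomB _ _ (isoL x)) -(isomZ _ _ (isoL x)) ab.
  rewrite (isomN _ (isoL x)) !(isomD _ _ (isoL x)) !XX; vlra.
have : ((k%:~R * k%:~R)%R - 3%:R%R)%R *: w1 = 0 by rewrite scalerBl k3 subrr.
move/eqP; rewrite scaler_eq0 => /orP[|/eqP/basis_neq0//].
rewrite subr_eq0 -intrM -[3%:R%R]/(3%:Z%:~R%R) eqr_int => /eqP k33.
by move: k2 k33; case: k {kE key ab k3} => [[|[|[|?]]]|[|[|?]]]; lia.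
Qed.

Lemma trace0_neg x : trace_is (lin x) 0 -> lin (x * x) = neg R.
Proof. by move=> h; rewrite linM; exact: trace0_sq (isoL x) h. Qed.

Lemma trace1_neg x : trace_is (lin x) 1 -> lin (x * x * x) = neg R.
Proof. by move=> h; rewrite !linM; exact: trace1_cube (isoL x) h. Qed.

Lemma fix_lattice A : isom A -> (forall v, L v -> A v = v) -> A = 1.
Proof. by move=> iA h; apply: (lattice_ext_bij cr); [exact: isom_linear|exact/isom_linear/isom1|exact: h]. Qed.

(** The translations and half-turns; their linear parts commute with every linear isometry. *)
Definition central x := lin x = 1 \/ lin x = neg R.

Let centralM x y : central x -> central y <-> central (x * y).
Proof.
have nn : neg R * neg R = 1 := negM R.
move=> [lx|lx]; rewrite /central linM lx ?mul1g//; split=> -[e|e].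
- by right; rewrite e mulg1.
- by left; rewrite e nn.
- by right; rewrite -[lin y]mul1g -nn -mulgA e mulg1.
- by left; rewrite -[lin y]mul1g -nn -mulgA e nn.
Qed.

Let not_centralM x y : central x -> ~ central y -> ~ central (x * y).
Proof. by move=> cx cy /(centralM y cx). Qed.

Let centralC x y : central (x * y) <-> central (y * x).
Proof. by rewrite /central !linM lin_comm. Qed.

(* An element whose commutators with the translations and half-turns are invisible
   modulo (1 - lin y) L, for every rotation y of order greater than 2. *)
Lemma partial_conjugator r : ~ central r -> exists s,
  (forall x y, central x -> ~ central y ->
     exists2 l, L l & s * x * s^-1 = tau (l - lin y l) * x) /\
  (exists2 x, central x & s * x * s^-1 <> x).
Proof.
move=> r0; have [[z lz]|no] := pselect (exists z, lin z = neg R).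
  have L3 : L (w1 *+ 3)%R := latticeMn 3 (lattice1 w1 w2).
  (* Conjugation by this element moves half-turns by 6 w1. With l = m (w1 - A^-1 w1), where A = lin
     y, one has l - A l = m (2 - k) w1, and 6 is a common multiple of the values 2, 1, 3 of 2 -
     k. *)
  exists (tau (w1 *+ 3)%R); split.
    move=> x y [lx|lx] y0; rewrite (tau_conjV cr)// lx /=.
      by exists 0; [exact: lattice0|rewrite subrr (isom0 (isoL y)) subr0].
    have [e|[e|[k k3 kE]]] := lin_trace_cases y; [by case: y0; left|by case: y0; right|].
    have Ly := lattice_lin cr y^-1 (lattice1 w1 w2); rewrite (linV cr) in Ly.
    have [m m2] : exists m : nat, (m%:R * (2 - k%:~R))%R = 6%:R%R :> R.
      by move: k3; rewrite !inE => /or3P[] /eqP ->; [exists 3%N|exists 6%N|exists 2%N];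
        rewrite ?mulrNz ?mulr0z ?mulr1z; lra.
    exists ((w1 - (lin y)^-1%g w1) *+ m)%R; first by apply: latticeMn; apply: latticeB => //; exact: lattice1.
    congr (tau _ * _).
    have -> : ((w1 - (lin y)^-1%g w1) *+ m)%R = m%:R%R *: (w1 - (lin y)^-1%g w1) by rewrite scaler_nat.
    rewrite (isomZ _ _ (isoL y)) (isomB _ _ (isoL y)) bijVK.
    have e : (lin y) w1 = k%:~R%R *: w1 - (lin y)^-1%g w1 by rewrite -kE addrK.
    rewrite e -scalerBr opprB opprK.
    transitivity ((m%:R * (2 - k%:~R))%R *: w1); last by vlra.
    by rewrite m2 scaler_nat -mulrnDr.
  exists z; first by right.
  rewrite (tau_conjV cr)// lz /= opprK -[RHS]mul1g -(tau0 cr) => /mulIg /(tau_inj cr) e.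
  have {}e := e (latticeD L3 L3) (lattice0 _ _).
  have e3 : (w1 *+ 3 = 3%:R%R *: w1)%R by rewrite scaler_nat.
  by rewrite e3 in e; apply: basis_neq0; vsplit e; vlra.
have c1 x : central x -> lin x = 1 by case=> // lx; case: no; exists x.
have tr x : ~ central x -> trace_is (lin x) (-1)%R.
  move=> nx; have [e|[e|[k]]] := lin_trace_cases x; [by case: nx; left|by case: nx; right|].
  rewrite !inE => /or3P[] /eqP -> // kE; exfalso; apply: no.
    by exists (x * x); exact: trace0_neg.
  by exists (x * x * x); exact: trace1_neg.
(* Without half-turns, the central elements are translations and every other linear part is that of
   r or of r^-1, so r itself serves. *)
exists r; split.
  move=> x y /c1 lx y0; have Lx := cr_lat cr lx; have Lr := lattice_lin cr r Lx.
  rewrite (tau_pt cr lx) (tau_comm cr)// mulgK.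
  case: (trace_eq (tr _ r0) (tr _ y0)) => ->.
    exists (- pt x); first exact: latticeN.
    rewrite (isomN _ (isoL r)) opprK (tauM cr)//; last by rewrite addrC; exact: latticeB.
    by rewrite addrC addrA subrr add0r.
  exists (lin r (pt x)) => //; rewrite bijK (tauM cr)//; last exact: latticeB.
  by rewrite subrK.
exists (tau w1); first by left; rewrite (lin_tau cr)//; exact: lattice1.
have L1 : L w1 := lattice1 w1 w2.
rewrite (tau_comm cr)// mulgK => /(tau_inj cr) e; apply: basis_neq0.
apply: (rotn_fix (rot r)); first by move=> lr; apply: r0; left.
by apply: e => //; exact: (lattice_lin cr).
Qed.

Lemma rot_nontrivial r : ~ central r -> weak_cayley gT <> weak_cayley0 gT.
Proof.
move=> r0; have [s [sP [x0 cx0 sx0]]] := partial_conjugator r0.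
pose F s x := if `[< central x >] then s * x * s^-1 else x.
have Fc s' x : central x -> F s' x = s' * x * s'^-1 by move=> h; rewrite /F asboolT.
have Fn s' x : ~ central x -> F s' x = x by move=> h; rewrite /F asboolF.
have linJ s' x : lin (s' * x * s'^-1) = lin x.
  by rewrite linM lin_comm linM mulgA -linM mulVg (lin1 cr) mul1g.
have FK s' : cancel (F s') (F s'^-1).
  move=> x; have [cx|cx] := pselect (central x); last by rewrite !Fn.
  rewrite Fc ?(Fc _ x)// ?invgK ?mulgA ?mulVg ?mul1g ?mulgVK//.
  by rewrite /central linJ.
have FK' : cancel (F s^-1) (F s) by move=> x; have := FK s^-1 x; rewrite invgK.
pose f : bijection gT := Bijection (@Bijective _ _ (F s) (F s^-1) (FK s) FK').
have fE x : f x = F s x by [].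
(* s x s^-1 y = tau (l - lin (x y) l) x y is the conjugate of x y by tau l. *)
have key x y : central x -> ~ central y -> conjugate (x * y) (s * x * s^-1 * y).
  move=> cx cy; have cxy := not_centralM cx cy.
  have [l Ll ->] := sP x (x * y) cx cxy.
  exists (tau l)^-1; rewrite conjgE invgK mulgA (tau_conjV cr)// mulgA //.
apply: (@nontrivial_weak_cayley_neq _ f).
  move=> x y; rewrite !fE.
  have [cx|cx] := pselect (central x); have [cy|cy] := pselect (central y).
  - rewrite !Fc//; last exact/(centralM y cx).
    suff -> : s * x * s^-1 * (s * y * s^-1) = s * (x * y) * s^-1 by exact: conjugate_refl.
    by rewrite !mulgA mulgVK.
  - rewrite (Fc _ x)// (Fn _ y)// Fn; first exact: key.
    exact: not_centralM.
  - rewrite (Fn _ x)// (Fc _ y)// Fn; last by move=> /centralC; exact: not_centralM.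
    apply: conjugate_trans (conjugate_mulC _ _).
    by apply: conjugate_trans (key _ _ cy cx); exact: conjugate_mulC.
  - rewrite (Fn _ x)// (Fn _ y)//.
    have [cxy|cxy] := pselect (central (x * y)); last by rewrite Fn//; exact: conjugate_refl.
    rewrite Fc//; apply: conjugate_sym; by exists s^-1; rewrite conjgE invgK !mulgA.
move=> /weak_cayley0E[] h.
  have cxr := not_centralM cx0 r0.
  have := h x0 r; rewrite !fE (Fn _ (x0 * r))// (Fn _ r)// Fc// => /mulIg e.
  by apply: sx0.
(* An anti-homomorphism fixing the non-central elements sends tau v both to r tau v r^-1 and to r^-1
   tau v r. *)
have lr2 : lin r * lin r = 1.
  rewrite -linM; apply: fix_lattice; first exact: isoL.
  move=> v Lv; have Lv' := lattice_lin cr r Lv.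
  have ct : central (tau v) by left; rewrite (lin_tau cr).
  have c1 := not_centralM ct r0.
  have c2 : ~ central (r * tau v) by move=> /centralC.
  have e1 := h (tau v) r; rewrite !fE (Fn _ (tau v * r))// (Fn _ r)// in e1.
  have e2 := h r (tau v); rewrite !fE (Fn _ (r * tau v))// (Fn _ r)// in e2.
  have e3 : r * tau v * r^-1 = F s (tau v) by rewrite e2 mulgK.
  rewrite -e3 (tau_comm cr)// mulgK (tau_comm cr)// in e1.
  move: e1 => /mulIg e1; have Lvv := lattice_lin cr r Lv'.
  by rewrite linM /=; apply: (tau_inj cr) => //; exact: esym.
by apply: r0; exact: rotn_sq1 (rot r) lr2.
Qed.

Lemma wc_lin_morph f x y : weak_cayley gT f -> lin (f (x * y)) = lin (f x) * lin (f y).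
Proof. by move=> fW; rewrite -linM (conj_lin (fW x y)). Qed.

Lemma wc_lin_inj f x y : weak_cayley gT f -> lin (f x) = lin (f y) -> lin x = lin y.
Proof.
move=> fW; have [Phi [PhiL PhiLat Phi_surj PhiT]] := wc_struct cr fW.
exact: (f_lin_inj cr Phi_surj PhiT).
Qed.

Lemma wc_lin f x y : weak_cayley gT f -> lin x = lin y -> lin (f x) = lin (f y).
Proof.
move=> fW; have [Phi [PhiL PhiLat Phi_surj PhiT]] := wc_struct cr fW.
exact: (f_lin cr PhiLat PhiT).
Qed.

Lemma wc_lin_eq1 f x : weak_cayley gT f -> lin (f x) = 1 <-> lin x = 1.
Proof.
move=> fW; have f1 := wc1 fW; split=> h.
  by rewrite -(lin1 cr); apply: (wc_lin_inj fW); rewrite f1 (lin1 cr).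
by rewrite -(lin1 cr) -f1; apply: (wc_lin fW); rewrite (lin1 cr).
Qed.

Lemma wc_lin_neg f x : weak_cayley gT f -> lin x = neg R -> lin (f x) = neg R.
Proof.
move=> fW lx; have [|e|//] := rotn_sq1 (rot (f x)).
  by rewrite -wc_lin_morph//; apply/wc_lin_eq1 => //; rewrite linM lx; exact: (negM R).
by move/(wc_lin_eq1 x fW) in e; case: (@neg_neq1 R); rewrite -lx.
Qed.

(* trace 0: a rotation of order 4; trace 1: a rotation of order 6 *)
Definition principal r := trace_is (lin r) 0 \/ trace_is (lin r) 1.

Lemma linX x n : lin (x ^+ n) = lin x ^+ n.
Proof. by elim: n => [|n IH]; [rewrite !expg0 (lin1 cr)|rewrite !expgS linM IH]. Qed.

Lemma trace_negM x k : trace_is (lin x) k -> trace_is (neg R * lin x) (- k)%R.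
Proof.
move=> h v; have -> : (neg R * lin x)^-1 = neg R * (lin x)^-1.
  rewrite invgM (_ : (neg R)^-1 = neg R); last by apply: (mulgI (neg R)); rewrite mulgV negM.
  by rewrite -(linV cr) neg_comm.
by rewrite /= -opprD h mulrNz scaleNr.
Qed.

Lemma principal_neg r : principal r -> exists2 n, (n \in [:: 2; 3]%N) & lin (r ^+ n) = neg R.
Proof.
case=> h; [exists 2%N => //|exists 3%N => //].
  by rewrite expg2 trace0_neg.
by rewrite expgS expg2 mulgA trace1_neg.
Qed.

Lemma principal_order r : principal r -> lin r ^+ 12 = 1.
Proof.
have n2 : neg R ^+ 2 = 1 by rewrite expg2 (negM R).
move=> /principal_neg[n]; rewrite !inE => /orP[] /eqP ->; rewrite linX => e.
  by rewrite (expgnA _ 2 6) e (expgnA _ 2 3) n2 expg1n.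
by rewrite (expgnA _ 3 4) e (expgnA _ 2 2) n2 expg1n.
Qed.

(** Order 4 cannot occur with 3 or 6. Equal traces mean r or r^-1; if r has trace 1, a rotation of
    trace -1 is the negative of one of trace 1, and -1 is a power of lin r. *)
Lemma principal_gen r : principal r -> forall x, exists n, lin x = lin r ^+ n.
Proof.
move=> pr x; have r12 := principal_order pr.
have inv A : A = (lin r)^-1 -> exists n, A = lin r ^+ n.
  by move=> ->; exists 11%N; apply: (mulgI (lin r)); rewrite mulgV -expgS r12.
have pw y : lin y = lin r \/ lin y = (lin r)^-1 -> exists n, lin y = lin r ^+ n.
  by case=> e; [exists 1%N; rewrite expg1|exact: inv].
have [n _ nn] := principal_neg pr; rewrite linX in nn.
have [e|[e|[k kin kE]]] := lin_trace_cases x.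
- by exists 0%N; rewrite expg0.
- by exists n; rewrite nn.
have negx (j : int) : k = (-1)%R -> j = 1%R -> trace_is (lin r) j -> exists m, lin x = lin r ^+ m.
  move=> k1 -> h1; have h := trace_negM kE; rewrite k1 opprK -nn -linX -linM in h.
  have [m mE] := pw _ (trace_eq h1 h).
  exists (n + m)%N; rewrite expgnDr -mE linM linX mulgA nn negM mul1g //.
case: pr => h; move: kin; rewrite !inE => /or3P[] /eqP k0; rewrite k0 in kE *.
- exact: pw (trace_eq h kE).
- by case: (trace0_1_absurd h kE); left.
- by case: (trace0_1_absurd h kE); right.
- by case: (trace0_1_absurd kE h); left.
- exact: pw (trace_eq h kE).
- exact: negx h.
Qed.

Lemma principal_neq1 r : principal r -> lin r <> 1 /\ lin r * lin r <> 1.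
Proof.
have key : principal r -> lin r * lin r <> 1.
  move=> pr r2; have [e|e] := rotn_sq1 (rot r) r2; case: pr => h.
  - by have := trace0_neg h; rewrite linM r2 => /esym/neg_neq1.
  - by have := trace1_neg h; rewrite !linM r2 e mul1g => /esym/neg_neq1.
  - by have := trace0_neg h; rewrite linM r2 => /esym/neg_neq1.
  - have := h w1; rewrite e (_ : (neg R)^-1 = neg R); last by apply: (mulgI (neg R)); rewrite mulgV negM.
    by rewrite mulr1z scale1r /= => e1; case: basis_neq0; vsplit e1; vlra.
by move=> pr; split; [move=> r1; apply: (key pr); rewrite r1 mulg1|exact: key].
Qed.

Lemma principal_f f r : weak_cayley gT f -> principal r ->
  principal (f r) /\ (lin (f r) = lin r \/ lin (f r) = (lin r)^-1).
Proof.
move=> fW pr; suff [k [k1 k2 k3]] : exists k, [/\ k = 0 \/ k = 1%R, trace_is (lin r) k & trace_is (lin (f r)) k].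
  split; last exact: trace_eq k2 k3.
  by case: k1 k3 => ->; [left|right].
have [Phi [PhiL PhiLat Phi_surj PhiT]] := wc_struct cr fW.
case: pr => h.
  exists 0; split; [by left|exact: h|].
  have ff : lin (f r) * lin (f r) = neg R.
    by rewrite -wc_lin_morph// wc_lin_neg// trace0_neg.
  move=> v; rewrite scale0r; have -> : v = lin (f r) (- lin (f r) v).
    by rewrite isomN// -[lin (f r) (lin (f r) v)]/((lin (f r) * lin (f r)) v) ff /= opprK.
  rewrite bijK !isomN// -[lin (f r) (lin (f r) (lin (f r) v))]/((lin (f r) * lin (f r)) (lin (f r) v)) ff /=.
  by rewrite opprK subrr.
exists 1%R; split; [by right|exact: h|].
have fff : lin (f r) * lin (f r) * lin (f r) = neg R.
  by rewrite -!wc_lin_morph// wc_lin_neg// trace1_neg.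
set A := lin (f r) in fff *; have hA : rotn A := rot (f r); have iA : isom A by left.
have An : neg R * A <> 1.
  move=> e; have rn := trace1_neg h; have fn := wc_lin_neg fW rn.
  have AN : A = neg R by apply: (mulgI (neg R)); rewrite e negM.
  have : lin (f r) = lin (f (r * r * r)) by rewrite fn.
  move=> /(wc_lin_inj fW); rewrite !linM -(mulgA (lin r)) => e2.
  have : lin r * lin r = 1.
    by apply: (mulIg (lin r)); rewrite mul1g -mulgA -e2.
  by case: (principal_neq1 (or_intror h)).
move=> v; rewrite mulr1z scale1r.
(* (A + 1)(A^2 - A + 1) = A^3 + 1 = 0, and A + 1 is injective because -A is a rotation other than
   1. *)
have y0 : A (A v) - A v + v = 0.
  apply: (rotn_fix (rotnM (rotn_neg R) hA) An); rewrite /= isomD// isomB//.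
  have -> : A (A (A v)) = - v by rewrite -[LHS]/((A * A * A) v) fff.
  by vlra.
have := congr1 (A^-1)%g y0; rewrite (isomD _ _ (isomV iA)) (isomB _ _ (isomV iA)) !bijK (isom0 (isomV iA)).
by move=> e; vsplit e; vlra.
Qed.

(* Conjugation by the affine map z |-> psi z + b, for a suitable b. *)
Lemma affine_automorphism r s (psi : B) : principal r -> principal s -> linear_bij psi ->
  (forall v, L v -> L (psi v)) -> (forall w, L w -> exists2 v, L v & psi v = w) ->
  psi * lin r = lin s * psi ->
  exists2 al : bijection gT, {morph al : x y / x * y >-> x * y} &
    forall v, L v -> al (tau v * r) = tau (psi v) * s.
Proof.
move=> pr ps psiL psiLat psi_surj psir.
have [s1 _] := principal_neq1 ps.
(* The condition that z |-> psi z + b carry r to s, solvable because lin s - 1 is onto. *)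
have [b bE] : exists b, pt s = psi (pt r) + b - lin s b.
  have [c cE] := rotn_sub_onto (rot s) s1 (psi (pt r) - pt s).
  by exists c; vsplit cE; vlra.
(* y is x conjugated by the affine map. The relation form avoids checking beforehand that conjugates
   stay in the group: totality on both sides follows because r, and likewise s, generates the group
   together with the translations. *)
pose rel x y := psi * lin x = lin y * psi /\ pt y = psi (pt x) + b - lin y b.
have relM x y x' y' : rel x y -> rel x' y' -> rel (x * x') (y * y').
  move=> [e1 e2] [e3 e4]; split; first by rewrite !linM mulgA e1 -mulgA e3 mulgA.
  rewrite !ptM e2 e4 linM (isomB _ _ (isoL y)) (isomD _ _ (isoL y)) (linear_bijD _ _ psiL) /=.
  by rewrite -[lin y (psi (pt x'))]/((lin y * psi) (pt x')) -e1 /=; vlra.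
have rel_tau v : L v -> rel (tau v) (tau (psi v)).
  move=> Lv; have LP := psiLat v Lv; split; rewrite !(lin_tau cr) ?mulg1 ?mul1g//.
  by rewrite !(pt_tau cr)//= addrK.
have rel_r : rel r s by [].
have relX n : rel (r ^+ n) (s ^+ n).
  elim: n => [|n IH]; last by rewrite !expgS; exact: relM.
  by rewrite !expg0 -(tau0 cr) -{2}(linear_bij0 psiL); apply: rel_tau; exact: lattice0.
have ex1 x : exists y, rel x y.
  have [n nE] := principal_gen pr x; rewrite -linX in nE.
  have [l Ll ->] := same_lin cr nE; exists (tau (psi l) * s ^+ n).
  by apply: relM => //; exact: rel_tau.
have ex2 y : exists x, rel x y.
  have [n nE] := principal_gen ps y; rewrite -linX in nE.
  have [l Ll ->] := same_lin cr nE; have [v Lv <-] := psi_surj l Ll.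
  by exists (tau v * r ^+ n); apply: relM => //; exact: rel_tau.
have uni1 x y y' : rel x y -> rel x y' -> y = y'.
  move=> [e1 e2] [e3 e4]; have e : lin y = lin y' by apply: (mulIg psi); rewrite -e1 -e3.
  by apply: (cr_inj cr) => //; rewrite e2 e4 e.
have uni2 x x' y : rel x y -> rel x' y -> x = x'.
  move=> [e1 e2] [e3 e4]; have e : lin x = lin x' by apply: (mulgI psi); rewrite e1 e3.
  apply: (cr_inj cr) => //; apply: (@bij_inj _ psi).
  by rewrite e2 in e4; vsplit e4; vlra.
pose a x := sval (cid (ex1 x)); pose a' y := sval (cid (ex2 y)).
have aP x : rel x (a x) by rewrite /a; case: cid.
have a'P y : rel (a' y) y by rewrite /a'; case: cid.
have aK : cancel a a' by move=> x; apply: uni2 (aP x).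
have a'K : cancel a' a by move=> y; apply: uni1 (a'P y).
exists (Bijection (Bijective aK a'K)) => [x y|v Lv] /=.
  by apply: (uni1 (x * y)) => //; exact: relM.
by apply: (uni1 (tau v * r)) => //; apply: relM => //; exact: rel_tau.
Qed.

(** psi = twist r Phi intertwines lin r with [cj (lin r)], which is lin (f r) or its inverse. The
    first case gives an automorphism, the second an anti-automorphism. *)
Lemma wc_approx f r : weak_cayley gT f -> principal r ->
  exists2 h, weak_cayley0 gT h & forall x, lin x = lin r -> f x = h x.
Proof.
move=> fW pr; have [Phi [PhiL PhiLat Phi_surj PhiT]] := wc_struct cr fW.
have [ps fr] := principal_f fW pr.
have [y yE] := PhiT r; pose psi := lin y * Phi.
have psiL : linear_bij psi by apply: linear_bijM => //; exact: isom_linear.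
have psiLat v : L v -> L (psi v).
  by move=> Lv; have [LP _] := PhiLat v Lv; exact: (lattice_lin cr).
have psi_surj w : L w -> exists2 v, L v & psi v = w.
  move=> Lw; have [v Lv e] := Phi_surj _ (lattice_lin cr y^-1 Lw).
  by exists v => //; rewrite /psi /= e (linV cr) bijVK.
have [z zE] := cj_point cr fW PhiL PhiLat Phi_surj r.
have zr : lin z = lin r \/ lin z = (lin r)^-1.
  have tz k : trace_is (lin r) k -> trace_is (lin z) k.
    move=> h v; have [u ->] : exists u, v = Phi u by exists (Phi^-1 v); rewrite bijVK.
    have -> : (lin z)^-1 = Phi * (lin r)^-1 * Phi^-1.
      by rewrite zE /cj !invgM invgK mulgA.
    by rewrite zE (cjE Phi) /= bijK -(linear_bijD _ _ PhiL) h (linear_bijZ _ _ PhiL).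
  by case: pr => h; apply: trace_eq (h) (tz _ h).
have psir : psi * lin r = lin z * psi.
  by rewrite /psi mulgA -(lin_comm y z) -!mulgA; congr (_ * _); rewrite zE /cj mulgVK.
have {}yE v : L v -> f (tau v * r) = tau (psi v) * f r := yE v.
clearbody psi.
have [e|e] : lin z = lin (f r) \/ lin z = (lin (f r))^-1.
  by case: zr => ->; case: fr => ->; rewrite ?invgK; [left|right|right|left].
  rewrite e in psir; have [al alM alE] := affine_automorphism pr ps psiL psiLat psi_surj psir.
  exists al; first by apply/weak_cayley0E; left.
  by move=> x /(same_lin cr)[l Ll ->]; rewrite alE// yE.
(* Read off from (tau (psi v) f r)^-1 = tau (- (lin (f r))^-1 (psi v)) (f r)^-1. *)
pose psi' := neg R * (lin (f r))^-1 * psi.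
have iN : isom (neg R) by left; exact: rotn_neg.
have psi'E v : psi' v = - lin (f r)^-1 (psi v) by rewrite (linV cr).
have psi'L : linear_bij psi'.
  by apply: linear_bijM => //; apply: isom_linear; apply: isomM => //; rewrite -(linV cr).
have psi'Lat v : L v -> L (psi' v).
  by move=> Lv; rewrite psi'E; apply: latticeN; apply: (lattice_lin cr); exact: psiLat.
have psi'_surj w : L w -> exists2 v, L v & psi' v = w.
  move=> Lw; have [v Lv vE] := psi_surj _ (latticeN (lattice_lin cr (f r) Lw)).
  by exists v => //; rewrite psi'E vE (isomN _ (isoL _)) opprK (linV cr) bijK.
have pfV : principal (f r)^-1.
  by case: ps => h; [left|right] => v; rewrite (linV cr) invgK addrC h.
have psi'r : psi' * lin r = lin (f r)^-1 * psi'.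
  by rewrite /psi' -mulgA psir e (linV cr) !mulgA (neg_comm (isomV (isoL (f r)))).
have [al alM alE] := affine_automorphism pr pfV psi'L psi'Lat psi'_surj psi'r.
exists (inversion gT * al).
  by apply/weak_cayley0E; right=> x0 y0 /=; rewrite alM invgM.
move=> x /(same_lin cr)[l Ll ->]; rewrite yE//= alE//.
have LP := psi'Lat l Ll; have Lp := psiLat l Ll.
rewrite invgM invgK (tauV cr)// psi'E opprK (tau_comm cr); last exact: (lattice_lin cr).
by rewrite (linV cr) bijVK.
Qed.

(** F moves each coset of the translations by a constant vector, so p q and x y are moved by the
    same a, and F^-1 (x y) = tau (- a) x y. The weak Cayley property at tau (- a) p and q is the
    required conjugacy, read backwards. *)
Lemma shift_inverse F : weak_cayley gT F -> (forall x v, L v -> F (tau v * x) = tau v * F x) ->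
  (forall x, lin (F x) = lin x) -> weak_cayley gT F^-1.
Proof.
move=> FW FT Fl x y; set p := F^-1 x; set q := F^-1 y.
have Fp : F p = x by rewrite /p bijVK.
have Fq : F q = y by rewrite /q bijVK.
have [a La aE] := same_lin cr (Fl (p * q)).
have LN := latticeN La.
have lpq : lin (x * y) = lin (p * q) by rewrite !linM -Fp -Fq !Fl.
have [l Ll lE] := same_lin cr lpq.
have Fxy : F (x * y) = tau a * (x * y).
  rewrite lE FT// aE !mulgA !(tauM cr)//; congr (tau _ * _ * _); exact: addrC.
have Finv : F^-1 (x * y) = tau (- a) * (x * y).
  apply: (@bij_inj _ F); rewrite bijVK FT// Fxy mulgA (tauM cr)// addNr (tau0 cr) mul1g //.
have := FW (tau (- a) * p) q.
rewrite -mulgA !FT// aE mulgA (tauM cr)// addNr (tau0 cr) mul1g Fp Fq -mulgA -Finv.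
exact: conjugate_sym.
Qed.

Lemma iter_coset (f : bijection gT) x (A : B) n : (forall x', lin x' = lin x -> forall v, L v -> f (tau v * x') = tau (A v) * f x') ->
  (forall x', lin (f x') = lin x') -> (forall v, L v -> L (A v)) ->
  lin ((f ^+ n) x) = lin x /\ forall v, L v -> (f ^+ n) (tau v * x) = tau ((A ^+ n)%g v) * (f ^+ n)%g x.
Proof.
move=> fT fl AL.
have AX k v : L v -> L ((A ^+ k)%g v).
  by move=> Lv; elim: k => [|k IH]; [rewrite expg0|rewrite expgS; exact: AL].
elim: n => [|n [IH1 IH2]]; first by rewrite !expg0.
split=> [|v Lv]; rewrite !expgS /=; first by rewrite fl.
by rewrite IH2// fT//; exact: AX.
Qed.

Definition fixing r : {pred bijection gT} :=
  fun f => `[< weak_cayley gT f /\ forall x, lin x = lin r -> f x = x >].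

Lemma fixingP r f : reflect (weak_cayley gT f /\ forall x, lin x = lin r -> f x = x) (f \in fixing r).
Proof. exact: asboolP. Qed.

(* The 12th power of such a map translates every coset of the translation subgroup. *)
Lemma fixing_inv r f : principal r -> f \in fixing r -> weak_cayley gT f^-1.
Proof.
move=> pr /fixingP[fW ff]; have [Phi [PhiL PhiLat Phi_surj PhiT]] := wc_struct cr fW.
have fl x : lin (f x) = lin x.
  have [n nE] := principal_gen pr x; rewrite nE; rewrite -linX in nE; rewrite (wc_lin fW nE).
  elim: n {nE} => [|n IH]; first by rewrite !expg0 (wc1 fW) (lin1 cr).
  by rewrite !expgS wc_lin_morph// IH ff.
have [y yE] := PhiT r.
(* f fixes tau v r, so the twist at r undoes Phi, and Phi belongs to the point group. *)
have PhiE : Phi = lin y^-1.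
  apply: (lattice_ext_bij cr) => //; first exact: isom_linear.
  move=> v Lv; have [LP _] := PhiLat v Lv; have := yE v Lv.
  rewrite (ff r erefl) ff ?(lin_tauM cr)// => /mulIg /(tau_inj cr) e.
  rewrite {2}e ?(linV cr) ?bijK//; exact: (lattice_lin cr).
have fT x : exists z, forall x', lin x' = lin x -> forall v, L v -> f (tau v * x') = tau (lin z v) * f x'.
  have [z zE] := PhiT x; exists (z * y^-1) => x' /(same_lin cr)[l Ll ->] v Lv.
  have [LPl _] := PhiLat l Ll; have [LPv _] := PhiLat v Lv.
  have Lzl := lattice_lin cr z LPl; have Lzv := lattice_lin cr z LPv.
  rewrite mulgA (tauM cr)// !zE//; last exact: latticeD.
  by rewrite linM -PhiE /= mulgA (tauM cr)// linear_bijD// isomD.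
have FT x : lin ((f ^+ 12) x) = lin x /\ forall v, L v -> (f ^+ 12) (tau v * x) = tau v * (f ^+ 12) x.
  have [z zE] := fT x; have [n nE] := principal_gen pr z.
  have zz : lin z ^+ 12 = 1 by rewrite nE expgnAC principal_order// expg1n.
  have [|l1 h] := @iter_coset f x (lin z) 12 zE fl; first by move=> v; exact: (lattice_lin cr).
  by split=> // v Lv; rewrite h// zz.
have fX n : weak_cayley gT (f ^+ n).
  elim: n => [|n IH]; last by rewrite expgS; exact: weak_cayley_comp.
  by rewrite expg0 => a b; exact: conjugate_refl.
have := @shift_inverse (f ^+ 12) (fX 12%N) (fun x => (FT x).2) (fun x => (FT x).1).
(* [shift_inverse] applies to f^12, and this writes f^-1 as a composite of weak Cayley maps. *)
have -> : f^-1 = f ^+ 11 * (f ^+ 12)^-1.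
  by apply: (mulgI f); rewrite mulgV mulgA -expgS mulgV.
exact: weak_cayley_comp.
Qed.

Lemma fixing_closed r : principal r -> group_closed (fixing r).
Proof.
move=> pr; split.
  by apply/fixingP; split=> // x y; exact: conjugate_refl.
move=> f g fN gN; have gV := fixing_inv pr gN.
move: fN gN => /fixingP[fW ff] /fixingP[gW gf]; apply/fixingP; split.
  exact: weak_cayley_comp.
by move=> x lx /=; rewrite -{1}(gf x lx) bijK ff.
Qed.

Lemma weak_cayley0V h : weak_cayley0 gT h -> weak_cayley0 gT h^-1.
Proof.
move=> /weak_cayley0E hE; apply/weak_cayley0E; apply/auto_antiP.
by apply: (group_closedV (auto_anti_closed gT)); apply/auto_antiP.
Qed.

(** A homomorphism fixing L r pointwise fixes L and r, hence all products of translations and powers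
    of r. An anti-homomorphism would force lin r to have square 1. *)
Lemma fixing_weak_cayley0 r f : principal r -> f \in fixing r -> weak_cayley0 gT f -> f = 1.
Proof.
move=> pr /fixingP[fW ff] /weak_cayley0E[] h; apply: bijectionP => x /=.
  have [n nE] := principal_gen pr x; rewrite -linX in nE; have [l Ll ->] := same_lin cr nE.
  have ft : f (tau l) = tau l.
    by apply: (mulIg (f r)); rewrite -h (ff r erefl) ff// (lin_tauM cr).
  rewrite h ft; congr (_ * _); elim: n {nE} => [|n IH]; first by rewrite !expg0 (wc1 fW).
  by rewrite !expgS h IH ff.
exfalso; have [_ r2] := principal_neq1 pr; apply: r2.
rewrite -linM; apply: fix_lattice; first exact: isoL.
move=> v Lv; have Lr := lattice_lin cr r Lv; have Lrr := lattice_lin cr r Lr.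
have e1 : tau v * r = r * f (tau v).
  by rewrite -{2}(ff r erefl) -h ff// (lin_tauM cr).
have e2 : r * tau v = f (tau v) * r.
  by rewrite -{2}(ff r erefl) -h ff// linM (lin_tau cr)// mulg1.
have e3 : f (tau v) = tau (lin r v) by rewrite (tau_comm cr)// in e2; move: e2 => /mulIg.
rewrite e3 (tau_comm cr)// in e1; move: e1 => /mulIg e1.
by rewrite linM /=; apply: (tau_inj cr).
Qed.

Lemma rot_semidirect r : principal r -> exists N : groupClosed (bijection gT),
  (forall f, f \in N -> f <> 1 -> weak_cayley gT f /\ ~ weak_cayley0 gT f) /\
  semidirect (weak_cayley gT) N (weak_cayley0 gT).
Proof.
move=> pr; pose N : groupClosed (bijection gT) := closed_pred (fixing_closed pr).
have NE f : f \in N = (f \in fixing r) by [].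
have WN f h : weak_cayley gT f -> weak_cayley0 gT h ->
    (forall x, lin x = lin r -> f x = h x) -> f * h^-1 \in N.
  move=> fW h0 fh; have hW := weak_cayley0_sub h0.
  rewrite NE; apply/fixingP; split.
    by apply: weak_cayley_comp => //; apply: weak_cayley0_sub; exact: weak_cayley0V.
  move=> x lx /=; set y := h^-1 x; have hy : h y = x by rewrite /y bijVK.
  suff -> : f y = h y by [].
  (* h^-1 may send the coset of r to that of r^-1, where f and h agree because both respect
     inverses. *)
  have [ly|ly] : lin y = lin r \/ lin y = lin r^-1.
    have [_ [hr|hr]] := principal_f hW pr; [left|right]; apply: (wc_lin_inj hW); rewrite hy lx.
      by rewrite hr.
    by rewrite (wcV hW) (linV cr) hr invgK.
  exact: fh.
  have e : lin y^-1 = lin r by rewrite (linV cr) ly (linV cr) invgK.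
  by apply: invg_inj; rewrite -(wcV fW) -(wcV hW); exact: fh.
have dec f : weak_cayley gT f -> exists n h, [/\ n \in N, weak_cayley0 gT h & f = n * h].
  move=> fW; have [h h0 fh] := wc_approx fW pr.
  by exists (f * h^-1), h; split=> //; [exact: WN|rewrite mulgVK].
have WV f : weak_cayley gT f -> weak_cayley gT f^-1.
  move=> /dec[n [h [nN h0 ->]]]; rewrite invgM; apply: weak_cayley_comp.
    by apply: weak_cayley0_sub; exact: weak_cayley0V.
  exact: fixing_inv nN.
have NW f : f \in N -> weak_cayley gT f by rewrite NE => /fixingP[].
exists N; split=> [f fN f1|].
  by split; [exact: NW|move=> f0; apply: f1; exact: fixing_weak_cayley0 fN f0].
split.
- split=> [f /NW//|n w nN wW].
  rewrite NE; apply/fixingP; split.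
    rewrite conjgE; apply: weak_cayley_comp; first exact: WV.
    by apply: weak_cayley_comp => //; exact: NW.
  move=> x lx; rewrite conjgE /=; apply: (@bij_inj _ w); rewrite bijVK.
  move: nN; rewrite NE => /fixingP[nW nf].
  have [_ [wr|wr]] := principal_f wW pr; first by apply: nf; rewrite (wc_lin wW lx).
  apply: invg_inj; rewrite -(wcV nW); apply: nf.
  by rewrite (linV cr) (wc_lin wW lx) wr invgK.
- exact: weak_cayley0_sub.
- apply/seteqP; split=> [f [/= fN f0]|f /= ->]; first exact: fixing_weak_cayley0 fN f0.
  split; first exact: gpred1.
  by apply/weak_cayley0E; left.
- apply/seteqP; split=> [f /dec[n [h [nN h0 ->]]]|_ [n /= nN [h h0 <-]]].
    by exists n => //; exists h.
  by apply: weak_cayley_comp; [exact: NW|exact: weak_cayley0_sub].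
Qed.

(** x^n is a translation commuting with x, so its vector is fixed by lin x and vanishes. *)
Lemma rotn_lin_pow1 x n : lin x <> 1 -> lin (x ^+ n) = 1 -> x ^+ n = 1.
Proof.
move=> x1 xn; have Lx := cr_lat cr xn; rewrite (tau_pt cr xn).
have comm : x * x ^+ n = x ^+ n * x by rewrite -expgS expgSr.
have Lx' := lattice_lin cr x Lx.
rewrite {1 2}(tau_pt cr xn) (tau_comm cr)// in comm.
move: comm => /mulIg /(tau_inj cr) e.
by rewrite (rotn_fix (rot x) x1 (e Lx' Lx)) (tau0 cr).
Qed.

Lemma trace_neg1_cube x : trace_is (lin x) (-1)%R -> lin (x ^+ 3) = 1.
Proof.
move=> h; apply: fix_lattice; first exact: isoL.
move=> v _; rewrite linX expgS expg2 /=.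
have := h (lin x (lin x v)); rewrite bijK => e1; have := h (lin x v); rewrite bijK => e2.
by rewrite !mulrNz !mulr1z in e1 e2; vsplit e1; vsplit e2; vlra.
Qed.

Lemma noncentral_pow12 x : ~ central x -> lin (x ^+ 12) = 1.
Proof.
move=> cx; have [e|[e|[k]]] := lin_trace_cases x; [by case: cx; left|by case: cx; right|].
rewrite !inE => /or3P[] /eqP -> h.
- by rewrite linX principal_order//; left.
- by rewrite linX principal_order//; right.
- by rewrite linX (expgnA _ 3 4) -linX trace_neg1_cube// expg1n.
Qed.

Lemma noncentral_order x : ~ central x -> exists n, has_order x n /\ (2 < n)%N.
Proof.
move=> cx; have x1 : lin x <> 1 by move=> e; apply: cx; left.
pose P n := (0 < n)%N && (x ^+ n == 1).
have exP : exists n, P n.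
  by exists 12%N; apply/eqP; apply: rotn_lin_pow1 => //; exact: noncentral_pow12.
case: (ex_minnP exP) => n /andP[n0 /eqP xn] min; exists n; split.
  split=> // m /andP[m0 mn]; apply/eqP => xm.
  by have := min m; rewrite /P m0 xm eqxx leqNgt mn => /(_ isT).
rewrite ltnNge; apply/negP => n2; case: n n0 xn {min} n2 => [|[|[|//]]] // _ xn _; apply: cx.
  by left; rewrite -[x]expg1 xn (lin1 cr).
by apply: rotn_sq1 (rot x) _; rewrite -linM -expg2 xn (lin1 cr).
Qed.

Lemma order_principal x n : ~ central x -> has_order x n -> (4 <= n)%N -> principal x.
Proof.
move=> cx [_ _ xn] n4; have [e|[e|[k]]] := lin_trace_cases x; [by case: cx; left|by case: cx; right|].
rewrite !inE => /or3P[] /eqP -> h; [by left|by right|exfalso].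
have x1 : lin x <> 1 by move=> e; apply: cx; left.
have := xn 3%N; rewrite n4 (rotn_lin_pow1 x1 (trace_neg1_cube h)) eqxx => /(_ isT) //.
Qed.

End Rotations.

(** * Wallpaper groups *)

Section Geometry.
Variable R : realType.
Notation V := 'rV[R]_2.
Notation B := (bijection V).
Implicit Types (x y z v w : V) (g : B).

Lemma transl_subproof v : bijective (fun x : V => x + v).
Proof. by exists (fun x : V => x - v) => x; rewrite ?addrK ?subrK. Qed.
Definition transl v : B := Bijection (transl_subproof v).

Definition linear_part (g : B) : B := (transl (g 0))^-1 * g.

Lemma linear_partE g x : linear_part g x = g x - g 0.
Proof. by apply: (@bij_inj _ (transl (g 0))); rewrite bijVK /= subrK. Qed.

Lemma affineE g x : g x = linear_part g x + g 0.
Proof. by rewrite linear_partE subrK. Qed.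

Lemma isometry_sqnorm (g : B) x y : is_isometry g -> sqnorm (g x - g y) = sqnorm (x - y).
Proof.
move=> /(_ x y); rewrite /euclid_dist => h.
have sE (u v : V) : (\sum_(i < 2) (u 0 i - v 0 i) ^+ 2)%R = sqnorm (u - v) :> R.
  rewrite !big_ord_recl big_ord0 /sqnorm !mxE addr0 !expr2.
  by rewrite (_ : lift ord0 ord0 = 1%R :> 'I_2)//; apply: val_inj.
rewrite !sE in h; have s0 (u : V) : (0 <= sqnorm u)%R.
  by rewrite /sqnorm -!expr2 addr_ge0// sqr_ge0.
by rewrite -[LHS]sqr_sqrtr// h sqr_sqrtr.
Qed.

(** The second vector of an orthonormal pair is the first turned by a right angle, up to the sign c
    q - s p. *)
Lemma orthonormal_frame (c s p q : R) : (c ^+ 2 + s ^+ 2 = 1)%R -> (p ^+ 2 + q ^+ 2 = 1)%R ->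
  (c * p + s * q = 0)%R ->
  [/\ (c * q - s * p) ^+ 2 = 1, p = - s * (c * q - s * p) & q = c * (c * q - s * p)]%R.
Proof.
move=> cs pq o; split.
- transitivity ((c ^+ 2 + s ^+ 2) * (p ^+ 2 + q ^+ 2) - (c * p + s * q) ^+ 2)%R; first by lra.
  by rewrite cs o pq; lra.
- transitivity ((c ^+ 2 + s ^+ 2) * p - c * (c * p + s * q))%R; last by lra.
  by rewrite cs o; lra.
- transitivity ((c ^+ 2 + s ^+ 2) * q - s * (c * p + s * q))%R; last by lra.
  by rewrite cs o; lra.
Qed.

Lemma isometry_isom (g : B) : is_isometry g -> isom (linear_part g).
Proof.
move=> hg; set A := linear_part g.
have A0 : A 0 = 0 by rewrite /A linear_partE subrr.
have dist u v : sqnorm (A u - A v) = sqnorm (u - v).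
  by rewrite -(isometry_sqnorm u v hg) /A !linear_partE; congr sqnorm; vlra.
have nrm u : sqnorm (A u) = sqnorm u by have := dist u 0; rewrite A0 !subr0.
pose e0 : V := \row_j (if j == 0 then 1 else 0)%R; pose e1 : V := \row_j (if j == 0 then 0 else 1)%R.
have n0 := nrm e0; have n1 := nrm e1; have n01 := dist e0 e1.
rewrite /sqnorm !mxE /= in n0 n1 n01.
have [c cE] : exists c : R, A e0 0%R 0%R = c by exists (A e0 0%R 0%R).
have [s sE] : exists s : R, A e0 0%R 1%R = s by exists (A e0 0%R 1%R).
have [p pE'] : exists p : R, A e1 0%R 0%R = p by exists (A e1 0%R 0%R).
have [q qE'] : exists q : R, A e1 0%R 1%R = q by exists (A e1 0%R 1%R).
rewrite cE sE in n0; rewrite pE' qE' in n1; rewrite cE sE pE' qE' in n01.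
have cs : (c ^+ 2 + s ^+ 2 = 1)%R by lra.
have o : (c * p + s * q = 0)%R by lra.
have pq : (p ^+ 2 + q ^+ 2 = 1)%R by lra.
have [k2 pE qE] := orthonormal_frame cs pq o.
(* Distances to the images of 0, e0 and e1 determine the inner products with the latter two. *)
have co z : (c * A z 0 0 + s * A z 0 1 = z 0 0)%R /\ (p * A z 0 0 + q * A z 0 1 = z 0 1)%R.
  have d0 := dist z e0; have d1 := dist z e1; have dz := nrm z.
  rewrite /sqnorm !mxE /= cE sE in d0; rewrite /sqnorm !mxE /= pE' qE' in d1.
  by rewrite /sqnorm in dz; split; lra.
have /orP[/eqP k|/eqP k] : (c * q - s * p == 1)%R || (c * q - s * p == -1)%R by rewrite -sqrf_eq1 k2.
- have p' : p = (- s)%R by rewrite pE k mulr1.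
  have q' : q = c by rewrite qE k mulr1.
  left; exists c, s; split=> // z; have [z0 z1] := co z; rewrite p' q' in z1.
  by split; rewrite -z0 -z1 -[LHS]mul1r -[in LHS]cs; lra.
- have p' : p = s by rewrite pE k mulrNN mulr1.
  have q' : q = (- c)%R by rewrite qE k mulrN1.
  right; exists c, s; split=> // z; have [z0 z1] := co z; rewrite p' q' in z1.
  by split; rewrite -z0 -z1 -[LHS]mul1r -[in LHS]cs; lra.
Qed.

Lemma unit_angle (c s : R) : (c ^+ 2 + s ^+ 2 = 1)%R -> exists t, cos t = c /\ sin t = s.
Proof.
move=> cs; have c2 : (c ^+ 2 <= 1)%R by have := sqr_ge0 s; lra.
have c1 : (-1 <= c <= 1)%R by apply/andP; split; nra.
have s2 : (1 - c ^+ 2 = s ^+ 2)%R by lra.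
have cK : cos (acos c) = c by apply: acosK; rewrite in_itv.
have [s0|s0] := leP 0%R s.
  by exists (acos c); rewrite cK sin_acos// s2 sqrtr_sqr ger0_norm.
by exists (- acos c)%R; rewrite cosN sinN cK sin_acos// s2 sqrtr_sqr ltr0_norm// opprK.
Qed.

Lemma rotate_rotn (g : B) c t : (forall x, g x = c + rotate t (x - c)) ->
  rotn (linear_part g) /\ g c = c.
Proof.
move=> h; split; last by rewrite h subrr; vlra.
exists (cos t), (sin t); split; first exact: cos2Dsin2.
by move=> z; rewrite linear_partE !h !mxE /=; split; lra.
Qed.

Lemma rotn_rotation (g : B) c : rotn (linear_part g) -> g c = c -> is_rotation g.
Proof.
move=> hA gc; have := hA => -[a [b [ab hE]]]; have [t [ca sb]] := unit_angle ab.
have iA : isom (linear_part g) by left.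
exists c, t => x; transitivity (linear_part g (x - c) + c).
  by rewrite (isomB _ _ iA) !linear_partE gc; vlra.
by apply: vec2P; rewrite !mxE /= ?(hE _).1 ?(hE _).2 !mxE ca sb; lra.
Qed.

(** Pigeonhole on fractional parts of multiples of a. It excludes linearly dependent generators of
    the translations, which would produce arbitrarily short ones. *)
Lemma dirichlet (a : R) (d : R) : (0 < d)%R ->
  exists m n : int, (m, n) != (0, 0) /\ (`|m%:~R + n%:~R * a| < d)%R.
Proof.
move=> d0; have [N Nd] : exists N : nat, (d^-1 < N.+1%:R)%R.
  exists `|Num.floor d^-1|%N; apply: lt_le_trans (lt_succ_floor _) _ => //.
  rewrite -natr1 intrD lerD2r natr_absz ler_int; exact: ler_norm.
pose fr (k : nat) : R := (k%:R * a - (Num.floor (k%:R * a))%:~R)%R.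
have fr0 k : (0 <= fr k < 1)%R.
  rewrite /fr subr_ge0 floor_le_tmp /= ltrBlDr addrC.
  by have := lt_succ_floor (k%:R * a)%R; rewrite intrD.
pose bx (k : nat) := Num.floor (fr k * N.+1%:R)%R.
have bx0 k : (0 <= bx k < N.+1%:Z)%R.
  have /andP[h0 h1] := fr0 k; rewrite /bx floor_ge0 mulr_ge0//=.
  by rewrite floor_lt_int -[X in (_ < X)%R]mul1r ltr_pM2r.
(* N + 2 multiples of a fall into N + 1 boxes of width 1 / (N + 1). *)
pose F (k : 'I_N.+2) : 'I_N.+1 := inord `|bx k|%N.
have [k1 [k2 [k12 Fk]]] : exists k1 k2, k1 != k2 /\ F k1 = F k2.
  apply: contrapT => no; have /leq_card : injective F.
    by move=> k1 k2 e; apply: contrapT => /eqP ne; apply: no; exists k1, k2.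
  by rewrite !card_ord ltnn.
have bk : bx k1 = bx k2.
  have nat_bx k : (`|bx k| < N.+1)%N.
    by have /andP[] := bx0 k; lia.
  have := congr1 val Fk; rewrite /= !inordK// => e.
  by have /andP[] := bx0 k1; have /andP[] := bx0 k2; lia.
exists (Num.floor (k2%:R * a) - Num.floor (k1%:R * a))%R, ((k1 : nat)%:Z - (k2 : nat)%:Z)%R; split.
  apply/eqP => -[_ /eqP]; rewrite subr_eq0 => /eqP [] /val_inj e.
  by rewrite e eqxx in k12.
have -> : ((Num.floor (k2%:R * a) - Num.floor (k1%:R * a))%:~R +
   ((k1 : nat)%:Z - (k2 : nat)%:Z)%:~R * a = fr k1 - fr k2)%R.
  by rewrite /fr !intrB; lra.
have N0 : (0 < N.+1%:R :> R)%R by rewrite ltr0n.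
have bd k : ((bx k)%:~R <= fr k * N.+1%:R < (bx k)%:~R + 1)%R.
  by rewrite floor_le_tmp /= -(intrD _ _ 1) lt_succ_floor.
have : (`|fr k1 - fr k2| * N.+1%:R < 1)%R.
  rewrite -[X in (_ * X < _)%R](ger0_norm (ltW N0)) -normrM ltr_norml.
  have := bd k1; have := bd k2; rewrite bk => /andP[? ?] /andP[? ?].
  by apply/andP; split; lra.
rewrite -ltr_pdivlMr// mul1r => h; apply: (lt_trans h).
by rewrite -[ltRHS]invrK ltf_pV2// posrE invr_gt0.
Qed.

(** By currying, a |-> transl (a w) is continuous for the compact-open topology, and the identity is
    isolated. *)
Lemma discrete_short (G : groupClosed B) (w : V) : discrete_group G -> w != 0 ->
  exists2 d : R, (0 < d)%R & forall a : R, (`|a| < d)%R -> transl (a *: w) \in G -> a = 0%R.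
Proof.
move=> dG w0; pose f (p : R^o * V) : V := p.2 + p.1 *: w.
have fc : continuous f.
  move=> p; apply: cvgD; first exact: cvg_snd.
  apply: cvgZl; exact: cvg_fst.
have cc := continuous_curry_fun fc.
have id_in : [set bij_fun g | g in [set` G]] (id : V -> V) by exists 1; [exact: gpred1|].
have [_ [U nU UE]] := dG _ id_in.
have c0 : curry f (0 : R^o) = (id : V -> V) by apply/funext => x; rewrite /curry /f /= scale0r addr0.
have := cc (0 : R^o); rewrite /continuous_at c0 => /(_ U nU) /=.
move=> /nbhs_ballP[d /= d0 dU]; exists d => // a ad aG.
have : U (curry f a) by apply: dU; rewrite -ball_normE /= sub0r normrN.
have cE : curry f a = transl (a *: w) by apply/funext => x.
move=> Ua; have : (U `&` [set bij_fun g | g in [set` G]]) (transl (a *: w)).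
  by split; [rewrite -cE|exists (transl (a *: w))].
rewrite UE => /= /(congr1 (fun g : V -> V => g 0)) /=.
by rewrite add0r => /eqP; rewrite scaler_eq0 (negbTE w0) orbF => /eqP.
Qed.

End Geometry.

(** * A wallpaper group as an abstract crystallographic group *)

Section Wallpaper.
Variable R : realType.
Notation V := 'rV[R]_2.
Notation B := (bijection V).
Variable G : groupClosed B.
Hypothesis hG : wallpaper_group G.
Notation gT := (elts G).
Implicit Types (v w : V) (x y : gT).

Definition wp_lin x : B := linear_part (val x).
Definition wp_pt x : V := (val x) 0.
(** The default 1 is taken only when the translation by v is not in G. *)
Definition wp_tau v : gT := insubd 1 (transl v).

Lemma wp_isom x : isom (wp_lin x).
Proof. by have [iso _ _] := hG; apply/isometry_isom/iso; exact: (valP x). Qed.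

Lemma wpE x v : val x v = wp_lin x v + wp_pt x.
Proof. exact: affineE. Qed.

Lemma wp_linM x y : wp_lin (x * y) = wp_lin x * wp_lin y.
Proof.
apply: bijectionP => v; rewrite -[RHS]/(wp_lin x (wp_lin y v)).
have vM u : val (x * y) u = val x (val y u) by rewrite valM.
rewrite {1}/wp_lin linear_partE !vM !(wpE x) !(wpE y).
by rewrite !(isomD _ _ (wp_isom x)) (isom0 (wp_isom y)) (isom0 (wp_isom x)); vlra.
Qed.

Lemma transl_linear_part (g : B) : linear_part g = 1 <-> g = transl (g 0).
Proof.
rewrite /linear_part; split=> [h|{2}->]; last by rewrite mulVg.
by rewrite -[RHS]mulg1 -h mulVKg.
Qed.

Lemma translation_linear_part (g : B) : is_translation g <-> linear_part g = 1.
Proof.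
split=> [[v h]|/transl_linear_part h]; last by exists (g 0) => x; rewrite {1}h.
by apply: bijectionP => x; rewrite linear_partE !h /= add0r addrK.
Qed.

Lemma int_additive (h : int -> V) : (forall m n, h (m + n)%R = h m + h n) ->
  forall m, h m = (h 1%R *~ m)%R.
Proof.
move=> hD; have h0 : h 0 = 0 by apply: (addIr (h 0)); rewrite -hD !add0r.
have hn (n : nat) : h n%:Z = (h 1%R *~ n%:Z)%R.
  by elim: n => [|n IH]; [rewrite h0 mulr0z|rewrite intS hD IH mulrzDr mulr1z].
case=> n; first exact: hn.
rewrite NegzE mulrNz; apply/eqP; rewrite -addr_eq0 -hn -hD addNr h0 //.
Qed.

Lemma wp_lattice : exists w1 w2,
  (w1 0 0 * w2 0 1 - w1 0 1 * w2 0 0 != 0)%R /\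
  forall v, lattice w1 w2 v <-> transl v \in G.
Proof.
have [_ dG [phi [phiI phiM phiR]]] := hG.
pose e u := phi u 0.
have phiT u : phi u = transl (e u).
  have : range phi (phi u) by exists u.
  by rewrite phiR => -[_ /translation_linear_part /transl_linear_part].
have eD u u' : e (u + u') = e u + e u'.
  by rewrite /e phiM -[LHS]/(phi u (phi u' 0)) {1}(phiT u) /= addrC.
have eI : injective e by move=> u u' h; apply: phiI; rewrite !phiT h.
have e0 : e 0 = 0 by apply: (addIr (e 0)); rewrite -eD !add0r.
pose w1 := e (1%R, 0); pose w2 := e (0, 1%R).
have eE m n : e (m, n) = (w1 *~ m + w2 *~ n)%R.
  have -> : (m, n) = (m, 0) + (0, n) :> (int * int)%type by congr pair; rewrite ?addr0 ?add0r.
  rewrite eD; congr (_ + _).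
    by apply: (@int_additive (fun m => e (m, 0))) => a b; rewrite -eD; congr (e (_, _)).
  by apply: (@int_additive (fun n => e (0, n))) => a b; rewrite -eD; congr (e (_, _)).
have latE v : lattice w1 w2 v <-> transl v \in G.
  split=> [[m [n ->]]|vG].
    rewrite -eE -phiT; have : range phi (phi (m, n)) by exists (m, n).
    by rewrite phiR => -[].
  have : [set g | g \in G /\ is_translation g] (transl v).
    by split=> //; exists v.
  rewrite -phiR => -[[m n] _ h]; exists m, n; rewrite -eE /e h /= add0r //.
exists w1, w2; split=> //; apply/eqP => det0.
have w10 : w1 != 0.
  by apply/eqP => h; have : (1%R, 0) = 0 :> (int * int)%type by apply: eI; rewrite e0.
(* If w1 and w2 were dependent, a small non-trivial combination m + n a would contradict
   discreteness or the injectivity of phi. *)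
have [a aE] : exists a : R, w2 = a *: w1.
  have [c0|c0] : (w1 0 0 != 0)%R \/ (w1 0 1 != 0)%R.
    have [z0|] := eqVneq (w1 0%R 0%R) 0%R; last by left.
    by right; apply/eqP => z1; move/eqP: w10; apply; apply: vec2P; rewrite ?z0 ?z1 mxE.
  - exists (w2 0%R 0%R / w1 0%R 0%R)%R; apply: vec2P; rewrite mxE ?divfK//.
    by apply: (mulIf c0); rewrite [RHS]mulrAC divfK//; lra.
  - exists (w2 0%R 1%R / w1 0%R 1%R)%R; apply: vec2P; rewrite mxE ?divfK//.
    by apply: (mulIf c0); rewrite [RHS]mulrAC divfK//; lra.
have [d d0 dP] := discrete_short dG w10.
have [m [n [mn small]]] := dirichlet a d0.
have c0 := dP _ small.
have vE : (m%:~R + n%:~R * a)%R *: w1 = e (m, n).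
  by rewrite eE aE scalerDl -scalerA !scaler_int.
have /c0 s0 : transl ((m%:~R + n%:~R * a)%R *: w1) \in G.
  by apply/latE; exists m, n; rewrite vE eE.
move/eqP: mn; apply; apply: eI.
by rewrite -vE s0 scale0r -[LHS]e0.
Qed.

Lemma wp_crystal : exists w1 w2, crystal wp_lin wp_pt wp_tau w1 w2.
Proof.
have [w1 [w2 [w12 latE]]] := wp_lattice; exists w1, w2; split=> //.
- exact: wp_linM.
- by move=> x y; rewrite /wp_pt valM -[LHS]/(val x (val y 0)) (wpE x (val y 0)) addrC.
- move=> x y lxy pxy; apply: val_inj; apply: bijectionP => v.
  by rewrite !wpE lxy pxy.
- exact: wp_isom.
- move=> v /latE vG; have vE : val (wp_tau v) = transl v by rewrite /wp_tau insubdK.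
  by split; rewrite /wp_lin /wp_pt vE ?transl_linear_part //= add0r.
- move=> x /transl_linear_part xE; apply/latE; rewrite -xE; exact: (valP x).
Qed.

Lemma val_expg x n : val (x ^+ n) = val x ^+ n.
Proof. by elim: n => [|n IH]; [rewrite !expg0|rewrite !expgS valM IH]. Qed.

End Wallpaper.

(** * From linear parts back to rotations and their orders *)

Section Main.
Variable R : realType.
Notation V := 'rV[R]_2.
Notation B := (bijection V).
Variable G : groupClosed B.
Hypothesis hG : wallpaper_group G.
Notation gT := (elts G).
Implicit Types (v w : V) (x y : gT).
Notation lin := (@wp_lin R G).

Let isoL := wp_isom hG.

Lemma rotation_rotn x : is_rotation (val x) -> rotn (lin x) /\ exists c, val x c = c.
Proof. by move=> [c [t h]]; have [h1 h2] := rotate_rotn h; split=> //; exists c. Qed.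

Lemma only_rotations : (forall g : B, g \in G -> is_translation g \/ is_rotation g) <->
  forall x, rotn (lin x).
Proof.
split=> [h x|h g gG].
  have [/translation_linear_part e|/rotation_rotn[]//] := h _ (valP x).
  by rewrite /wp_lin e; exact: rotn1.
pose x : gT := mk_elt gG; have hx : rotn (linear_part g) := h x.
have [e|e] := pselect (linear_part g = 1); [left; exact/translation_linear_part|right].
(* c is the fixed point of g. *)
have [c cE] := rotn_sub_onto hx e (- g 0).
apply: (rotn_rotation (c := c) hx).
rewrite affineE; vsplit cE; vlra.
Qed.

Lemma order_noncentral x n : is_rotation (val x) -> has_order (val x) n -> (2 < n)%N ->
  rotn (lin x) /\ ~ central lin x.
Proof.
move=> /rotation_rotn[hx [c xc]] [_ _ h] n2; split=> //.
have [w1 [w2 cr]] := wp_crystal hG; case=> e.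
  have x1 : val x = 1.
    move/transl_linear_part: (e) => xE; rewrite xE in xc *.
    have p0 : val x 0 = 0 by apply: (addrI c); rewrite addr0 -[RHS]xc.
    by rewrite p0; apply: bijectionP => z /=; rewrite addr0.
  by have := h 1%N; rewrite (ltnW n2) x1 expg1 eqxx => /(_ isT).
have x2 : x * x = 1 by exact: half_turn_invol cr x e.
by have := h 2%N; rewrite n2 expg2 -valM x2 eqxx => /(_ isT).
Qed.

Lemma has_order_val x n : has_order (val x) n <-> has_order x n.
Proof.
split=> -[n0 xn h]; split=> //.
- by apply: val_inj; rewrite val_expg.
- by move=> m /h; apply: contraNN => /eqP e; rewrite -val_expg e.
- by rewrite -val_expg xn.
- by move=> m /h; apply: contraNN => /eqP e; apply/eqP/val_inj; rewrite val_expg.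
Qed.

Lemma weak_cayley_eq : (forall f, weak_cayley gT f -> {morph f : x y / x * y >-> x * y} \/ antimorph f) ->
  weak_cayley gT = weak_cayley0 gT.
Proof.
by move=> h; apply/seteqP; split=> f; [move=> /h/weak_cayley0E|exact: weak_cayley0_sub].
Qed.

Lemma refl_or_rotations : (exists y, refl (lin y)) \/ forall x, rotn (lin x).
Proof.
have [|no] := pselect (exists y, refl (lin y)); [by left|right=> x].
by have [//|h] := isoL x; case: no; exists x.
Qed.

Lemma wallpaper_nontrivial : weak_cayley gT <> weak_cayley0 gT <->
  product_of_nonabelian gT \/
  ((forall g : B, g \in G -> is_translation g \/ is_rotation g) /\
   (exists (g : B) (n : nat), [/\ g \in G, is_rotation g, has_order g n & (2 < n)%N])).
Proof.
have [w1 [w2 cr]] := wp_crystal hG; split=> [W0|[|[/only_rotations rot [g [n [gG rg og n2]]]]]].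
- have [[y hy]|rot] := refl_or_rotations.
    left; apply: contrapT => np; apply: W0; apply: weak_cayley_eq => f fW.
    by have [//|[]] := wc_refl_cases cr fW hy.
  right; split; first exact/only_rotations.
  have [x cx] : exists x, ~ central lin x.
    apply: contrapT => no; apply: W0; apply: weak_cayley_eq => f.
    by apply: (wc_half_turns cr) => x; apply: contrapT => cx; apply: no; exists x.
  have [n [xn n2]] := noncentral_order cr rot cx.
  have lx : lin x <> 1 by move=> e; apply: cx; left.
  have [/translation_linear_part//|rx] := (proj2 only_rotations rot) (val x) (valP x).
  exists (val x), n; split=> //; [exact: (valP x)|exact/has_order_val].
- exact: product_nontrivial.
- have [_ cx] := @order_noncentral (mk_elt gG) n rg og n2.
  exact: (rot_nontrivial cr rot cx).
Qed.

Lemma wallpaper_semidirect :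
  (exists (g : B) (n : nat), [/\ g \in G, is_rotation g, has_order g n & (4 <= n)%N]) ->
  exists N : groupClosed (bijection gT),
    (forall f, f \in N -> f <> 1 -> weak_cayley gT f /\ ~ weak_cayley0 gT f) /\
    semidirect (weak_cayley gT) N (weak_cayley0 gT).
Proof.
have [w1 [w2 cr]] := wp_crystal hG; move=> [g [n [gG rg og n4]]].
pose x : gT := mk_elt gG; have [hx cx] := @order_noncentral x n rg og (ltnW n4).
have [[y hy]|rot] := refl_or_rotations.
  (* A rotation of order at least 4 excludes the product case, where rotations have linear part 1 or
     -1; so there are no non-trivial maps and the trivial N works. *)
  apply: trivial_semidirect; apply: weak_cayley_eq => f fW.
  by have [//|[_ /(_ x hx)]] := wc_refl_cases cr fW hy.
have pr := order_principal cr rot cx (proj1 (has_order_val x n) og) n4.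
exact: (rot_semidirect cr rot pr).
Qed.

End Main.

Local Close Scope group_scope.
Local Close Scope ring_scope.
Local Close Scope classical_set_scope.

Theorem theorem1p1 (R : realType) (G : groupClosed (bijection 'rV[R]_2))
    (hG : wallpaper_group G) :
  (weak_cayley (elts G) <> weak_cayley0 (elts G) <->
     product_of_nonabelian (elts G) \/
     ((forall g : bijection 'rV[R]_2, g \in G ->
         is_translation g \/ is_rotation g) /\
      (exists (g : bijection 'rV[R]_2) (n : nat),
         [/\ g \in G, is_rotation g, has_order g n & (2 < n)%N]))) /\
  ((exists (g : bijection 'rV[R]_2) (n : nat),
      [/\ g \in G, is_rotation g, has_order g n & (4 <= n)%N]) ->
   exists N : groupClosed (bijection (elts G)),
     (forall f : bijection (elts G), f \in N -> f <> 1%g ->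
        weak_cayley (elts G) f /\ ~ weak_cayley0 (elts G) f) /\
     semidirect (weak_cayley (elts G)) N (weak_cayley0 (elts G))).
Proof. by split; [exact: wallpaper_nontrivial|exact: wallpaper_semidirect]. Qed.
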